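(* Let $X,U$ be Banach spaces, let $A:D(A)\subset X\to X$ generate an analytic semigroup $T=(T(t))_{t\ge0}$ on $X$, and let $\mathcal{U}:=L^\infty(\mathbb{R}_+,U)$. Assume: (A1) $\alpha\in(0,1)$; (A2) $B\in L(U,X_{-1+\alpha+\varepsilon})$ for sufficiently small $\varepsilon>0$; (A3) $f\in C(X_\alpha\times U,X)$, and for each $r>0$ there is $L=L(r)>0$ such that $\|f(x_1,u)-f(x_2,u)\|_X\le L\|x_1-x_2\|_{X_\alpha}$ for all $x_1,x_2\in X_\alpha$ with $\|x_1\|_{X_\alpha},\|x_2\|_{X_\alpha}<r$ and all $u\in U$ with $\|u\|_U<r$; (A4) for all $u\in L^\infty(\mathbb{R}_+,U)$ and any $x\in C(\mathbb{R}_+,X)$ with $x((0,+\infty))\subset X_\alpha$, the map $s\mapsto f(x(s),u(s))$ is in $L^p_{loc}(\mathbb{R}_+,X)$ with a certain $p>\frac1{1-\alpha}$; (A5) there are $\sigma\in\mathcal{K}_\infty$ and $c>0$ with $\|f(0,u)\|_X\le\sigma(\|u\|_U)+c$ for all $u\in U$. Consider the system $\dot x(t)=Ax(t)+f(x(t),u(t))+Bu(t)$, $x(0)=x_0$. Then: (i) For each $x\in X_\alpha$ and each $u\in\mathcal{U}$ there is a unique maximal mild solution with initial state $x$ and input $u$, defined over a certain maximal time interval $[0,t_m(x,u))$; denote it by $\phi(\cdot,x,u)$. (ii) The triple $\Sigma:=(X_\alpha,\mathcal{U},\phi)$ is a well-defined control system. (iii) $\Sigma$ satisfies the boundedness-implies-continuation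 property, that is, if for certain $x\in X_\alpha$ and $u\in\mathcal{U}$ we have $t_m(x,u)<\infty$, then $\|\phi(t,x,u)\|_{X_\alpha}\to\infty$ as $t\to t_m(x,u)-0$.
   Context: $\mathcal{K}_\infty$ is the set of continuous, strictly increasing, unbounded $\gamma:\mathbb{R}_+\to\mathbb{R}_+$ with $\gamma(0)=0$. $L^p_{loc}(\mathbb{R}_+,X)$: functions whose restriction to each $[0,t]$ is in $L^p([0,t],X)$ (Bochner). Let $\omega_0(T)$ be the growth bound of $T$, and fix $\omega>\omega_0(T)$. For $\alpha\ge0$: $X_\alpha:=D((\omega I-A)^\alpha)$ with norm $\|x\|_{X_\alpha}:=\|(\omega I-A)^\alpha x\|_X$; for $\beta>0$: $X_{-\beta}$ is the completion of $X$ in the norm $x\mapsto\|(\omega I-A)^{-\beta}x\|_X$ (so $X_{-1+\alpha+\varepsilon}\subset X_{-1}$ continuously when $0<\alpha+\varepsilon<1$). $T_{-1}$ is the unique extension of $T$ to a $C_0$-semigroup on $X_{-1}$. A mild solution on $[0,\tau]$ is a function $x\in C([0,\tau],X)$ with $x(s)\in X_\alpha$ for $s\in(0,\tau]$ such that for all $t\in[0,\tau]$ $$x(t)=T(t)x_0+\int_0^tT(t-s)f(x(s),u(s))\,ds+\int_0^tT_{-1}(t-s)Bu(s)\,ds.$$ A function on $[0,t_1)$ is a mild solution if its restriction to $[0,\tau]$ is one for every $\tau\in(0,t_1)$; a mild solution is maximal if it cannot be extended to a mild solution (same $x_0,u$) on a larger interval. Control system: a triple $\Sigma=(Z,\mathcal{U},\phi)$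 where (1) $Z$ is a normed vector space (state space); (2) $\mathcal{U}\subset\{u:\mathbb{R}_+\to U\}$ is a normed vector space of inputs such that: (shift invariance) for all $u\in\mathcal{U}$, $\tau\ge0$, $u(\cdot+\tau)\in\mathcal{U}$ with $\|u\|_{\mathcal{U}}\ge\|u(\cdot+\tau)\|_{\mathcal{U}}$; (concatenation) for all $u_1,u_2\in\mathcal{U}$ and $t>0$, the function equal to $u_1(\tau)$ for $\tau\in[0,t]$ and to $u_2(\tau-t)$ for $\tau>t$ belongs to $\mathcal{U}$; (3) $\phi:D_\phi\to Z$, $D_\phi\subseteq\mathbb{R}_+\times Z\times\mathcal{U}$, is such that for all $(x,u)\in Z\times\mathcal{U}$ one has $D_\phi\cap(\mathbb{R}_+\times\{(x,u)\})=[0,t_m)\times\{(x,u)\}$ for some $t_m=t_m(x,u)\in(0,+\infty]$; and the following hold: identity: $\phi(0,x,u)=x$; causality: for every $(t,x,u)\in D_\phi$ and every $\tilde u\in\mathcal{U}$ with $u=\tilde u$ on $[0,t]$, one has $[0,t]\times\{(x,\tilde u)\}\subset D_\phi$ and $\phi(t,x,u)=\phi(t,x,\tilde u)$; continuity: each $t\mapsto\phi(t,x,u)$ is continuous (in $Z$) on $[0,t_m(x,u))$; cocycle property: for all $x\in Z$, $u\in\mathcal{U}$, $t,h\ge0$ with $[0,t+h]\times\{(x,u)\}\subset D_\phi$, $\phi(h,\phi(t,x,u),u(t+\cdot))=\phi(t+h,x,u)$. *)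

(* Defs.v *)
From HB Require Import structures.
From mathcomp Require Import all_boot all_order all_algebra.
From mathcomp Require Import complex.
From mathcomp Require Import all_classical all_reals all_analysis ess_sup_inf.

Set Implicit Arguments.
Unset Strict Implicit.
Unset Printing Implicit Defensive.

Import Order.TTheory GRing.Theory Num.Theory.
Import numFieldNormedType.Exports.

Local Open Scope classical_set_scope.
Local Open Scope ring_scope.

(* Functions on R_+ are functions on R whose values at negative arguments are
   irrelevant.  Banach spaces are taken over the reals; a complex Banach space
   is covered by restriction of scalars (see [analytic] below). *)

Section Bochner.
Variables (R : realType) (X : normedModType R).
Implicit Types (D : set R) (g s : R -> X).

Notation mu := (@lebesgue_measure R).

Definition simple_function s :=
  finite_set (range s) /\
  forall y, measurable (s @^-1` [set y] : set (measurableTypeR R)).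

(* Borel simple functions with almost-everywhere convergence give the usual
   strong Lebesgue measurability. *)
Definition strongly_measurable D g :=
  exists s : nat -> R -> X, (forall n, simple_function (s n)) /\
    {ae mu, forall t, D t -> s n t @[n --> \oo] --> g t}.

Definition simple_integrable D s :=
  simple_function s /\
  forall y, y != 0 -> (mu (D `&` s @^-1` [set y]) < +oo)%E.

Definition simple_integral D s : X :=
  \sum_(y \in range s) fine (mu (D `&` s @^-1` [set y])) *: y.

(* [v] is the Bochner integral of [g] over [D]; in particular [g] is Bochner
   integrable over [D].  The a.e. convergence makes t |-> `|g t - s n t| a.e.
   equal to a Borel function on [D], so its integral is the usual one. *)
Definition is_bochner D g (v : X) :=
  exists s : nat -> R -> X,
  [/\ forall n, simple_integrable D (s n),
      {ae mu, forall t, D t -> s n t @[n --> \oo] --> g t},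
      (\int[mu]_(t in D) (`|g t - s n t|)%:E)%E @[n --> \oo] --> 0%E &
      simple_integral D (s n) @[n --> \oo] --> v].

Definition bochner D g : X := xget 0 [set v | is_bochner D g v].

Definition Lp_loc (p : R) g := forall t, 0 <= t ->
  strongly_measurable `[0, t] g /\
  (\int[mu]_(s in `[0%R, t]) (`|g s| `^ p)%:E < +oo)%E.

(* L^oo(R_+, X), by representatives; [Linf_norm] is the essential supremum
   over R_+, hence vanishes exactly on functions that are 0 a.e. on R_+. *)
Definition Linf_ess g : \bar R :=
  ess_sup mu (fun t => (\1_`[0%R, +oo[ t * `|g t|)%:E).

Definition Linf : set (R -> X) :=
  [set g | strongly_measurable `[0, +oo[ g /\ (Linf_ess g < +oo)%E].

Definition Linf_norm g : R := fine (Linf_ess g).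

End Bochner.

Section Semigroups.
Variables (R : realType) (X : normedModType R).
Implicit Types (T : R -> X -> X).

Definition bounded_operator (Y Z : normedModType R) (S : Y -> Z) :=
  linear S /\ continuous S.

Definition C0_semigroup T :=
  [/\ forall t, 0 <= t -> bounded_operator (T t),
      forall x, T 0 x = x,
      forall t s, 0 <= t -> 0 <= s -> forall x, T (t + s) x = T t (T s x) &
      forall x, T t x @[t --> 0^'+] --> x].

(* The unbounded operator A with domain DA; the values of A outside DA are
   irrelevant. *)
Definition is_generator T (DA : set X) (A : X -> X) :=
  (forall x, DA x <->
     exists y : X, t^-1 *: (T t x - x) @[t --> 0^'+] --> y) /\
  (forall x, DA x -> t^-1 *: (T t x - x) @[t --> 0^'+] --> A x).

Definition growth_bound T : \bar R :=
  ereal_inf [set w%:E | w in [set w : R | exists M : R,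
    forall t, 0 <= t -> forall x, `|T t x| <= M * expR (w * t) * `|x|]].

(* The complexification of X is X * X, (x, y) standing for x + i y.  Its norm
   as a product is equivalent to the usual ones. *)
Definition cscale (z : R[i]) (p : X * X) : X * X :=
  (complex.Re z *: p.1 - complex.Im z *: p.2,
   complex.Re z *: p.2 + complex.Im z *: p.1).

Definition cbounded_operator (S : X * X -> X * X) :=
  [/\ forall p q, S (p + q) = S p + S q,
      forall z p, S (cscale z p) = cscale z (S p) & continuous S].

(* The open sector {z != 0, |arg z| < arctan m}, for 0 < m. *)
Definition sector (m : R) : set R[i] :=
  [set z | `|complex.Im z| < m * complex.Re z].

(* T extends to a family of operators on an open sector around ]0, +oo[ that
   is holomorphic for the operator norm, satisfies the semigroup law, and is
   strongly continuous at 0 on every smaller sector.  The extension acts on the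
   complexification of X.  If X is a complex Banach space and T consists of
   complex-linear operators, the complexification is the direct sum of X and
   its conjugate space, and this amounts to an extension acting on X itself. *)
Definition analytic T :=
  exists (m : R) (S : R[i] -> X * X -> X * X), 0 < m /\
  [/\ forall z, sector m z -> cbounded_operator (S z),
      forall t, 0 < t -> forall p, S (t%:C)%C p = (T t p.1, T t p.2),
      forall z w, sector m z -> sector m w ->
        forall p, S (z + w) p = S z (S w p),
      forall z, sector m z -> exists2 D, cbounded_operator D &
        forall e, 0 < e -> exists2 d, 0 < d &
          forall h, ComplexField.Normc.normc h < d -> sector m (z + h) ->
            forall p, `|S (z + h) p - S z p - cscale h (D p)|
                      <= e * ComplexField.Normc.normc h * `|p| &
      forall m', 0 < m' -> m' < m -> forall p e, 0 < e ->
        exists2 d, 0 < d & forall z, sector m' z ->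
          ComplexField.Normc.normc z < d -> `|S z p - p| < e].

Definition generates_analytic_semigroup (DA : set X) (A : X -> X) T :=
  [/\ C0_semigroup T, is_generator T DA A & analytic T].

End Semigroups.

Section FractionalPowers.
Variables (R : realType) (X : normedModType R).
Variables (T : R -> X -> X) (omega : R).

Definition gamma_fun (b : R) : R :=
  Rintegral (@lebesgue_measure R) `]0, +oo[
    (fun t => t `^ (b - 1) * expR (- t)).

(* (omega I - A)^{-b}, b > 0, where A generates T and growth_bound T < omega:
   C^{-b} = Gamma(b)^{-1} \int_0^oo t^{b-1} e^{-tC} dt with C = omega I - A, so
   that e^{-tC} = e^{-omega t} T(t). *)
Definition fracpow_neg (b : R) (x : X) : X :=
  (gamma_fun b)^-1 *:
    bochner `]0, +oo[ (fun t => (t `^ (b - 1) * expR (- (omega * t))) *: T t x).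

(* D((omega I - A)^a), a > 0: (omega I - A)^a is the inverse of the injective
   operator (omega I - A)^{-a}. *)
Definition Xpow (a : R) : set X := range (fracpow_neg a).

Definition fracpow (a : R) (x : X) : X := xget 0 [set y | fracpow_neg a y = x].

Definition Xpow_norm (a : R) (x : X) : R := `|fracpow a x|.

Definition Xpow_neg_norm (b : R) (x : X) : R := `|fracpow_neg b x|.

End FractionalPowers.

(* Y together with j is a completion of X for the norm n. *)
Definition is_completion (R : realType) (X : lmodType R) (n : X -> R)
    (Y : completeNormedModType R) (j : {linear X -> Y}) :=
  (forall x, `|j x| = n x) /\ dense (range j).

Section MildSolutions.
Variables (R : realType) (X U Xm1 : normedModType R).
Variables (Xa : set X) (T : R -> X -> X).
Variables (jm1 : X -> Xm1) (Tm1 : R -> Xm1 -> Xm1).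
Variables (f : X -> U -> X) (B : U -> Xm1).
Variables (x0 : X) (u : R -> U).

(* The equation is read in Xm1, into which X embeds by jm1. *)
Definition mild_solution (tau : R) (x : R -> X) :=
  [/\ {within `[0, tau], continuous x},
      forall s, 0 < s <= tau -> Xa (x s) &
      forall t, 0 <= t <= tau -> exists (v : X) (w : Xm1),
        [/\ is_bochner `[0, t] (fun s => T (t - s) (f (x s) (u s))) v,
            is_bochner `[0, t] (fun s => Tm1 (t - s) (B (u s))) w &
            jm1 (x t) = jm1 (T t x0 + v) + w]].

Definition Ico0 (t1 : \bar R) : set R := [set t | 0 <= t /\ (t%:E < t1)%E].

Definition time_interval (J : set R) :=
  (exists2 tau : R, 0 < tau & J = `[0, tau]%classic) \/
  (exists2 t1 : \bar R, (0 < t1)%E & J = Ico0 t1).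

Definition mild_solution_on (J : set R) (x : R -> X) :=
  time_interval J /\
  forall tau, 0 < tau -> J tau -> mild_solution tau x.

Definition maximal_mild_solution (J : set R) (x : R -> X) :=
  mild_solution_on J x /\
  forall J' y, mild_solution_on J' y -> J `<=` J' ->
    (forall t, J t -> y t = x t) -> J' = J.

End MildSolutions.

Section ControlSystems.
Variables (R : realType).

(* A subspace S of the ambient space E with a (semi)norm n on it. *)
Definition seminormed_space (E : lmodType R) (S : set E) (n : E -> R) :=
  [/\ S 0,
      forall a x y, S x -> S y -> S (a *: x + y),
      forall x, S x -> 0 <= n x,
      forall a x, S x -> n (a *: x) = `|a| * n x &
      forall x y, S x -> S y -> n (x + y) <= n x + n y].

Definition normed_space (E : lmodType R) (S : set E) (n : E -> R) :=
  seminormed_space S n /\ forall x, S x -> n x = 0 -> x = 0.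

Variables (V U : lmodType R).

Definition shift_input (tau : R) (u : R -> U) : R -> U := fun s => u (s + tau).

Definition concat_input (t : R) (u1 u2 : R -> U) : R -> U :=
  fun s => if s <= t then u1 s else u2 (s - t).

(* The normed space of inputs is given by representatives: IU is a space of
   functions with a seminorm nU, and u, v in IU are the same input when
   nU (u - v) = 0.  Accordingly u and v are equal on [0, t] when some
   representative of v coincides with u at every point of [0, t]; for L^oo this
   is equality a.e. on [0, t]. *)
Definition input_eq_upto (IU : set (R -> U)) (nU : (R -> U) -> R)
    (t : R) (u v : R -> U) :=
  exists w, [/\ IU w, nU (w - v) = 0 & forall s, 0 <= s <= t -> w s = u s].

(* [phi] is total here; only its values on [Dphi] are meaningful.  Causality
   implies that [Dphi] and [phi] do not depend on the representative of u. *)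
Definition control_system (Z : set V) (nZ : V -> R)
    (IU : set (R -> U)) (nU : (R -> U) -> R)
    (Dphi : set (R * V * (R -> U))) (phi : R -> V -> (R -> U) -> V) :=
  [/\ normed_space Z nZ,
      seminormed_space IU nU,
      forall u tau, IU u -> 0 <= tau ->
        IU (shift_input tau u) /\ nU (shift_input tau u) <= nU u &
      forall u1 u2 t, IU u1 -> IU u2 -> 0 < t -> IU (concat_input t u1 u2)] /\
  [/\ forall t x u, Dphi (t, x, u) -> [/\ 0 <= t, Z x & IU u],
      forall t x u, Dphi (t, x, u) -> Z (phi t x u) &
      forall x u, Z x -> IU u -> exists2 tm : \bar R, (0 < tm)%E &
        forall t, Dphi (t, x, u) <-> Ico0 tm t] /\
  [/\ forall x u, Z x -> IU u -> phi 0 x u = x,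
      forall t x u v, Dphi (t, x, u) -> IU v -> input_eq_upto IU nU t u v ->
        (forall s, 0 <= s <= t -> Dphi (s, x, v)) /\ phi t x u = phi t x v,
      forall t x u, Dphi (t, x, u) -> forall e, 0 < e -> exists2 d, 0 < d &
        forall s, Dphi (s, x, u) -> `|s - t| < d ->
          nZ (phi s x u - phi t x u) < e &
      forall x u t h, Z x -> IU u -> 0 <= t -> 0 <= h ->
        (forall s, 0 <= s <= t + h -> Dphi (s, x, u)) ->
        Dphi (h, phi t x u, shift_input t u) /\
        phi h (phi t x u) (shift_input t u) = phi (t + h) x u].

End ControlSystems.

Definition K_infty (R : realType) (g : R -> R) :=
  [/\ g 0 = 0, {within `[0, +oo[, continuous g},
      forall r s, 0 <= r -> r < s -> g r < g s &
      forall M, exists2 r, 0 <= r & M < g r].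

(* Main.v *)
(* Put y = (omega - A)^alpha x.  Mild solutions become solutions of the Volterra
   equation
     y(t) = T(t) y(0) + \int_0^t (omega - A)^alpha T(t - s) f(x(s), u(s)) ds + ...
   whose kernel is bounded by K (t - s)^(-max(alpha, 1 - eps)): Cauchy's estimate on
   the sector of analyticity gives |A T(t)| <= K / t, and the representation of
   the negative powers as integrals of the semigroup interpolates this to
   |(omega - A)^alpha T(t)| <= K t^(-alpha).  The singularity is integrable, so
   Picard iteration applies on a time step that depends only on a bound of the
   initial state;
   hence solutions glue to a maximal one, and a maximal one of finite life span
   blows up.  Identities between Bochner integrals are tested against continuous
   linear functionals, which separate points by Hahn-Banach. *)
Require Import Defs.
From HB Require Import structures.
From mathcomp Require Import all_boot all_order all_algebra.
From mathcomp Require Import all_classical all_reals all_analysis.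
From mathcomp Require Import measurable_realfun ess_sup_inf.
From mathcomp Require Import ring lra.
From mathcomp Require complex.

Set Implicit Arguments.
Unset Strict Implicit.
Unset Printing Implicit Defensive.

Import Order.TTheory GRing.Theory Num.Theory.
Import numFieldNormedType.Exports.

Local Open Scope classical_set_scope.
Local Open Scope ring_scope.

(** * Bounded linear maps with an explicit constant *)

Section BoundedLinear.
Variable R : realType.

(** Negative powers are the only powers given by a formula, so identities for positive powers are
    verified after applying an injective negative one, and the composition law is recorded up to a
    nonzero factor. The control term lives in completions of X known only through their norms. With
    beta = 1 - (alpha + eps), the power of order -beta extends isometrically from X to X_{-beta};
    composed with B it is a bounded operator from U to X, and the control then enters through the
    kernel (omega I - A)^(alpha + beta) T(t), where alpha + beta = 1 - eps. Both forcing terms are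
    merged into one kernel acting on pairs. The delicate direction leads from mild solutions back to
    y: a mild solution is continuous in X and lies in X_alpha at positive times only, so y might be
    unbounded near 0, where local Lipschitz bounds say nothing. Here (A4) enters: p > 1/(1 - alpha)
    makes the kernel integrable to the conjugate power, which gives the continuity of y and with it
    uniqueness among all mild solutions. *)

Definition bounded_linear (Y Z : normedModType R) (C : R) (S : Y -> Z) :=
  (forall a x y, S (a *: x + y) = a *: S x + S y) /\
  forall x, `|S x| <= C * `|x|.

Lemma bounded_linearD (Y Z : normedModType R) C (S : Y -> Z) x y :
  bounded_linear C S -> S (x + y) = S x + S y.
Proof. by move=> [h _]; rewrite -[x]scale1r h !scale1r. Qed.

Lemma bounded_linear0 (Y Z : normedModType R) C (S : Y -> Z) :
  bounded_linear C S -> S 0 = 0.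
Proof.
by move=> [_ h]; apply/eqP; rewrite -normr_le0; have := h 0; rewrite normr0 mulr0.
Qed.

Lemma bounded_linearZ (Y Z : normedModType R) C (S : Y -> Z) a x :
  bounded_linear C S -> S (a *: x) = a *: S x.
Proof.
by move=> hS; have := hS.1 a x 0; rewrite addr0 (bounded_linear0 hS) addr0.
Qed.

Lemma bounded_linearN (Y Z : normedModType R) C (S : Y -> Z) x :
  bounded_linear C S -> S (- x) = - S x.
Proof. by move=> hS; rewrite -scaleN1r (bounded_linearZ _ _ hS) scaleN1r. Qed.

Lemma bounded_linearB (Y Z : normedModType R) C (S : Y -> Z) x y :
  bounded_linear C S -> S (x - y) = S x - S y.
Proof.
by move=> hS; rewrite (bounded_linearD _ _ hS) (bounded_linearN _ hS).
Qed.

Lemma bounded_linear_comp (W Y Z : normedModType R) C D (S : Y -> Z) (S' : W -> Y) :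
  0 <= C -> bounded_linear C S -> bounded_linear D S' ->
  bounded_linear (C * D) (S \o S').
Proof.
move=> C0 hS hS'; split => [a x y|x] /=; first by rewrite hS'.1 hS.1.
by rewrite (le_trans (hS.2 _))// -mulrA ler_wpM2l// hS'.2.
Qed.

(** The constant of [bounded_linear] carries no sign; this version is the one to use where products
    are compared. *)
Lemma bounded_linear_ge0 (Y Z : normedModType R) C (S : Y -> Z) :
  bounded_linear C S -> bounded_linear `|C| S.
Proof.
move=> [h1 h2]; split => // x; rewrite (le_trans (h2 x))//.
by rewrite ler_wpM2r// ler_norm.
Qed.

Lemma bounded_linear_continuous (Y Z : normedModType R) C (S : Y -> Z) :
  bounded_linear C S -> continuous S.
Proof.
move=> /bounded_linear_ge0 hS x; apply/cvgrPdist_lt => e e0.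
have C0 : 0 < `|C| + 1 by rewrite ltr_wpDl.
near=> y; rewrite -(bounded_linearB _ _ hS) (le_lt_trans (hS.2 _))//.
rewrite (@le_lt_trans _ _ ((`|C| + 1) * `|x - y|))//.
  by rewrite ler_wpM2r// lerDl.
rewrite -ltr_pdivlMl//; near: y.
by apply: cvgr_dist_lt; rewrite ?mulr_gt0 ?invr_gt0//; exact: cvg_id.
Unshelve. all: by end_near. Qed.

Lemma bounded_operatorP (Y Z : normedModType R) (S : Y -> Z) :
  bounded_operator S -> exists2 C, 0 < C & bounded_linear C S.
Proof.
move=> [lS cS].
pose f : {linear Y -> Z} := HB.pack S (GRing.isLinear.Build _ _ _ _ _ lS).
have /linear_boundedP[M [_ hM]] : bounded_near f (nbhs (0 : Y)).
  exact/linear_bounded_continuous.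
exists (`|M| + 1); first by rewrite ltr_wpDl.
split=> // x; apply: (hM (`|M| + 1)); rewrite (le_lt_trans (ler_norm M))//.
by rewrite ltrDl.
Qed.

End BoundedLinear.

(** * The Hahn-Banach theorem for the norm *)

Section HahnBanach.
Variables (R : realType) (X : normedModType R).
Implicit Types (G : set (X * R)) (x y : X).

(** Partial functionals are encoded by their graphs, so that extension is inclusion and the union of
    a chain is an upper bound for Zorn's lemma. That a graph is single valued follows from linearity
    and domination by the norm. *)
Let lin_graph G := forall c p q, G p -> G q -> G (c *: p.1 + q.1, c * p.2 + q.2).
Let dominated G := forall p, G p -> p.2 <= `|p.1|.

Let lin_graph_dom G p q : lin_graph G -> dominated G -> G p -> G q ->
  p.1 = q.1 -> p.2 = q.2.
Proof.
move=> lG dG Gp Gq pq; apply/eqP; rewrite eq_le; apply/andP; split.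
- have /dG := lG (-1) _ _ Gq Gp.
  by rewrite /= pq scaleN1r addNr normr0 mulN1r addrC subr_le0.
- have /dG := lG (-1) _ _ Gp Gq.
  by rewrite /= pq scaleN1r addNr normr0 mulN1r addrC subr_le0.
Qed.

(** The value at y must lie above all [p.2 - |p.1 - y|] and below all [|q.1 + y| - q.2]. The
    triangle inequality separates the two families, and the supremum of the first one is taken. *)
Let extension G y : G (0, 0) -> lin_graph G -> dominated G ->
  exists H, [/\ G `<=` H, lin_graph H, dominated H & exists a, H (y, a)].
Proof.
move=> G0 lG dG.
pose E := [set p.2 - `|p.1 - y| | p in G].
have bE q : G q -> ubound E (`|q.1 + y| - q.2).
  move=> Gq _ [p Gp <-].
  rewrite lerBlDr addrAC lerBrDr.
  have /dG/= := lG 1 _ _ Gp Gq; rewrite scale1r mul1r => /le_trans -> //.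
  rewrite (_ : p.1 + q.1 = (p.1 - y) + (q.1 + y)); last first.
    by rewrite addrACA [- y + _]addrC subrr addr0.
  by rewrite [leRHS]addrC ler_normD.
have E0 : E !=set0 by exists (0 - `|0 - y|); exists (0, 0).
pose r := sup E.
have r1 q : G q -> r <= `|q.1 + y| - q.2 by move=> Gq; apply: ge_sup => //; exact: bE.
have r2 p : G p -> p.2 - `|p.1 - y| <= r.
  move=> Gp; apply: ub_le_sup; last by exists p.
  by exists (`|(0 : X) + y| - 0); exact: (bE (0, 0)).
have GZ c p : G p -> G (c *: p.1, c * p.2).
  by move=> /(lG c _ _) /(_ G0); rewrite /= !addr0.
(* Dividing by |c| reduces domination at p + c y to the two inequalities for c = 1 and c = -1. *)
have key p c : G p -> p.2 + c * r <= `|p.1 + c *: y|.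
  move=> Gp; have [->|c0] := eqVneq c 0.
    by rewrite mul0r scale0r !addr0; exact: dG.
  have [cp|cn] := ltP 0 c.
    have /r1/= := GZ c^-1 _ Gp.
    rewrite lerBrDr -(ler_pM2l cp) mulrDr mulVKf// addrC => /le_trans; apply.
    by rewrite -{1}[c]gtr0_norm// -normrZ scalerDr scalerA divff// scale1r.
  have {}cn : 0 < - c by rewrite oppr_gt0 lt_neqAle c0.
  have /r2/= := GZ (- c)^-1 _ Gp.
  rewrite lerBlDr -(ler_pM2l cn) mulrDr mulrA divff ?oppr_eq0// mul1r.
  rewrite mulNr -lerBlDl opprK => /le_trans; apply.
  rewrite -{1}[- c]gtr0_norm// -normrZ scalerBr scalerA divff ?oppr_eq0//.
  by rewrite scale1r scaleNr opprK.
exists [set q | exists2 p, G p & exists c, q = (p.1 + c *: y, p.2 + c * r)].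
split.
- by move=> p Gp; exists p => //; exists 0; rewrite scale0r mul0r !addr0 -surjective_pairing.
- move=> c _ _ [p Gp [a ->]] [q Gq [b ->]].
  exists (c *: p.1 + q.1, c * p.2 + q.2); first exact: lG.
  exists (c * a + b) => /=; congr (_, _); last by ring.
  by rewrite scalerDr scalerDl scalerA addrACA.
- by move=> _ [p Gp [c ->]]; exact: key.
- by exists r, (0, 0) => //; exists 1; rewrite scale1r mul1r /= !add0r.
Qed.

Lemma norming_functional x : exists2 phi : X -> R^o,
  bounded_linear 1 phi & phi x = `|x|.
Proof.
pose G0 := [set (c *: x, c * `|x|) | c in [set: R]].
(* [Zorn_bigcup] also asks for the union of the empty chain, so the property must hold of the empty
   graph; adjoining [G0] to every graph achieves this and makes every candidate extend the
   functional on the line through x. *)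
pose P G := lin_graph (G `|` G0) /\ dominated (G `|` G0).
have PG0 : P set0.
  rewrite /P set0U; split.
    move=> c _ _ [a _ <-] [b _ <-]; exists (c * a + b) => //=; congr (_, _).
      by rewrite scalerDl scalerA.
    by ring.
  move=> _ [a _ <-] /=; rewrite normrZ ler_wpM2r//; exact: ler_norm.
have chain (F : set (set (X * R))) : F `<=` P -> total_on F subset -> P (\bigcup_(Y in F) Y).
  move=> FP Ftot.
  have [->|/set0P[Y0 FY0]] := eqVneq F set0; first by rewrite bigcup_set0.
  have in1 p : (\bigcup_(Y in F) Y `|` G0) p -> exists2 Y, F Y & (Y `|` G0) p.
    by move=> [[Y FY Yp]|G0p]; [exists Y => //; left|exists Y0 => //; right].
  have in2 p Y : F Y -> (Y `|` G0) p -> (\bigcup_(Y in F) Y `|` G0) p.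
    by move=> FY [Yp|]; [left; exists Y|right].
  split=> [c p q /in1[Y FY Yp] /in1[Z FZ Zq]|p /in1[Y FY Yp]].
    have [YZ|ZY] := Ftot _ _ FY FZ.
      by apply: (in2 _ _ FZ); apply: (FP _ FZ).1 => //; exact: (setSU YZ Yp).
    by apply: (in2 _ _ FY); apply: (FP _ FY).1 => //; exact: (setSU ZY Zq).
  exact: (FP _ FY).2.
have [G [[lG dG] Gmax]] := Zorn_bigcup chain.
set H := G `|` G0 in lG dG.
have G0H : G0 `<=` H by right.
have H0 : H (0, 0) by apply: G0H; exists 0 => //; rewrite scale0r mul0r.
have tot y : exists a, H (y, a).
  have [K [HK lK dK [a Ka]]] := extension y H0 lG dG.
  exists a; apply: contrapT => nHa.
  have KG0 : K `|` G0 = K by apply/setUidPl => p /G0H/HK.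
  apply: (Gmax K); last by rewrite /P KG0.
  split; first by move=> p Gp; apply: HK; left.
  by move=> /(_ _ Ka) Ga; apply: nHa; left.
have [phi phiP] := choice tot.
have phiE y a : H (y, a) -> phi y = a.
  by move=> Ha; exact: (lin_graph_dom lG dG (phiP y) Ha).
have philin a y z : phi (a *: y + z) = a * phi y + phi z.
  by apply: phiE; exact: (lG a _ _ (phiP y) (phiP z)).
exists phi; last by apply: phiE; apply: G0H; exists 1; rewrite ?scale1r ?mul1r.
split=> // y; rewrite mul1r ler_norml; apply/andP; split; last exact: (dG _ (phiP y)).
have phi0 : phi 0 = 0 by exact: phiE.
have phiN : phi (- y) = - phi y.
  by have := philin (-1) y 0; rewrite addr0 scaleN1r phi0 addr0 mulN1r.
by rewrite lerNl -phiN -[leRHS]normrN; exact: (dG _ (phiP (- y))).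
Qed.

Lemma functional_separation x y :
  (forall phi : X -> R^o, bounded_linear 1 phi -> phi x = phi y) -> x = y.
Proof.
move=> h; have [phi hphi phixy] := norming_functional (x - y).
apply/eqP; rewrite -subr_eq0 -normr_eq0 -phixy.
by rewrite (bounded_linearB _ _ hphi) (h _ hphi) subrr.
Qed.

End HahnBanach.

(** * Simple functions with values in normed spaces *)

Section SimpleFunctions.
Variables (R : realType).

Lemma simple_preimage (X : normedModType R) (s : R -> X) (B : set X) :
  simple_function s -> measurable (s @^-1` B : set (measurableTypeR R)).
Proof.
move=> [fs ms]; rewrite (_ : _ @^-1` _ = \bigcup_(y in range s `&` B) s @^-1` [set y]).
  apply: fin_bigcup_measurable => [|y _]; last exact: ms.
  exact: finite_setIl.
apply/seteqP; split=> t /=; first by move=> Bt; exists (s t) => //; split => //; exists t.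
by move=> [y [_ By] /= ->].
Qed.

Lemma simple_comp (X Y : normedModType R) (k : X -> Y) (s : R -> X) :
  simple_function s -> simple_function (k \o s).
Proof.
move=> hs; split; last first.
  by move=> y; rewrite comp_preimage; exact: simple_preimage.
rewrite (_ : range _ = k @` range s); first by apply: finite_image; exact: hs.1.
by rewrite image_comp.
Qed.

Lemma simple_pair (X Y : normedModType R) (s : R -> X) (s' : R -> Y) :
  simple_function s -> simple_function s' ->
  simple_function (fun t => (s t, s' t)).
Proof.
move=> hs hs'; split.
  apply: (sub_finite_set (B := range s `*` range s')); last first.
    by apply: finite_setX; [exact: hs.1|exact: hs'.1].
  by move=> _ [t _ <-]; split; exists t.
move=> [y z]; rewrite (_ : _ @^-1` _ = s @^-1` [set y] `&` s' @^-1` [set z]).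
  by apply: measurableI; [exact: hs.2|exact: hs'.2].
by apply/seteqP; split => t /= [-> ->].
Qed.

Lemma simple_comp2 (X Y Z : normedModType R) (op : X -> Y -> Z) (s : R -> X) (s' : R -> Y) :
  simple_function s -> simple_function s' ->
  simple_function (fun t => op (s t) (s' t)).
Proof.
move=> hs hs'.
exact: (simple_comp (fun p => op p.1 p.2) (simple_pair hs hs')).
Qed.

Lemma simple_cst (X : normedModType R) (x : X) : simple_function (fun=> x).
Proof.
split; first by apply: (sub_finite_set (B := [set x])) => // _ [t _ <-].
by move=> y; rewrite preimage_cst; case: ifP.
Qed.

Lemma simple_indic (A : set (measurableTypeR R)) : measurable A ->
  simple_function (\1_A : R -> R^o).
Proof.
move=> mA; split.
  apply: (sub_finite_set (B := [set 0; 1])) => // _ [t _ <-] /=.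
  by rewrite indicE; case: (_ \in _); [right|left].
move=> y; rewrite preimage_indic.
by do !case: ifP => _ //; exact: measurableC.
Qed.

Lemma simple_restrict (X : normedModType R) (s : R -> X) (A : set (measurableTypeR R)) :
  measurable A -> simple_function s -> simple_function (fun t => if t \in A then s t else 0).
Proof.
move=> mA hs; rewrite (_ : (fun t => _) = fun t => (\1_A t : R^o) *: s t).
  by apply: (simple_comp2 (fun (a : R^o) x => a *: x)) => //; exact: simple_indic.
apply/funext => t; rewrite indicE.
by case: (t \in A) => /=; rewrite ?mulr1n ?mulr0n ?scale1r ?scale0r.
Qed.

Lemma simple_measurable_fun (s : R -> R^o) :
  simple_function s -> measurable_fun setT (s : measurableTypeR R -> R).
Proof. by move=> hs _ B mB; rewrite setTI; exact: (simple_preimage B hs). Qed.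

Lemma simple_measurable_comp (s : measurableTypeR R -> measurableTypeR R)
  (X : normedModType R) (g : R -> X) : measurable_fun setT s ->
  simple_function g -> simple_function (g \o s).
Proof.
move=> ms hg; split.
  by apply: sub_finite_set hg.1 => _ [t _ <-]; exists (s t).
move=> y; rewrite comp_preimage -[X in measurable X]setTI; apply: ms => //.
exact: hg.2.
Qed.

End SimpleFunctions.

(** * Integrals of nonnegative functions up to null sets *)

Section LowerIntegral.
Variable R : realType.
Notation mu := (@lebesgue_measure R).

Lemma aeS (P Q : R -> Prop) : (forall t, P t -> Q t) ->
  {ae mu, forall t, P t} -> {ae mu, forall t, Q t}.
Proof. exact: (@filterS _ _ (ae_filter_ringOfSetsType mu) P Q). Qed.

Lemma aeS2 (P Q S : R -> Prop) : (forall t, P t -> Q t -> S t) ->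
  {ae mu, forall t, P t} -> {ae mu, forall t, Q t} -> {ae mu, forall t, S t}.
Proof. exact: (@filterS2 _ _ (ae_filter_ringOfSetsType mu) P Q S). Qed.

Implicit Types (D : set (measurableTypeR R)) (f g : R -> \bar R).
Import HBNNSimple.
Local Open Scope ereal_scope.

(* The library's integral of a non-measurable nonnegative function is a lower
   integral, so no measurability is needed here. *)
Lemma ae_le_integral D f g : (forall t, D t -> 0 <= f t) -> (forall t, D t -> 0 <= g t) ->
  {ae mu, forall t, D t -> f t <= g t} ->
  \int[mu]_(t in D) f t <= \int[mu]_(t in D) g t.
Proof.
move=> f0 g0 [N [mN N0 hN]].
rewrite (ge0_integralE _ f0) (ge0_integralE _ g0).
apply: ge_ereal_sup => _ [h /= hf <-].
(* Setting the simple function to 0 on the exceptional null set keeps its integral and puts it below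
   g everywhere. *)
pose h' := proj_nnsfun h (measurableC mN).
have h'h t : ~ N t -> h' t = h t.
  by move=> Nt; rewrite /h' -mrestrict patchE mem_set.
have h'0 t : N t -> h' t = 0%R.
  by move=> Nt; rewrite /h' -mrestrict patchE memNset.
have -> : sintegral mu h = sintegral mu h'.
  have sT (k : {nnsfun measurableTypeR R >-> R}) : sintegral mu k = \int[mu]_t (k t)%:E.
    by rewrite integral_nnsfun// patch_setT.
  rewrite !sT.
  apply: ae_eq_integral => //; try exact/measurable_EFinP.
  exists N; split => // t /= ne; apply: contrapT => /h'h hh; apply: ne => _.
  exact: (f_equal EFin (esym hh)).
apply: ereal_sup_ubound; exists h'; last by [].
move=> t.
have [Nt|Nt] := pselect (N t).
  rewrite h'0// patchE; case: ifP => // /set_mem; exact: g0.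
rewrite h'h// (le_trans (hf t))// !patchE; case: ifP => // /set_mem Dt.
by apply: contrapT => ngf; apply: Nt; apply: hN => /= /(_ Dt).
Qed.

Lemma ae_eq_ge0_integral D f g :
  (forall t, D t -> 0 <= f t) -> (forall t, D t -> 0 <= g t) ->
  {ae mu, forall t, D t -> f t = g t} ->
  \int[mu]_(t in D) f t = \int[mu]_(t in D) g t.
Proof.
move=> f0 g0 fg; apply/eqP; rewrite eq_le; apply/andP; split; apply: ae_le_integral => //;
  by apply: aeS fg => t /[apply] ->.
Qed.

Lemma ae_eq_Rintegral D (f g : R -> R) : {ae mu, forall t, D t -> f t = g t} ->
  (\int[mu]_(t in D) f t = \int[mu]_(t in D) g t)%R.
Proof.
move=> fg; congr fine; rewrite integralE [RHS]integralE; congr (_ - _);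
  by apply: ae_eq_ge0_integral => //; apply: aeS fg => t /[apply];
     rewrite !(funeposE, funenegE) => ->.
Qed.

End LowerIntegral.

(** * Everywhere limits of simple functions *)

Section NiceFunctions.
Variables (R : realType).
Notation mu := (@lebesgue_measure R).

(** Convergence everywhere, instead of almost everywhere as in [strongly_measurable], makes norms
    and continuous functionals of the function Borel, so that scalar integration applies.
    [nice_representative] passes from one notion to the other. *)
Definition nice (X : normedModType R) (g : R -> X) := exists s : nat -> R -> X,
  (forall n, simple_function (s n)) /\ forall t, s n t @[n --> \oo] --> g t.

Lemma nice_pair (X Y : normedModType R) (g : R -> X) (h : R -> Y) :
  nice g -> nice h -> nice (fun t => (g t, h t)).
Proof.
move=> [s [hs sg]] [r [hr rh]]; exists (fun n t => (s n t, r n t)); split.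
  by move=> n; exact: simple_pair.
by move=> t; apply: (@cvg_pair _ _ _ _ (nbhs (g t)) (nbhs (h t))); [exact: sg|exact: rh].
Qed.

Lemma nice_comp (X Y : normedModType R) (k : X -> Y) (g : R -> X) :
  continuous k -> nice g -> nice (k \o g).
Proof.
move=> ck [s [hs sg]]; exists (fun n => k \o s n); split.
  by move=> n; exact: simple_comp.
by move=> t; apply: (@cvg_comp _ _ _ (fun n => s n t) k _ (nbhs (g t))) => //; [exact: sg|exact: ck].
Qed.

Lemma nice_measurable (g : R -> R^o) : nice g -> measurable_fun setT (g : measurableTypeR R -> R).
Proof.
move=> [s [hs sg]]; apply/measurable_EFinP.
apply: (emeasurable_fun_cvg (fun n => EFin \o (s n : measurableTypeR R -> R))).
  by move=> n; apply/measurable_EFinP; exact: simple_measurable_fun.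
by move=> t _; apply: cvg_EFin; [exact: nearW|exact: sg].
Qed.

Lemma nice_norm (X : normedModType R) (g : R -> X) : nice g ->
  measurable_fun setT ((fun t => `|g t|) : measurableTypeR R -> R).
Proof.
move=> hg; apply: (@nice_measurable (Num.norm \o g)).
by apply: nice_comp hg; exact: norm_continuous.
Qed.

Lemma nice_sub (X : normedModType R) (g h : R -> X) : nice g -> nice h -> nice (fun t => g t - h t).
Proof.
move=> hg hh.
apply: (nice_comp (k := fun p : X * X => p.1 - p.2) _ (nice_pair hg hh)) => p.
apply: cvgB; [exact: cvg_fst|exact: cvg_snd].
Qed.

Lemma nice_simple (X : normedModType R) (s : R -> X) : simple_function s -> nice s.
Proof. by move=> hs; exists (fun=> s); split => // t; exact: cvg_cst. Qed.

Lemma strongly_measurable_nice (X : normedModType R) (D : set (measurableTypeR R)) (g : R -> X) :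
  nice g -> strongly_measurable D g.
Proof. by move=> [s [hs sg]]; exists s; split => //; apply: aeW => t _; exact: sg. Qed.

Lemma strongly_measurable_ae (X : normedModType R) (D : set (measurableTypeR R)) (g h : R -> X) :
  {ae mu, forall t, D t -> g t = h t} -> strongly_measurable D g -> strongly_measurable D h.
Proof.
move=> gh [s [hs sg]]; exists s; split => //.
by apply: aeS2 sg gh => t sg gh Dt; rewrite -gh//; exact: sg.
Qed.

Lemma strongly_measurableS (X : normedModType R) (D E : set (measurableTypeR R)) (g : R -> X) :
  E `<=` D -> strongly_measurable D g -> strongly_measurable E g.
Proof.
by move=> ED [s [hs sg]]; exists s; split => //; apply: aeS sg => t + /ED; exact.
Qed.

(** The approximations are multiplied by the indicator of D minus the exceptional null set. The
    value 0 outside D later allows unions and translates of domains to be handled by integrals over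
    a larger common set. *)
Lemma nice_representative (X : normedModType R) (D : set (measurableTypeR R)) (g : R -> X) :
  measurable D -> strongly_measurable D g ->
  exists2 h, nice h & {ae mu, forall t, D t -> g t = h t} /\ forall t, ~ D t -> h t = 0.
Proof.
move=> mD [s [hs [N [mN N0 hN]]]].
have mDN : measurable (D `\` N) by exact: measurableD.
exists (fun t => if t \in D `\` N then g t else 0); last split.
- exists (fun n t => if t \in D `\` N then s n t else 0); split => [n|t].
    exact: simple_restrict.
  have [/set_mem[Dt Nt]|_] := boolP (t \in D `\` N); last exact: cvg_cst.
  by apply: contrapT => ns; apply: Nt; apply: hN => /= /(_ Dt).
- exists N; split => // t /= /not_implyP[Dt]; apply: contra_notP => Nt.
  by rewrite mem_set.
- by move=> t Dt; rewrite memNset// => -[].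
Qed.

End NiceFunctions.

(** * The integral of simple functions seen through scalar functions *)

Section SimpleIntegral.
Variables (R : realType) (X : normedModType R).
Notation mu := (@lebesgue_measure R).
Variable D : set (measurableTypeR R).
Hypothesis mD : measurable D.

Lemma Rintegral_sum (I : Type) (l : seq I) (h : I -> R -> R) :
  (forall i, mu.-integrable D (EFin \o h i)) ->
  mu.-integrable D (EFin \o (fun t => \sum_(i <- l) h i t)) /\
  \int[mu]_(t in D) (\sum_(i <- l) h i t) = \sum_(i <- l) \int[mu]_(t in D) h i t.
Proof.
move=> hi; elim: l => [|i l [ih1 ih2]].
  split; first by apply: eq_integrable (integrable0 _ _) => // t _ /=; rewrite big_nil.
  rewrite big_nil; under eq_Rintegral do rewrite big_nil.
  by rewrite /Rintegral integral0.
split; first by apply: eq_integrable (integrableD mD (hi i) ih1) => // t _ /=; rewrite big_cons.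
rewrite big_cons -ih2 -RintegralD//.
by apply: eq_Rintegral => t _; rewrite big_cons.
Qed.

(** A general k with k 0 = 0 covers the norm and linear functionals at once. The level set of 0 may
    have infinite measure, and k 0 = 0 removes its contribution. *)
Lemma simple_integral_comp (k : X -> R) (s : R -> X) : k 0 = 0 -> simple_integrable D s ->
  mu.-integrable D (EFin \o (k \o s)) /\
  \int[mu]_(t in D) k (s t) =
    \sum_(y <- finmap.enum_fset (fset_set (range s))) fine (mu (D `&` s @^-1` [set y])) * k y.
Proof.
move=> k0 [[fs ms] fin]; set l := finmap.enum_fset _.
have E t : k (s t) = \sum_(y <- l) k y * \1_(s @^-1` [set y]) t.
  have tl : s t \in l by rewrite in_fset_set// inE; exists t.
  rewrite (bigD1_seq (s t)) ?finmap.fset_uniq//=.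
  rewrite indicE mem_set// mulr1 big1 ?addr0// => y yt.
  by rewrite indicE memNset ?mulr0// => /= st; rewrite st eqxx in yt.
have mA y : measurable (s @^-1` [set y] : set (measurableTypeR R)) by exact: ms.
have hI y : y != 0 -> mu.-integrable D (EFin \o (\1_(s @^-1` [set y]) : R -> R)).
  move=> y0; apply/integrableP; split.
    by apply/measurable_EFinP; apply: measurable_funTS; exact: measurable_indic.
  under eq_integral do rewrite /= ger0_norm//.
  by rewrite integral_indic// setIC; exact: fin.
have hi y : mu.-integrable D (EFin \o (fun t => k y * \1_(s @^-1` [set y]) t)).
  have [->|y0] := eqVneq y 0.
    by apply: eq_integrable (integrable0 _ _) => // t _ /=; rewrite k0 mul0r.
  by apply: eq_integrable (integrableZl mD (k y) (hI _ y0)).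
have [h1 h2] := Rintegral_sum l hi.
split; first by apply: eq_integrable h1 => // t _ /=; rewrite -E.
under eq_Rintegral do rewrite E.
rewrite h2; apply: eq_bigr => y _.
have [->|y0] := eqVneq y 0.
  rewrite k0 mulr0; under eq_Rintegral do rewrite mul0r.
  by rewrite /Rintegral integral0.
rewrite RintegralZl//; last exact: hI.
by rewrite mulrC /Rintegral integral_indic// setIC.
Qed.

Lemma simple_integralE (C : R) (phi : X -> R^o) (s : R -> X) :
  bounded_linear C phi -> simple_integrable D s ->
  phi (simple_integral D s) = \int[mu]_(t in D) phi (s t).
Proof.
move=> hphi hs.
have [_ ->] := simple_integral_comp (bounded_linear0 hphi) hs.
rewrite /simple_integral fsbig_finite//=; last by case: hs => -[].
elim/big_ind2 : _ => [|_ a _ b <- <-|y _]; first exact: (bounded_linear0 hphi).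
  exact: (bounded_linearD _ _ hphi).
exact: (bounded_linearZ _ _ hphi).
Qed.

Lemma simple_integrable_norm (s : R -> X) : simple_integrable D s ->
  mu.-integrable D (EFin \o (fun t => `|s t|)).
Proof. by move=> hs; have [] := simple_integral_comp (k := Num.norm) (normr0 _) hs. Qed.

End SimpleIntegral.

(** * Bochner integrability and its characterisation by functionals *)

Section BochnerIntegral.
Variables (R : realType) (X : normedModType R).
Notation mu := (@lebesgue_measure R).
Implicit Types (D : set (measurableTypeR R)) (g h : R -> X).

(** The approximations are cut off where |s n t| > 2 |g t|, so that 3 |g| dominates the errors.
    Convergence survives: where g t is nonzero the cut eventually does nothing, and where g t = 0 it
    forces the value 0. *)
Lemma simple_approximation D g : measurable D -> nice g ->
  (\int[mu]_(t in D) (`|g t|)%:E < +oo)%E ->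
  exists s : nat -> R -> X, [/\ forall n, simple_integrable D (s n),
    forall t, s n t @[n --> \oo] --> g t &
    (\int[mu]_(t in D) (`|g t - s n t|)%:E)%E @[n --> \oo] --> 0%E].
Proof.
move=> mD ng gfin.
have [s [hs sg]] := ng.
pose A n := [set t : measurableTypeR R | `|s n t| <= 2 * `|g t|].
have mA n : measurable (A n).
  rewrite (_ : A n = (fun t => `|s n t| <= 2 * `|g t|) @^-1` [set true]); last first.
    by apply/seteqP; split => t.
  rewrite -[X in measurable X]setTI; apply: measurable_fun_ler => //.
    by apply: nice_norm; exact: nice_simple.
  by apply: measurable_funM => //; exact: nice_norm.
pose s' n t := if t \in A n then s n t else 0.
have ss' n : simple_function (s' n) by exact: simple_restrict.
have s'le n t : `|s' n t| <= 2 * `|g t|.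
  rewrite /s'; case: ifPn => [/set_mem//|_]; rewrite normr0 mulr_ge0//.
have s'g t : s' n t @[n --> \oo] --> g t.
  have [g0|g0] := eqVneq (g t) 0.
    have s'0 n : s' n t = 0.
      by apply/eqP; rewrite -normr_le0 (le_trans (s'le n t))// g0 normr0 mulr0.
    by under eq_fun do rewrite s'0; rewrite g0; exact: cvg_cst.
  apply: cvg_trans (sg t); apply: near_eq_cvg.
  have gt0 : 0 < `|g t| by rewrite normr_gt0.
  near=> n; rewrite /s' mem_set// /A/=; near: n.
  apply: (cvgr_le `|g t|); first by apply: cvg_norm; exact: sg.
  by rewrite ltr_pMl// ltr1n.
have ig : mu.-integrable D (EFin \o (fun t => `|g t|)).
  apply/integrableP; split.
    by apply/measurable_EFinP; apply: measurable_funTS; exact: nice_norm.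
  by under eq_integral do rewrite /= normr_id.
exists s'; split => //.
- move=> n; split => // y y0.
  (* Chebyshev's inequality: after the cut, the level set of a nonzero y is contained in the set
     where |g| is at least |y| / 2. *)
  have a0 : (0 < `|y| / 2)%R by rewrite divr_gt0// normr_gt0.
  have /le_lt_trans := @le_integral_abse _ _ _ mu D mD (EFin \o (fun t => `|g t|)) (`|y| / 2)
    (measurable_int mu ig) a0.
  move=> /(_ +oo%E); move/integrableP : ig => [mg] /[swap] /[apply] Hlt.
  have : (mu (D `&` [set x | ((`|y| / 2)%:E <= `|(`|g x|)%:E|)%E]) < +oo)%E.
    rewrite ltNge leye_eq; apply/negP => /eqP muoo.
    by move: Hlt; rewrite /= muoo gt0_muley ?lte_fin// ltxx.
  apply: le_lt_trans; apply: le_measure; rewrite ?inE.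
  + by apply: measurableI => //; exact: (ss' n).2.
  + by apply: (emeasurable_fun_c_infty mD) => //; exact: measurableT_comp.
  + move=> t [Dt /= st]; split => //=.
    by rewrite lee_fin normr_id ler_pdivrMr// mulrC -st.
- have := @dominated_convergence _ _ _ mu D mD (fun n t => (`|g t - s' n t|)%:E) (cst 0%E)
    (fun t => (3 * `|g t|)%:E).
  case.
  + move=> n; apply/measurable_EFinP; apply: measurable_funTS; apply: nice_norm.
    by apply: nice_sub => //; exact: nice_simple.
  + exact: measurable_cst.
  + apply: aeW => t Dt; apply: cvg_EFin; first exact: nearW.
    apply: norm_cvg0 => //.
    rewrite (_ : 0 = `|g t - g t|) ?subrr ?normr0//.
    have : (g t - s' n t) @[n --> \oo] --> g t - g t by apply: cvgB; [exact: cvg_cst|exact: s'g].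
    by rewrite subrr; under [X in _ -> X @ _ --> _]eq_fun do rewrite normr_id; move=> /cvg_norm; rewrite normr0.
  + by apply: eq_integrable (integrableZl mD 3 ig).
  + apply: aeW => t n Dt; rewrite lee_fin normr_id (le_trans (ler_normB _ _))//.
    by rewrite -[in leRHS]natr1 mulrDl mul1r addrC lerD.
  move=> _ + _; apply: cvg_trans; apply: near_eq_cvg; apply: nearW => n /=.
  by apply: eq_integral => t _ /=; rewrite subr0 normr_id.
Unshelve. all: by end_near. Qed.


Definition bochner_integrable D g :=
  strongly_measurable D g /\ (\int[mu]_(t in D) (`|g t|)%:E < +oo)%E.

Lemma bochner_integrable_ae D g h : {ae mu, forall t, D t -> g t = h t} ->
  bochner_integrable D g -> bochner_integrable D h.
Proof.
move=> gh [mg ig]; split; first exact: strongly_measurable_ae gh mg.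
rewrite (_ : (\int[mu]_(t in D) _)%E = (\int[mu]_(t in D) (`|g t|)%:E)%E)//.
by apply: ae_eq_ge0_integral => //; apply: aeS gh => t /[apply] ->.
Qed.

Lemma nice_integrable_norm D g : measurable D -> nice g -> bochner_integrable D g ->
  mu.-integrable D (EFin \o (fun t => `|g t|)).
Proof.
move=> mD ng [_ ig]; apply/integrableP; split.
  by apply/measurable_EFinP; apply: measurable_funTS; exact: nice_norm.
by under eq_integral do rewrite /= normr_id.
Qed.

Lemma nice_integrable_functional D g C (phi : X -> R^o) : measurable D -> nice g ->
  bochner_integrable D g -> bounded_linear C phi -> mu.-integrable D (EFin \o (phi \o g)).
Proof.
move=> mD ng ig hphi.
apply: (le_integrable mD (g := fun t => (`|C| * `|g t|)%:E)).
- apply/measurable_EFinP; apply: measurable_funTS; apply: nice_measurable.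
  by apply: nice_comp ng; exact: bounded_linear_continuous hphi.
- move=> t Dt; rewrite lee_fin [leRHS]ger0_norm; last by rewrite mulr_ge0.
  by have /bounded_linear_ge0[_] := hphi; exact.
- by apply: eq_integrable (integrableZl mD `|C| (nice_integrable_norm mD ng ig)).
Qed.

Lemma Rintegral_functional_le D g C (phi : X -> R^o) : measurable D -> nice g ->
  bochner_integrable D g -> bounded_linear C phi ->
  `|\int[mu]_(t in D) phi (g t)| <= `|C| * \int[mu]_(t in D) `|g t|.
Proof.
move=> mD ng ig hphi.
have ip := nice_integrable_functional mD ng ig hphi.
have In := nice_integrable_norm mD ng ig.
rewrite (le_trans (le_normr_Rintegral mD ip))// -RintegralZl//.
apply: le_Rintegral => //; first exact: integrable_norm.
  exact: eq_integrable (integrableZl mD `|C| In).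
by move=> t _; have /bounded_linear_ge0[_] := hphi; exact.
Qed.

Lemma bochner_integrable_sub D g h : measurable D -> nice g -> nice h ->
  bochner_integrable D g -> bochner_integrable D h ->
  bochner_integrable D (fun t => g t - h t).
Proof.
move=> mD ng nh ig ih; split; first by apply: strongly_measurable_nice; exact: nice_sub.
have ig' := nice_integrable_norm mD ng ig.
have ih' := nice_integrable_norm mD nh ih.
have /integrableP[_] := integrableD mD ig' ih'.
apply: le_lt_trans; apply: ae_le_integral => //; apply: aeW => t _.
by rewrite /= lee_fin [leRHS]ger0_norm ?addr_ge0// ler_normB.
Qed.

Lemma simple_bochner_integrable D (s : R -> X) : measurable D ->
  simple_integrable D s -> bochner_integrable D s.
Proof.
move=> mD hs; split.
  by apply: strongly_measurable_nice; apply: nice_simple; case: hs.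
have /integrableP[_] := simple_integrable_norm mD hs.
by under eq_integral do rewrite /= normr_id.
Qed.

Lemma is_bochner_integrable D g v : measurable D -> is_bochner D g v ->
  bochner_integrable D g.
Proof.
move=> mD [s [si sg s0 _]].
have mg : strongly_measurable D g by exists s; split => // n; case: (si n).
split=> //.
have [h nh [gh _]] := nice_representative mD mg.
rewrite (_ : (\int[mu]_(t in D) _)%E = (\int[mu]_(t in D) (`|h t|)%:E)%E); last first.
  by apply: ae_eq_ge0_integral => //; apply: aeS gh => t /[apply] ->.
(* One index with finite error suffices: |h| is at most |h - s N| + |s N|. *)
have /fine_cvgP[[N _ /(_ N (leqnn N))/=] + _] := s0.
have -> : (\int[mu]_(t in D) (`|g t - s N t|)%:E = \int[mu]_(t in D) (`|h t - s N t|)%:E)%E.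
  by apply: ae_eq_ge0_integral => //; apply: aeS gh => t /[apply] ->.
rewrite ge0_fin_numE ?integral_ge0// => lt1.
have msub : measurable_fun D (fun t => (`|h t - s N t|)%:E).
  apply/measurable_EFinP; apply: measurable_funTS; apply: nice_norm.
  by apply: nice_sub => //; apply: nice_simple; case: (si N).
have isN := simple_integrable_norm mD (si N).
apply: (@le_lt_trans _ _ (\int[mu]_(t in D) ((`|h t - s N t|)%:E + (`|s N t|)%:E))%E).
  apply: ae_le_integral => //; first by move=> t _; rewrite adde_ge0.
  apply: aeW => t _; rewrite -EFinD lee_fin.
  by rewrite -[X in `|X| <= _](subrK (s N t)) ler_normD.
rewrite ge0_integralD//; last exact: measurable_int isN.
rewrite lte_add_pinfty//; have /integrableP[_] := isN.
apply: le_lt_trans; apply: ae_le_integral => //; apply: aeW => t _.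
by rewrite /= lee_fin normr_id.
Qed.

Lemma is_bochner_weak D g v C (phi : X -> R^o) : measurable D -> is_bochner D g v ->
  bounded_linear C phi -> phi v = \int[mu]_(t in D) phi (g t).
Proof.
move=> mD hv hphi; have [mg ig] := is_bochner_integrable mD hv.
have [h nh [gh _]] := nice_representative mD mg.
have ih : bochner_integrable D h by exact: bochner_integrable_ae gh _.
rewrite (_ : (\int[mu]_(t in D) _) = (\int[mu]_(t in D) phi (h t))); last first.
  by apply: ae_eq_Rintegral; apply: aeS gh => t /[apply] ->.
move: hv => [s [si _ s0 sv]].
have nsn n : nice (s n) by apply: nice_simple; case: (si n).
have isn n : bochner_integrable D (s n) by exact: simple_bochner_integrable.
have key n : `|\int[mu]_(t in D) phi (h t) - phi (simple_integral D (s n))| <=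
    `|C| * fine (\int[mu]_(t in D) (`|g t - s n t|)%:E)%E.
  rewrite (simple_integralE mD hphi)// -RintegralB//; last 2 first.
  - exact: nice_integrable_functional hphi.
  - exact: nice_integrable_functional hphi.
  rewrite (_ : \int[mu]_(t in D) _ = \int[mu]_(t in D) phi (h t - s n t)); last first.
    by apply: eq_Rintegral => t _; rewrite (bounded_linearB _ _ hphi).
  apply: (le_trans (Rintegral_functional_le mD (nice_sub nh (nsn n)) _ hphi)).
    exact: bochner_integrable_sub.
  rewrite ler_wpM2l// le_eqVlt; apply/orP; left; apply/eqP; congr fine.
  by apply: ae_eq_ge0_integral => //; apply: aeS gh => t /[apply] ->.
have c1 : phi (simple_integral D (s n)) @[n --> \oo] --> phi v.
  apply: (@cvg_comp _ _ _ (fun n => simple_integral D (s n)) phi _ (nbhs v)) => //.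
  exact: (bounded_linear_continuous hphi).
have c2 : phi (simple_integral D (s n)) @[n --> \oo] --> (\int[mu]_(t in D) phi (h t) : R^o).
  have c3 : `|C| * fine (\int[mu]_(t in D) (`|g t - s n t|)%:E)%E @[n --> \oo] --> 0.
    rewrite -(mulr0 `|C|); apply: cvgMr; exact: fine_cvg.
  apply/cvgrPdist_le => e e0.
  have /cvgrPdist_le/(_ _ e0) := c3; apply: filterS => n.
  rewrite sub0r normrN => /(le_trans (ler_norm _)); apply: le_trans; exact: key.
exact: (cvg_unique _ c1 c2).
Qed.

(** Later identities between Bochner integrals are reduced by this to scalar integrals. In the
    converse direction a norming functional evaluates the distance from v to the integral of an
    approximation, which is then at most the L^1 error. Existence of a value is a separate matter,
    settled in [bochner_exists] for complete X. *)
Lemma is_bochnerP D g v : measurable D -> is_bochner D g v <->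
  bochner_integrable D g /\ forall phi : X -> R^o, bounded_linear 1 phi ->
    phi v = \int[mu]_(t in D) phi (g t).
Proof.
move=> mD; split=> [hv|[[mg ig] hphi]].
  split; first exact: is_bochner_integrable hv.
  by move=> phi; exact: is_bochner_weak.
have [h nh [gh _]] := nice_representative mD mg.
have ih : bochner_integrable D h by exact: bochner_integrable_ae gh _.
have [s [si sh s0]] := simple_approximation mD nh ih.2.
have nsn n : nice (s n) by apply: nice_simple; case: (si n).
have isn n : bochner_integrable D (s n) by exact: simple_bochner_integrable.
exists s; split => //.
- by apply: aeS gh => t gh Dt; rewrite gh//; exact: sh.
- apply: cvg_trans s0; apply: near_eq_cvg; apply: nearW => n.
  by apply: ae_eq_ge0_integral => //; apply: aeS gh => t /[apply] ->.
- have /fine_cvg c3 := s0; apply/cvgrPdist_le => e e0.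
  have /cvgrPdist_le/(_ _ e0) := c3; apply: filterS => n /=.
  rewrite sub0r normrN => /(le_trans (ler_norm _)); apply: le_trans.
  have [phi Hphi <-] := norming_functional (v - simple_integral D (s n)).
  rewrite (bounded_linearB _ _ Hphi) hphi// (simple_integralE mD Hphi)//.
  rewrite (_ : (\int[mu]_(t in D) phi (g t)) = (\int[mu]_(t in D) phi (h t))); last first.
    by apply: ae_eq_Rintegral; apply: aeS gh => t /[apply] ->.
  rewrite -RintegralB//; last 2 first.
  - exact: nice_integrable_functional Hphi.
  - exact: nice_integrable_functional Hphi.
  rewrite (_ : \int[mu]_(t in D) _ = \int[mu]_(t in D) phi (h t - s n t)); last first.
    by apply: eq_Rintegral => t _; rewrite (bounded_linearB _ _ Hphi).
  rewrite (le_trans (ler_norm _))//.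
  apply: (le_trans (Rintegral_functional_le mD (nice_sub nh (nsn n)) _ Hphi)).
    exact: bochner_integrable_sub.
  by rewrite normr1 mul1r.
Qed.

Lemma is_bochner_unique D g v w : measurable D -> is_bochner D g v -> is_bochner D g w -> v = w.
Proof.
move=> mD hv hw; apply: functional_separation => phi hphi.
by rewrite (is_bochner_weak mD hv hphi) (is_bochner_weak mD hw hphi).
Qed.

Lemma is_bochner_ae D g h v : {ae mu, forall t, D t -> g t = h t} ->
  is_bochner D g v -> is_bochner D h v.
Proof.
move=> gh [s [si sg s0 sv]]; exists s; split => //.
  by apply: aeS2 sg gh => t sg gh Dt; rewrite -gh//; exact: sg.
apply: cvg_trans s0; apply: near_eq_cvg; apply: nearW => n.
by apply: ae_eq_ge0_integral => //; apply: aeS gh => t /[apply] ->.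
Qed.

Lemma is_bochner_norm D g v : measurable D -> is_bochner D g v ->
  (`|v|%:E <= \int[mu]_(t in D) (`|g t|)%:E)%E.
Proof.
move=> mD hv; have [mg ig] := is_bochner_integrable mD hv.
have [h nh [gh _]] := nice_representative mD mg.
have ih : bochner_integrable D h by exact: bochner_integrable_ae gh _.
have [phi Hphi <-] := norming_functional v.
rewrite (is_bochner_weak mD hv Hphi).
rewrite (_ : (\int[mu]_(t in D) phi (g t)) = (\int[mu]_(t in D) phi (h t))); last first.
  by apply: ae_eq_Rintegral; apply: aeS gh => t /[apply] ->.
rewrite (_ : (\int[mu]_(t in D) _)%E = (\int[mu]_(t in D) (`|h t|)%:E)%E); last first.
  by apply: ae_eq_ge0_integral => //; apply: aeS gh => t /[apply] ->.
rewrite -[leRHS]fineK; last by rewrite ge0_fin_numE ?ih.2// integral_ge0.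
rewrite lee_fin (le_trans (ler_norm _))//.
by rewrite (le_trans (Rintegral_functional_le mD nh ih Hphi))// normr1 mul1r.
Qed.

Lemma bochner_integrable_dom D g (m : R -> R) : measurable D -> strongly_measurable D g ->
  (forall t, D t -> 0 <= m t) -> {ae mu, forall t, D t -> `|g t| <= m t} ->
  (\int[mu]_(t in D) (m t)%:E < +oo)%E -> bochner_integrable D g.
Proof.
move=> mD mg m0 gm moo; split => //; apply: le_lt_trans moo.
by apply: ae_le_integral => //; apply: aeS gm => t /[apply]; rewrite lee_fin.
Qed.

(** The zero sequence serves for every g, since a condition almost everywhere on a null set is
    empty. Applied to [0, 0], this fixes initial values. *)
Lemma is_bochner0 D v : measurable D -> mu D = 0%E -> forall g, v = 0 -> is_bochner D g v.
Proof.
move=> mD D0 g ->; exists (fun _ _ => 0); split.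
- move=> n; split; first exact: simple_cst.
  by move=> y y0; rewrite (_ : _ @^-1` _ = set0) ?setI0 ?measure0// preimage_cst memNset// => /esym/eqP; rewrite (negbTE y0).
- by exists D; split => // t /= /not_implyP[].
- rewrite (_ : (fun _ => _) = cst 0%E); first exact: cvg_cst.
  apply/funext => n; rewrite (@ae_eq_ge0_integral _ _ _ (cst 0%E))//; first by rewrite integral0.
  by exists D; split => // t /= /not_implyP[].
- rewrite (_ : (fun _ => _) = cst 0); first exact: cvg_cst.
  apply/funext => n; rewrite /simple_integral fsbig1// => y _ /=.
  have [->|y0] := eqVneq y 0; first by rewrite scaler0.
  rewrite (_ : _ @^-1` _ = set0) ?setI0 ?measure0 ?scale0r//.
  by rewrite preimage_cst memNset// => /esym/eqP; rewrite (negbTE y0).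
Qed.

End BochnerIntegral.

(** * Existence and calculus of Bochner integrals *)

Section BochnerOperations.
Variables (R : realType).
Notation mu := (@lebesgue_measure R).
Implicit Types (D E : set (measurableTypeR R)) (X Y : normedModType R).

(** A norming functional bounds the distance between the integrals of two approximations by the sum
    of their L^1 errors, so these integrals form a Cauchy sequence. *)
Lemma bochner_exists (X : completeNormedModType R) D (g : R -> X) : measurable D ->
  bochner_integrable D g -> exists v, is_bochner D g v.
Proof.
move=> mD [mg ig].
have [h nh [gh _]] := nice_representative mD mg.
have ih : bochner_integrable D h by exact: bochner_integrable_ae gh _.
have [s [si sh s0]] := simple_approximation mD nh ih.2.
have nsn n : nice (s n) by apply: nice_simple; case: (si n).
have isn n : bochner_integrable D (s n) by exact: simple_bochner_integrable.
suff [v sv] : exists v : X, simple_integral D (s n) @[n --> \oo] --> v.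
  exists v; exists s; split => //.
  - by apply: aeS gh => t gh Dt; rewrite gh//; exact: sh.
  - apply: cvg_trans s0; apply: near_eq_cvg; apply: nearW => n.
    by apply: ae_eq_ge0_integral => //; apply: aeS gh => t /[apply] ->.
pose e n := fine (\int[mu]_(t in D) (`|h t - s n t|)%:E)%E.
have e0 : e n @[n --> \oo] --> (0 : R) by exact: fine_cvg.
have key n m : `|simple_integral D (s n) - simple_integral D (s m)| <= e n + e m.
  have [phi Hphi <-] := norming_functional (simple_integral D (s n) - simple_integral D (s m)).
  rewrite (bounded_linearB _ _ Hphi) !(simple_integralE mD Hphi)//.
  rewrite -RintegralB//; last 2 first.
  - exact: nice_integrable_functional Hphi.
  - exact: nice_integrable_functional Hphi.
  rewrite (_ : \int[mu]_(t in D) _ = \int[mu]_(t in D) phi (s n t - s m t)); last first.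
    by apply: eq_Rintegral => t _; rewrite (bounded_linearB _ _ Hphi).
  rewrite (le_trans (ler_norm _))//.
  apply: (le_trans (Rintegral_functional_le mD (nice_sub (nsn n) (nsn m)) _ Hphi)).
    exact: bochner_integrable_sub.
  rewrite normr1 mul1r.
  have in1 := nice_integrable_norm mD (nice_sub nh (nsn n)) (bochner_integrable_sub mD nh (nsn n) ih (isn n)).
  have in2 := nice_integrable_norm mD (nice_sub nh (nsn m)) (bochner_integrable_sub mD nh (nsn m) ih (isn m)).
  rewrite /e -!/(Rintegral _ _ _) -RintegralD//.
  apply: le_Rintegral => //.
  - exact: nice_integrable_norm (nice_sub (nsn n) (nsn m)) (bochner_integrable_sub _ _ _ _ _).
  - exact: eq_integrable (integrableD mD in1 in2).
  - by move=> t _; rewrite [X in _ <= X + _]distrC -{1}[s n t](subrK (h t)) -addrA ler_normD.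
suff /cauchy_cvg : cauchy (simple_integral D (s n) @[n --> \oo]).
  by move=> c; exists (lim (simple_integral D (s n) @[n --> \oo])).
apply/cauchy_exP => r r0.
have r2 : 0 < r / 2 by rewrite divr_gt0.
have /cvgrPdist_lt/(_ _ r2)[N _ hN] := e0.
have eN n : (N <= n)%N -> e n < r / 2.
  by move=> /hN /=; rewrite sub0r normrN => /(le_lt_trans (ler_norm _)).
exists (simple_integral D (s N)); exists N => // n /= Nn.
rewrite -ball_normE /= (le_lt_trans (key _ _))// (splitr r) ltrD ?eN//.
Qed.

Lemma bochnerE (X : completeNormedModType R) D (g : R -> X) : measurable D ->
  bochner_integrable D g -> is_bochner D g (bochner D g).
Proof.
move=> mD ig; have [v hv] := bochner_exists mD ig.
by rewrite /bochner; case: xgetP => [w _ //|/(_ v)].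
Qed.

Lemma bochner_eq X D (g : R -> X) v : measurable D -> is_bochner D g v -> bochner D g = v.
Proof.
move=> mD hv; rewrite /bochner; case: xgetP => [w _ /= hw|/(_ v)//].
exact: is_bochner_unique hw hv.
Qed.

Lemma is_bochner_linear X Y D (g : R -> X) v C (S : X -> Y) : measurable D ->
  is_bochner D g v -> bounded_linear C S -> is_bochner D (S \o g) (S v).
Proof.
move=> mD hv hS.
have [mg ig] := is_bochner_integrable mD hv.
have [h nh [gh _]] := nice_representative mD mg.
have ih : bochner_integrable D h by exact: bochner_integrable_ae gh _.
have gh' : {ae mu, forall t, D t -> (S \o h) t = (S \o g) t}.
  by apply: aeS gh => t /[apply] /= ->.
apply: (is_bochner_ae gh'); apply/(is_bochnerP _ _ mD); split.
  apply: (@bochner_integrable_dom _ _ D _ (fun t => `|C| * `|h t|)) => //.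
  - by apply: strongly_measurable_nice; apply: nice_comp nh; exact: bounded_linear_continuous hS.
  - by apply: aeW => t _; have /bounded_linear_ge0[_] := hS; exact.
  - under eq_integral do rewrite EFinM.
    rewrite ge0_integralZl_EFin//; last first.
      exact: measurable_int (nice_integrable_norm mD nh ih).
    by apply: lte_mul_pinfty => //; exact: ih.2.
move=> phi hphi; have /= -> := is_bochner_weak mD hv (bounded_linear_comp ler01 hphi hS).
by apply: ae_eq_Rintegral; apply: aeS gh => t /[apply] /= ->.
Qed.

Lemma is_bochnerD X D (g h : R -> X) v w : measurable D ->
  is_bochner D g v -> is_bochner D h w -> is_bochner D (fun t => g t + h t) (v + w).
Proof.
move=> mD hv hw.
have [mg ig] := is_bochner_integrable mD hv.
have [mh ih] := is_bochner_integrable mD hw.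
have [g' ng [gg' _]] := nice_representative mD mg.
have [h' nh [hh' _]] := nice_representative mD mh.
have ig' : bochner_integrable D g' by exact: bochner_integrable_ae gg' _.
have ih' : bochner_integrable D h' by exact: bochner_integrable_ae hh' _.
(* The sum is written as a difference in order to use [bochner_integrable_sub]. *)
have E : {ae mu, forall t, D t -> g' t - (- h' t) = g t + h t}.
  by apply: aeS2 gg' hh' => t a b Dt; rewrite opprK a// b.
have nN : nice (fun t => - h' t).
  by apply: (nice_comp (k := -%R)) nh; exact: opp_continuous.
have iN : bochner_integrable D (fun t => - h' t).
  split; first exact: strongly_measurable_nice.
  by under eq_integral do rewrite normrN; exact: ih'.2.
apply: (is_bochner_ae E); apply/(is_bochnerP _ _ mD); split.
  exact: bochner_integrable_sub.
move=> phi hphi; rewrite (bounded_linearD _ _ hphi).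
rewrite (is_bochner_weak mD hv hphi) (is_bochner_weak mD hw hphi).
rewrite (@ae_eq_Rintegral _ D _ (fun t => phi (g' t))); last by apply: aeS gg' => t /[apply] ->.
rewrite (@ae_eq_Rintegral _ D (fun t => phi (h t)) (fun t => phi (h' t))); last by apply: aeS hh' => t /[apply] ->.
rewrite -RintegralD//.
- by apply: eq_Rintegral => t _; rewrite opprK (bounded_linearD _ _ hphi).
- exact: nice_integrable_functional hphi.
- exact: nice_integrable_functional hphi.
Qed.

Lemma bounded_linear_scale X a : bounded_linear `|a| (fun x : X => a *: x).
Proof.
split=> [b x y|x]; last by rewrite normrZ.
by rewrite scalerDr !scalerA mulrC.
Qed.

Lemma is_bochnerZ X D (g : R -> X) v a : measurable D ->
  is_bochner D g v -> is_bochner D (fun t => a *: g t) (a *: v).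
Proof. by move=> mD hv; exact: (is_bochner_linear mD hv (bounded_linear_scale X a)). Qed.

Lemma is_bochnerB X D (g h : R -> X) v w : measurable D ->
  is_bochner D g v -> is_bochner D h w -> is_bochner D (fun t => g t - h t) (v - w).
Proof.
move=> mD hv /(is_bochnerZ (-1) mD) hw; rewrite -scaleN1r.
by under [g in is_bochner _ g _]eq_fun do rewrite -scaleN1r; exact: is_bochnerD.
Qed.

Lemma bochner_integrableS X D E (g : R -> X) : measurable D -> measurable E ->
  E `<=` D -> bochner_integrable D g -> bochner_integrable E g.
Proof.
move=> mD mE ED [mg ig]; split; first exact: strongly_measurableS mg.
have [h nh [gh _]] := nice_representative mD mg.
have ih : bochner_integrable D h by exact: bochner_integrable_ae gh _.
apply: le_lt_trans ih.2.
rewrite (@ae_eq_ge0_integral _ _ _ (fun t => (`|h t|)%:E))//; last first.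
  by apply: aeS gh => t + /ED => /[apply] ->.
apply: ge0_subset_integral => //.
exact: measurable_int (nice_integrable_norm mD nh ih).
Qed.

Lemma ge0_integral_ae_set D E (f : R -> \bar R) : (forall t, 0 <= f t)%E ->
  {ae mu, forall t, D t <-> E t} ->
  (\int[mu]_(t in D) f t = \int[mu]_(t in E) f t)%E.
Proof.
move=> f0 DE; rewrite integral_mkcond [RHS]integral_mkcond.
apply: ae_eq_ge0_integral => [t _|t _|].
- by rewrite patchE; case: ifP.
- by rewrite patchE; case: ifP.
- apply: aeS DE => t DE _; rewrite !patchE.
  by have [Dt|Dt] := pselect (D t); [rewrite !mem_set//; exact/DE|rewrite !memNset//; move/DE].
Qed.

Lemma Rintegral_ae_set D E (f : R -> R) : {ae mu, forall t, D t <-> E t} ->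
  \int[mu]_(t in D) f t = \int[mu]_(t in E) f t.
Proof.
move=> DE; congr fine; rewrite integralE [RHS]integralE.
by congr (_ - _)%E; apply: ge0_integral_ae_set.
Qed.

Lemma is_bochner_ae_set X D E (g : R -> X) v : measurable D -> measurable E ->
  {ae mu, forall t, D t <-> E t} -> is_bochner D g v -> is_bochner E g v.
Proof.
move=> mD mE DE /(is_bochnerP _ _ mD)[[mg ig] hv].
apply/(is_bochnerP _ _ mE); split; last first.
  by move=> phi hphi; rewrite hv//; exact: Rintegral_ae_set.
split; last by rewrite -(ge0_integral_ae_set _ DE).
have [s [hs sg]] := mg; exists s; split => //.
by apply: aeS2 sg DE => t sg DE /DE.
Qed.

Lemma is_bochner_setU X D E (g : R -> X) v w : measurable D -> measurable E ->
  [disjoint D & E] -> is_bochner D g v -> is_bochner E g w ->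
  is_bochner (D `|` E) g (v + w).
Proof.
move=> mD mE DE hv hw.
have [mg ig] := is_bochner_integrable mD hv.
have [mh ih] := is_bochner_integrable mE hw.
have [g1 ng1 [gg1 g10]] := nice_representative mD mg.
have [g2 ng2 [gg2 g20]] := nice_representative mE mh.
have dDE t : D t -> ~ E t.
  by move=> Dt Et; move: DE => /disj_set2P/seteqP[/(_ t)] /(_ (conj Dt Et)).
have E1 : {ae mu, forall t, (D `|` E) t -> g1 t - (- g2 t) = g t}.
  apply: aeS2 gg1 gg2 => t a b [Dt|Et]; rewrite opprK.
    by rewrite -a// g20 ?addr0//; exact: dDE.
  by rewrite -b// g10 ?add0r// => /dDE.
have mU : measurable (D `|` E) by exact: measurableU.
have nN : nice (fun t => - g2 t).
  by apply: (nice_comp (k := -%R)) ng2; exact: opp_continuous.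
have ext F (k : R -> X) : measurable F -> nice k -> F `<=` D `|` E ->
    (forall t, ~ F t -> k t = 0) -> bochner_integrable F k -> bochner_integrable (D `|` E) k.
  move=> mF nk FDE k0 [_ ik]; split; first exact: strongly_measurable_nice.
  apply: le_lt_trans ik; rewrite integral_mkcond [leRHS]integral_mkcond.
  apply: ae_le_integral => [t _|t _|]; [by rewrite patchE; case: ifP..|].
  apply: aeW => t _; rewrite !patchE; have [Ft|Ft] := pselect (F t).
    by rewrite !mem_set//; exact: FDE.
  by rewrite (k0 _ Ft) normr0 if_same; case: ifP.
have i1 : bochner_integrable D g1 by exact: bochner_integrable_ae gg1 _.
have i2 : bochner_integrable E g2 by exact: bochner_integrable_ae gg2 _.
have i1' : bochner_integrable (D `|` E) g1 by apply: (ext D).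
have i2' : bochner_integrable (D `|` E) g2 by apply: (ext E).
apply: (is_bochner_ae E1); apply/(is_bochnerP _ _ mU); split.
  apply: bochner_integrable_sub => //; split; first exact: strongly_measurable_nice.
  by under eq_integral do rewrite normrN; exact: i2'.2.
move=> phi hphi; rewrite (bounded_linearD _ _ hphi).
rewrite (is_bochner_weak mD hv hphi) (is_bochner_weak mE hw hphi).
rewrite (@ae_eq_Rintegral _ D _ (fun t => phi (g1 t))); last by apply: aeS gg1 => t /[apply] ->.
rewrite (@ae_eq_Rintegral _ E (fun t => phi (g t)) (fun t => phi (g2 t))); last by apply: aeS gg2 => t /[apply] ->.
have extR F (k : R -> X) : F `<=` D `|` E -> (forall t, ~ F t -> k t = 0) ->
    \int[mu]_(t in F) phi (k t) = \int[mu]_(t in D `|` E) phi (k t).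
  move=> FDE k0; rewrite Rintegral_mkcond [RHS]Rintegral_mkcond.
  apply: eq_Rintegral => t _; rewrite !patchE; have [Ft|Ft] := pselect (F t).
    by rewrite !mem_set//; exact: FDE.
  by rewrite (k0 _ Ft) (bounded_linear0 hphi) !if_same.
rewrite (extR D g1)// (extR E g2)// -RintegralD//.
- by apply: eq_Rintegral => t _; rewrite opprK (bounded_linearD _ _ hphi).
- exact: nice_integrable_functional hphi.
- exact: nice_integrable_functional hphi.
Qed.

End BochnerOperations.

(** * Affine changes of variable *)

Section Affine.
Variable R : realType.
Notation mu := (@lebesgue_measure R).
Notation affine a b := ((fun x : measurableTypeR R => a * x + b) : measurableTypeR R -> measurableTypeR R).

Lemma measurable_affine (a b : R) : measurable_fun setT (affine a b).
Proof. by apply: measurable_funD => //; exact: measurable_funM. Qed.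

(** Uniqueness of Lebesgue measure: |a| times the image measure has the right value on half-open
    intervals. Their preimages are half open on the other side when a < 0, whence the two cases. *)
Lemma lebesgue_measure_affine (a b : R) (A : set (measurableTypeR R)) : a != 0 ->
  measurable A -> mu (affine a b @^-1` A) = (`|a|^-1%:E * mu A)%E.
Proof.
move=> a0 mA.
have Na0 : 0 < `|a| by rewrite normr_gt0.
have mf := measurable_affine a b.
pose nu := measure_function_pushforward__canonical__measure_function_Measure mu mf.
suff /(_ A mA) : forall B, measurable B -> mu B = mscale (NngNum (ltW Na0)) nu B.
  rewrite /mscale/= => ->; rewrite muleA -EFinM mulVf ?gt_eqF// mul1e.
  by [].
apply: lebesgue_measure_unique => _ [[x y] /= _ <-].
rewrite /mscale/= /pushforward.
have [an|ap] := ltP a 0.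
  rewrite (_ : _ @^-1` _ = `[(y - b) / a, (x - b) / a[%classic); last first.
    apply/seteqP; split => t /=; rewrite !in_itv/= ler_ndivrMr// ltr_ndivlMr//;
      by rewrite ltrBlDr lerBrDr [t * a]mulrC andbC.
  rewrite !lebesgue_measure_itv/= !lte_fin ltr_nM2r ?invr_lt0// ltrD2r.
  case: ifP => xy; last by rewrite mule0.
  by rewrite -!EFinB -EFinM -mulrBl ltr0_norm//; congr EFin; field.
have {}ap : 0 < a by rewrite lt_neqAle eq_sym a0.
rewrite (_ : _ @^-1` _ = `](x - b) / a, (y - b) / a]%classic); last first.
  apply/seteqP; split => t /=; rewrite !in_itv/= ltr_pdivrMr// ler_pdivlMr//;
    by rewrite ltrBlDr lerBrDr [t * a]mulrC.
rewrite !lebesgue_measure_itv/= !lte_fin ltr_pM2r ?invr_gt0// ltrD2r.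
case: ifP => xy; last by rewrite mule0.
by rewrite -!EFinB -EFinM -mulrBl gtr0_norm//; congr EFin; field.
Qed.

Lemma ge0_integral_affine (a b : R) (f : measurableTypeR R -> \bar R) : a != 0 ->
  measurable_fun setT f -> (forall x, 0 <= f x)%E ->
  (\int[mu]_x f (a * x + b)%R = `|a|^-1%:E * \int[mu]_x f x)%E.
Proof.
move=> a0 mf f0.
have ma := measurable_affine a b.
have Na0 : 0 <= `|a|^-1 by rewrite invr_ge0.
pose nu := measure_function_pushforward__canonical__measure_function_Measure mu ma.
transitivity (\int[nu]_x f x)%E.
  by rewrite [RHS](ge0_integral_pushforward ma).
rewrite (eq_measure_integral (mscale (NngNum Na0) mu)); last first.
  by move=> A mA _; exact: lebesgue_measure_affine.
by rewrite ge0_integral_mscale.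
Qed.

Lemma ae_affine (a b : R) (P : R -> Prop) : a != 0 ->
  {ae mu, forall t, P t} -> {ae mu, forall t, P (a * t + b)}.
Proof.
move=> a0 [N [mN N0 hN]]; exists (affine a b @^-1` N); split.
- by rewrite -[X in measurable X]setTI; apply: measurable_affine.
- by rewrite lebesgue_measure_affine// N0 mule0.
- by move=> t /= nP; exact: hN.
Qed.

Lemma Rintegral_translate (c : R) (f : measurableTypeR R -> R) : measurable_fun setT f ->
  \int[mu]_x f (x + c) = \int[mu]_x f x.
Proof.
move=> mf; congr fine; rewrite integralE [RHS]integralE.
have T (g : measurableTypeR R -> \bar R) : measurable_fun setT g -> (forall x, 0 <= g x)%E ->
    (\int[mu]_x g (x + c)%R = \int[mu]_x g x)%E.
  move=> mg g0; have := @ge0_integral_affine 1 c g (oner_neq0 _) mg g0.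
  by rewrite normr1 invr1 mul1e => <-; apply: eq_integral => x _; rewrite mul1r.
have mE : measurable_fun setT (EFin \o f) by exact/measurable_EFinP.
congr (_ - _)%E.
- rewrite -(T _ (measurable_funepos mE)); last exact: funepos_ge0.
  by apply: eq_integral => x _; rewrite !funeposE.
- rewrite -(T _ (measurable_funeneg mE)); last exact: funeneg_ge0.
  by apply: eq_integral => x _; rewrite !funenegE.
Qed.

Lemma is_bochner_translate (X : normedModType R) (D : set (measurableTypeR R)) (g : R -> X) v (c : R) :
  measurable D -> is_bochner D g v ->
  is_bochner ((fun x => x + c) @^-1` D) (fun t => g (t + c)) v.
Proof.
move=> mD hv.
have mt : measurable_fun setT ((fun x => x + c) : measurableTypeR R -> measurableTypeR R).
  exact: measurable_funD.
have mD' : measurable ((fun x : measurableTypeR R => x + c) @^-1` D).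
  by rewrite -[X in measurable X]setTI; exact: mt.
have [mg ig] := is_bochner_integrable mD hv.
have [h nh [gh h0]] := nice_representative mD mg.
have ih : bochner_integrable D h by exact: bochner_integrable_ae gh _.
have aet (P : R -> Prop) : {ae mu, forall t, P t} -> {ae mu, forall t, P (t + c)}.
  by move=> /(@ae_affine 1 c _ (oner_neq0 _)); apply: aeS => t; rewrite mul1r.
have gh' : {ae mu, forall t, ((fun x => x + c) @^-1` D) t -> h (t + c) = g (t + c)}.
  by apply: aeS (aet _ gh) => t /[apply] ->.
have nhc : nice (fun t => h (t + c)).
  have [s [hs sh]] := nh; exists (fun n t => s n (t + c)); split => [n|t]; last exact: sh.
  exact: (simple_measurable_comp mt).
apply: (is_bochner_ae gh'); apply/(is_bochnerP _ _ mD'); split.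
  split; first exact: strongly_measurable_nice.
  apply: le_lt_trans ih.2; rewrite integral_mkcond [leRHS]integral_mkcond.
  have := @ge0_integral_affine 1 c ((fun x => (`|h x|)%:E) \_ D) (oner_neq0 _).
  rewrite normr1 invr1 mul1e => <-.
  - rewrite le_eqVlt; apply/orP; left; apply/eqP; apply: eq_integral => t _.
    by rewrite !patchE !mul1r/=; congr (if _ then _ else _); rewrite !inE.
  - apply/(measurable_restrictT _ _).1 => //; apply/measurable_EFinP; apply: measurable_funTS.
    exact: nice_norm.
  - by move=> t; rewrite patchE; case: ifP.
move=> phi hphi; rewrite (is_bochner_weak mD hv hphi).
rewrite (@ae_eq_Rintegral _ D _ (fun t => phi (h t))); last by apply: aeS gh => t /[apply] ->.
have E F (k : R -> X) : (forall t, ~ F t -> k t = 0) ->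
    \int[mu]_(t in F) phi (k t) = \int[mu]_t phi (k t).
  move=> k0; rewrite Rintegral_mkcond; apply: eq_Rintegral => t _.
  rewrite patchE; have [Ft|Ft] := pselect (F t); first by rewrite mem_set.
  by rewrite memNset// (k0 _ Ft) (bounded_linear0 hphi).
rewrite (E D)// E//; last by move=> t; exact: h0.
rewrite (@Rintegral_translate c (phi \o h))//.
apply: nice_measurable; apply: nice_comp nh; exact: bounded_linear_continuous hphi.
Qed.

End Affine.

(** * Strong measurability of compositions *)

Section JointMeasurability.
Variables (R : realType) (X Y : normedModType R).
Notation mu := (@lebesgue_measure R).
Import HBNNSimple.

(** Approximation from below keeps the approximating times in [0, t], hence inside the interval on
    which a path is known to be continuous. *)
Lemma simple_approximation_id : exists r : nat -> R -> R, [/\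
  forall n, simple_function (r n : R -> R^o),
  forall n t, 0 <= t -> 0 <= r n t <= t &
  forall t, 0 <= t -> r n t @[n --> \oo] --> t].
Proof.
have mI : measurable (`[0, +oo[%classic : set (measurableTypeR R)) by exact: measurable_itv.
have mid : measurable_fun (`[0, +oo[%classic : set (measurableTypeR R)) (EFin : measurableTypeR R -> \bar R) by exact/measurable_EFinP.
have f0 : forall x : measurableTypeR R, `[0, +oo[%classic x -> (0 <= x%:E)%E.
  by move=> x /=; rewrite in_itv/= andbT lee_fin.
pose r := nnsfun_approx mI mid.
have cr t : 0 <= t -> r n t @[n --> \oo] --> t.
  move=> t0; have Dt : `[0, +oo[%classic t by rewrite /= in_itv/= t0.
  by have /fine_cvgP[_] := @cvg_nnsfun_approx _ _ R _ mI _ mid f0 t Dt.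
exists (fun n => r n); split => //.
- move=> n; split; first exact: (@fimfunP _ _ (r n)).
  by move=> y; exact: measurable_sfunP.
- move=> n t t0; apply/andP; split => //.
  rewrite -[leRHS](cvg_lim _ (cr _ t0))//.
  apply: nondecreasing_cvgn_le; last by apply/cvg_ex; exists t; exact: cr.
  by move=> m k mk; have /lefP/(_ t) := nd_nnsfun_approx mI mid mk.
Qed.

(** Replacing time by [r n t] and the value by [s n t] gives simple functions of t, so joint
    sequential continuity at almost every time is enough. The single time at which a kernel is
    singular can thus be discarded. *)
Lemma strongly_measurable_joint (D : set (measurableTypeR R)) (g : R -> Y) (k : R -> Y -> X) :
  (forall t, D t -> 0 <= t) -> strongly_measurable D g ->
  {ae mu, forall t, D t -> forall (r : nat -> R) (y : nat -> Y), (forall n, 0 <= r n <= t) ->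
    r n @[n --> \oo] --> t -> y n @[n --> \oo] --> g t ->
    k (r n) (y n) @[n --> \oo] --> k t (g t)} ->
  strongly_measurable D (fun t => k t (g t)).
Proof.
move=> D0 [s [hs sg]] hk; have [r [sr r1 r2]] := simple_approximation_id.
exists (fun n t => k (r n t) (s n t)); split => [n|].
  exact: (simple_comp2 (k : R^o -> _) (sr n) (hs n)).
apply: aeS2 sg hk => t sg hk Dt; have t0 := D0 _ Dt.
by apply: hk => //; [move=> n; exact: r1|exact: r2|exact: sg].
Qed.

Lemma strongly_measurable_right_continuous (D : set (measurableTypeR R)) (g : R -> X) :
  (forall t, D t -> 0 <= t) ->
  {ae mu, forall t, D t -> forall (r : nat -> R), (forall n, 0 <= r n <= t) ->
    r n @[n --> \oo] --> t -> g (r n) @[n --> \oo] --> g t} ->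
  strongly_measurable D g.
Proof.
move=> D0 hg; have [r [sr r1 r2]] := simple_approximation_id.
exists (fun n t => g (r n t)); split => [n|].
  exact: (simple_comp (g : R^o -> _) (sr n)).
by apply: aeS hg => t hg Dt; apply: hg; [|move=> n; exact/r1/D0|exact/r2/D0].
Qed.

End JointMeasurability.

(** * Integrals of powers and exponentials *)

Section PowerIntegrals.
Variable R : realType.
Notation mu := (@lebesgue_measure R).
Implicit Types (a b c t : R).

Lemma power_integral_itv c a b : 0 < a -> a < b -> c != 1 ->
  (\int[mu]_(s in `[a, b]) (s `^ (- c))%:E =
   ((b `^ (1 - c) - a `^ (1 - c)) / (1 - c))%:E)%E.
Proof.
move=> a0 ab c1; have c10 : 1 - c != 0 by rewrite subr_eq0 eq_sym.
pose F (s : R) := (1 - c)^-1 * s `^ (1 - c).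
have dF (s : R) : 0 < s -> is_derive s 1 F (s `^ (- c)).
  move=> s0; have d := is_derive1_powR (1 - c) s0.
  have := is_deriveZ (1 - c)^-1 d.
  by rewrite /GRing.scale/= mulKf// addrAC subrr add0r.
have cont (s : R) : 0 < s -> {for s, continuous F}.
  by move=> s0; apply: differentiable_continuous; apply/derivable1_diffP; case: (dF s s0).
rewrite (@continuous_FTC2 _ _ F)//.
- by rewrite -EFinB -mulrBr mulrC.
- apply: continuous_in_subspaceT => s /[!inE]/= /[!in_itv]/= /andP[as_ _].
  apply: differentiable_continuous; apply/derivable1_diffP.
  by apply: derivable_powR; rewrite in_itv/= andbT (lt_le_trans a0).
- split.
  + by move=> s /[!in_itv]/= /andP[as_ _]; case: (dF s (lt_trans a0 as_)).
  + by apply: cvg_at_right_filter; exact: cont.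
  + by apply: cvg_at_left_filter; apply: cont; exact: lt_trans ab.
- move=> s /[!in_itv]/= /andP[as_ _]; rewrite derive1E.
  by have := dF s (lt_trans a0 as_) => d; rewrite derive_val.
Qed.

Lemma measurable_power c (D : set (measurableTypeR R)) :
  measurable_fun D (fun s : measurableTypeR R => (s `^ c)%:E).
Proof. by apply/measurable_EFinP; apply: measurable_funTS; exact: measurable_powR. Qed.

Lemma power_integral0 c t : 0 < t -> c < 1 ->
  (\int[mu]_(s in `]0%R, t]) (s `^ (- c))%:E <= (t `^ (1 - c) / (1 - c))%:E)%E.
Proof.
move=> t0 c1.
(* With [n.+2] the left end point is strictly below t for every n, as [power_integral_itv]
   requires. *)
pose F n : set (measurableTypeR R) := `[t / n.+2%:R, t]%classic.
have Fpos n : 0 < t / n.+2%:R by rewrite divr_gt0.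
have FU : `]0%R, t]%classic = \bigcup_n F n.
  apply/seteqP; split=> s /=; rewrite ?in_itv/=.
    move=> /andP[s0 st]; exists (Num.truncn (t / s)) => //=.
    rewrite /F/= in_itv/= st andbT ler_pdivrMr// mulrC -ler_pdivrMr//.
    by rewrite ltW// (lt_trans (truncnS_gt _))// ltr_nat.
  by move=> [n _]; rewrite /F/= in_itv/= => /andP[/(lt_le_trans (Fpos n)) -> ->].
have ndF : nondecreasing_seq F.
  apply/nondecreasing_seqP => n; apply/subsetPset => s; rewrite /F/= !in_itv/= => /andP[h ->].
  rewrite andbT (le_trans _ h)// ler_pM2l// lef_pV2 ?posrE ?ltr0n// ler_nat.
  exact: leqW.
have := @ge0_nondecreasing_set_cvg_integral _ _ R F (fun s => (s `^ (- c))%:E) mu ndF.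
rewrite -FU => H.
have cF : (\int[mu]_(s in F n) (s `^ (- c))%:E)%E @[n --> \oo] --> (\int[mu]_(s in \bigcup_n F n) (s `^ (- c))%:E)%E.
  rewrite -FU; apply: H.
  - by move=> n; exact: measurable_itv.
  - by move=> n; exact: measurable_power.
  - by move=> n s _; rewrite lee_fin powR_ge0.
rewrite FU -(cvg_lim _ cF)//; apply: lime_le; first by apply/cvg_ex; eexists; exact: cF.
apply: nearW => n.
rewrite power_integral_itv//; last 2 first.
- by rewrite ltr_pdivrMr// ltr_pMr// ltr1n.
- by rewrite lt_eqF.
by rewrite lee_fin ler_pM2r ?invr_gt0 ?subr_gt0// lerBlDr lerDl powR_ge0.
Qed.

Lemma power_integraly c t : 0 < t -> 1 < c ->
  (\int[mu]_(s in `[t, +oo[) (s `^ (- c))%:E <= (t `^ (1 - c) / (c - 1))%:E)%E.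
Proof.
move=> t0 c1.
pose F n : set (measurableTypeR R) := `[t, t + n.+1%:R]%classic.
have FU : `[t, +oo[%classic = \bigcup_n F n.
  apply/seteqP; split=> s /=; rewrite ?in_itv/= ?andbT.
    move=> ts; exists (Num.truncn (s - t)) => //=.
    by rewrite /F/= in_itv/= ts -lerBlDl ltW// truncnS_gt.
  by move=> [n _]; rewrite /F/= in_itv/= => /andP[].
have ndF : nondecreasing_seq F.
  apply/nondecreasing_seqP => n; apply/subsetPset => s; rewrite /F/= !in_itv/= => /andP[-> h].
  by rewrite (le_trans h)//= lerD2l ler_nat.
have := @ge0_nondecreasing_set_cvg_integral _ _ R F (fun s => (s `^ (- c))%:E) mu ndF.
rewrite -FU => H.
have cF : (\int[mu]_(s in F n) (s `^ (- c))%:E)%E @[n --> \oo] --> (\int[mu]_(s in \bigcup_n F n) (s `^ (- c))%:E)%E.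
  rewrite -FU; apply: H.
  - by move=> n; exact: measurable_itv.
  - by move=> n; exact: measurable_power.
  - by move=> n s _; rewrite lee_fin powR_ge0.
rewrite FU -(cvg_lim _ cF)//; apply: lime_le; first by apply/cvg_ex; eexists; exact: cF.
apply: nearW => n.
rewrite power_integral_itv//; last 2 first.
- by rewrite ltrDl.
- by rewrite gt_eqF.
have E (x y : R) : (x - y) / (1 - c) = (y - x) / (c - 1).
  by rewrite -(opprB c 1) invrN mulrN -mulNr opprB.
by rewrite lee_fin E ler_pM2r ?invr_gt0 ?subr_gt0// lerBlDr lerDl powR_ge0.
Qed.

(** Split at s = t, bounding (s + t)^-1 by t^-1 on the left and by s^-1 on the right. The exact
    constant is pi / sin(pi a); what counts is the power t^-a, which turns the bound K / t for the
    derivative of a semigroup into one for its fractional power. *)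
Lemma stieltjes_integral a t : 0 < a < 1 -> 0 < t ->
  (\int[mu]_(s in `]0%R, +oo[) (s `^ (- a) * (s + t) `^ (- 1))%:E <=
     ((1 / (1 - a) + 1 / a) * t `^ (- a))%:E)%E.
Proof.
move=> /andP[a0 a1] t0.
have mf D : measurable_fun (D : set (measurableTypeR R)) (fun s : measurableTypeR R => (s `^ (- a) * (s + t) `^ (- 1))%:E).
  apply/measurable_EFinP; apply: measurable_funM; first by apply: measurable_funTS; exact: measurable_powR.
  apply: measurable_funTS; apply: (measurableT_comp (measurable_powR (- 1))).
  exact: measurable_funD.
rewrite (_ : `]0%R, +oo[%classic = `]0%R, t]%classic `|` `]t, +oo[%classic); last first.
  by rewrite -itv_bndbnd_setU ?bnd_simp//= ltW.
rewrite ge0_integral_setU//=; last 2 first.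
- move=> s; rewrite !in_itv/= !andbT => h; by rewrite lee_fin mulr_ge0 ?powR_ge0.
- apply/disj_set2P/seteqP; split => // s /=; rewrite !in_itv/= andbT => -[/andP[_ h1]].
  by rewrite ltNge h1.
rewrite mulrDl EFinD leeD//.
- apply: (@le_trans _ _ (\int[mu]_(s in `]0%R, t]) (t^-1%:E * (s `^ (- a))%:E))%E).
    apply: ge0_le_integral => //.
    + move=> s /=; rewrite in_itv/= => /andP[s0 _].
      by rewrite lee_fin mulr_ge0 ?powR_ge0.
    + by apply: measurable_funeM; exact: measurable_power.
    + move=> s /=; rewrite in_itv/= => /andP[s0 _].
      rewrite -EFinM lee_fin mulrC ler_wpM2r ?powR_ge0// powR_inv1 ?(addr_ge0 (ltW s0) (ltW t0))//.
      rewrite lef_pV2 ?posrE ?addr_gt0//.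
      by rewrite lerDr ltW.
  rewrite ge0_integralZl_EFin//; last 3 first.
  + by move=> s _; rewrite lee_fin powR_ge0.
  + exact: measurable_power.
  + by rewrite invr_ge0 ltW.
  apply: (@le_trans _ _ (t^-1%:E * (t `^ (1 - a) / (1 - a))%:E)%E).
    by apply: lee_wpmul2l; [rewrite lee_fin invr_ge0 ltW|exact: power_integral0].
  rewrite -EFinM lee_fin powRD; last by rewrite (gt_eqF t0) implybT.
  rewrite powRr1 ?(ltW t0)// le_eqVlt; apply/orP; left; apply/eqP.
  by rewrite -mulrA mulKf ?gt_eqF// mul1r mulrC.
- apply: (@le_trans _ _ (\int[mu]_(s in `[t, +oo[) (s `^ (- (1 + a)))%:E)%E).
    rewrite -integral_itv_obnd_cbnd; last exact: measurable_power.
    apply: ge0_le_integral => //.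
    + move=> s /=; rewrite in_itv/= andbT => ts.
      by rewrite lee_fin mulr_ge0 ?powR_ge0.
    + exact: measurable_power.
    + move=> s /=; rewrite in_itv/= andbT => ts; have s0 := lt_trans t0 ts.
      rewrite lee_fin opprD powRD; last by rewrite (gt_eqF s0) implybT.
      rewrite !powR_inv1 ?(addr_ge0 (ltW s0) (ltW t0)) ?(ltW s0)// mulrC ler_wpM2r ?powR_ge0// lef_pV2 ?posrE ?addr_gt0//.
      by rewrite lerDl ltW.
  apply: (le_trans (@power_integraly (1 + a) t t0 _)); first by rewrite ltrDl.
  by rewrite opprD addrA subrr add0r addrAC subrr add0r mulrC div1r.
Qed.

Lemma expR_power_le (d s : R) : 0 < d -> 0 < s -> expR (- (d * s)) <= (2 / d) ^+ 2 * s `^ (- 2).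
Proof.
move=> d0 s0.
have -> : (2 / d) ^+ 2 * s `^ (- 2) = ((d * s / 2) ^+ 2)^-1.
  by rewrite powR_invn ?ltW//; field; rewrite !gt_eqF.
rewrite expRN lef_pV2 ?posrE ?expR_gt0 ?exprn_gt0 ?divr_gt0 ?mulr_gt0//.
have -> : expR (d * s) = expR (d * s / 2) ^+ 2.
  by rewrite -expRM_natl -mulr_natl; congr expR; field.
rewrite lerXn2r ?nnegrE ?expR_ge0 ?divr_ge0 ?mulr_ge0 ?ltW//.
by apply: lt_le_trans (expR_ge1Dx _); rewrite ltrDr.
Qed.

(** Split at 1: an integrable power on the left; on the right s^(a - 1) is at most 1 because a is,
    and the exponential is dominated by a multiple of s^-2. *)
Lemma gamma_integral_lty a (d : R) : 0 < a <= 1 -> 0 < d ->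
  (\int[mu]_(s in `]0%R, +oo[) (s `^ (a - 1) * expR (- (d * s)))%:E < +oo)%E.
Proof.
move=> /andP[a0 a1] d0.
have mf D : measurable_fun (D : set (measurableTypeR R)) (fun s : measurableTypeR R => (s `^ (a - 1) * expR (- (d * s)))%:E).
  apply/measurable_EFinP; apply: measurable_funM; first by apply: measurable_funTS; exact: measurable_powR.
  apply: measurable_funTS; apply: (measurableT_comp (f := @expR R)) => //.
  by under eq_fun do rewrite -mulNr; exact: measurable_funM.
have f0 s : (0 <= (s `^ (a - 1) * expR (- (d * s)))%:E)%E by rewrite lee_fin mulr_ge0 ?powR_ge0 ?expR_ge0.
rewrite (_ : `]0%R, +oo[%classic = `]0%R, 1]%classic `|` `]1%R, +oo[%classic); last first.
  by rewrite -itv_bndbnd_setU ?bnd_simp//= ltW.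
rewrite ge0_integral_setU//=; last first.
  apply/disj_set2P/seteqP; split => // s /=; rewrite !in_itv/= andbT => -[/andP[_ h1]].
  by rewrite ltNge h1.
rewrite lte_add_pinfty//.
- apply: (@le_lt_trans _ _ (\int[mu]_(s in `]0%R, 1%R]) (s `^ (- (1 - a)))%:E)%E).
    apply: ge0_le_integral => //; first exact: measurable_power.
    move=> s /=; rewrite in_itv/= => /andP[s0 _].
    rewrite lee_fin opprB ler_piMr ?powR_ge0// -[leRHS]expR0 ler_expR oppr_le0.
    by rewrite mulr_ge0 ?ltW.
  apply: le_lt_trans (@power_integral0 (1 - a) 1 ltr01 _) _; last exact: ltry.
  by rewrite ltrBlDr ltrDl.
- apply: (@le_lt_trans _ _ (\int[mu]_(s in `]1%R, +oo[) (((2 / d) ^+ 2)%:E * (s `^ (- 2))%:E))%E).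
    apply: ge0_le_integral => //.
      by apply: measurable_funeM; exact: measurable_power.
    move=> s /=; rewrite in_itv/= andbT => s1; have s0 : 0 < s by rewrite (lt_trans _ s1).
    rewrite -EFinM lee_fin (le_trans _ (expR_power_le d0 s0))// ler_piMl ?expR_ge0//.
    by rewrite -[leRHS](powRr0 s); apply: ler_powR; [exact: ltW|rewrite subr_le0].
  rewrite ge0_integralZl_EFin//; last 3 first.
  + by move=> s _; rewrite lee_fin powR_ge0.
  + exact: measurable_power.
  + by rewrite exprn_ge0// divr_ge0// ltW.
  rewrite integral_itv_obnd_cbnd; last exact: measurable_power.
  apply: lte_mul_pinfty => //; first by rewrite lee_fin exprn_ge0// divr_ge0// ltW.
  by apply: le_lt_trans (@power_integraly 2 1 ltr01 _) _; [rewrite ltr1n|exact: ltry].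
Qed.

Lemma bounded_integrable_itv (f : measurableTypeR R -> R) (c a b : R) :
  measurable_fun (`]a, b]%classic : set (measurableTypeR R)) f ->
  (forall t, a < t <= b -> `|f t| <= c) ->
  mu.-integrable (`]a, b]%classic : set (measurableTypeR R)) (EFin \o f).
Proof.
move=> mf fc.
have mD : measurable (`]a, b]%classic : set (measurableTypeR R)) by exact: measurable_itv.
apply/integrableP; split; first exact/measurable_EFinP.
have muD : (mu (`]a, b]%classic : set R) < +oo)%E.
  by rewrite lebesgue_measure_itv/=; case: ifP => _; rewrite -?EFinB ltry.
apply: (@le_lt_trans _ _ (`|c|%:E * mu `]a, b]%classic)%E).
  apply: integral_le_bound => //; first exact/measurable_EFinP.
  apply: aeW => t /=; rewrite in_itv/= => /fc h; rewrite lee_fin (le_trans h)//.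
  exact: ler_norm.
exact: lte_mul_pinfty.
Qed.

End PowerIntegrals.

(** * Beta integrals and convolution of power kernels *)

Section Convolution.
Variable R : realType.
Notation mu := (@lebesgue_measure R).
Implicit Types (a b c t : R).

(** The kernel of fractional integration, extended by 0 to the left half line: convolutions become
    integrals over the whole line, on which translations and Fubini's theorem need no care about
    domains. *)
Definition power_kernel a (s : R) : R := \1_`]0, +oo[ s * s `^ (a - 1).

Lemma mem_itv0y (s : R) : (s \in `]0, +oo[%classic) = (0 < s).
Proof. by rewrite mem_setE in_itv/= andbT. Qed.

Lemma power_kernelE a (s : R) : 0 < s -> power_kernel a s = s `^ (a - 1).
Proof. by move=> s0; rewrite /power_kernel indicE mem_itv0y s0 mul1r. Qed.

Lemma power_kernel0 a (s : R) : s <= 0 -> power_kernel a s = 0.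
Proof. by move=> s0; rewrite /power_kernel indicE mem_itv0y ltNge s0 mul0r. Qed.

Lemma power_kernel_ge0 a (s : R) : 0 <= power_kernel a s.
Proof.
have [s0|s0] := leP s 0; first by rewrite power_kernel0.
by rewrite power_kernelE// powR_ge0.
Qed.

Lemma measurable_power_kernel a :
  measurable_fun setT (power_kernel a : measurableTypeR R -> R).
Proof.
apply: measurable_funM; last exact: measurable_powR.
by apply: measurable_indic; exact: measurable_itv.
Qed.

Lemma power_kernel_integral a (h : R -> \bar R) :
  (\int[mu]_s ((power_kernel a s)%:E * h s) =
   \int[mu]_(s in `]0%R, +oo[) ((s `^ (a - 1))%:E * h s))%E.
Proof.
rewrite [RHS]integral_mkcond; apply: eq_integral => s _; rewrite patchE.
have [s0|s0] := leP s 0.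
  by rewrite power_kernel0// mul0e mem_itv0y ltNge s0.
by rewrite power_kernelE// mem_itv0y s0.
Qed.

Definition beta_integral a b : \bar R :=
  (\int[mu]_s (power_kernel a s * power_kernel b (1 - s))%:E)%E.

Lemma measurable_power_kernel_sub a t :
  measurable_fun setT ((fun s => power_kernel a (t - s)) : measurableTypeR R -> R).
Proof.
apply: (measurableT_comp (measurable_power_kernel a)).
by apply: measurable_funB; [exact: measurable_cst|exact: measurable_id].
Qed.

(** Substituting t s for s pulls out t^(a + b - 1) by homogeneity and leaves the value at t = 1. *)
Lemma power_kernel_conv a b t : 0 < t ->
  (\int[mu]_s (power_kernel a s * power_kernel b (t - s))%:E =
   (power_kernel (a + b) t)%:E * beta_integral a b)%E.
Proof.
move=> t0.
pose f (s : measurableTypeR R) := (power_kernel a s * power_kernel b (t - s))%:E.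
have mf : measurable_fun setT f.
  apply/measurable_EFinP; apply: measurable_funM; first exact: measurable_power_kernel.
  exact: measurable_power_kernel_sub.
have f0 s : (0 <= f s)%E by rewrite lee_fin mulr_ge0 ?power_kernel_ge0.
have tn0 : t != 0 by rewrite gt_eqF.
have := ge0_integral_affine 0 tn0 mf f0.
have -> : (\int[mu]_x f (t * x + 0)%R = (t `^ (a - 1) * t `^ (b - 1))%:E * beta_integral a b)%E.
  rewrite /beta_integral -ge0_integralZl_EFin//; last 3 first.
  - by move=> s _; rewrite lee_fin mulr_ge0 ?power_kernel_ge0.
  - apply/measurable_EFinP; apply: measurable_funM; first exact: measurable_power_kernel.
    exact: measurable_power_kernel_sub.
  - by rewrite mulr_ge0 ?powR_ge0.
  have kE c s : power_kernel c (t * s) = t `^ (c - 1) * power_kernel c s.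
    have [s0|s0] := leP s 0.
      by rewrite !power_kernel0 ?mulr0// mulr_ge0_le0// ltW.
    by rewrite !power_kernelE ?mulr_gt0// powRM// ltW.
  apply: eq_integral => s _; rewrite /f -EFinM addr0; congr EFin.
  by rewrite -[t - _]/(t - t * s) -{2}[t]mulr1 -mulrBr !kE mulrACA.
move=> H; rewrite -/(f _).
have -> : (\int[mu]_s f s = t%:E * ((t `^ (a - 1) * t `^ (b - 1))%:E * beta_integral a b))%E.
  by rewrite H gtr0_norm// muleA -EFinM divff// mul1e.
have E : t * (t `^ (a - 1) * t `^ (b - 1)) = t `^ (a + b - 1).
  rewrite -powRD ?tn0 ?implybT// -{1}(powRr1 (ltW t0)) -powRD ?tn0 ?implybT//.
  by congr (_ `^ _); ring.
by rewrite (power_kernelE (a + b) t0) -E EFinM; exact: muleA.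
Qed.

Lemma power_kernel_integral01 a : 0 < a <= 1 ->
  (\int[mu]_(s in `]0%R, 1%R]) (power_kernel a s)%:E < +oo)%E.
Proof.
move=> /andP[a0 a1].
have -> : (\int[mu]_(s in `]0%R, 1%R]) (power_kernel a s)%:E = \int[mu]_(s in `]0%R, 1%R]) (s `^ (- (1 - a)))%:E)%E.
  by apply: eq_integral => s /[!inE]/= /[!in_itv]/= /andP[s0 _]; rewrite power_kernelE// opprB.
apply: le_lt_trans (@power_integral0 R (1 - a) 1 ltr01 _) _; last exact: ltry.
by rewrite ltrBlDr ltrDl.
Qed.

(** On ]0, 1[ one of s and 1 - s is at least 1/2, and there the corresponding factor is at most its
    argument to the power -1, hence at most 2. So twice the sum of the two kernels dominates their
    product. *)
Lemma beta_integral_lty a b : 0 < a <= 1 -> 0 < b <= 1 -> (beta_integral a b < +oo)%E.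
Proof.
move=> ha hb.
pose q c (s : measurableTypeR R) := ((fun s => (power_kernel c s)%:E) \_ `]0%R, 1%R]) s.
have mq c : measurable_fun setT (q c).
  apply/(measurable_restrictT _ _).1 => //.
  by apply/measurable_EFinP; apply: measurable_funTS; exact: measurable_power_kernel.
have q0 c s : (0 <= q c s)%E by rewrite /q patchE; case: ifP => // _; rewrite lee_fin power_kernel_ge0.
have qlt c : 0 < c <= 1 -> (\int[mu]_s q c s < +oo)%E.
  by move=> hc; rewrite /q -integral_mkcond; exact: power_kernel_integral01.
have mq' c : measurable_fun setT (fun s : measurableTypeR R => q c (1 - s)).
  apply: (measurableT_comp (mq c)).
  by apply: measurable_funB; [exact: measurable_cst|exact: measurable_id].
have half c (s : R) : 0 < c <= 1 -> 2^-1 <= s -> s < 1 -> power_kernel c s <= 2.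
  move=> /andP[c0 c1] s2 s1; have s0 : 0 < s by rewrite (lt_le_trans _ s2)// invr_gt0.
  rewrite power_kernelE// (@le_trans _ _ (s `^ (- 1)))//.
    apply: ger_powR; first by rewrite s0 ltW.
    by rewrite lerBrDr addNr ltW.
  by rewrite powR_inv1 ?(ltW s0)// -[leRHS]invrK lef_pV2 ?posrE// invr_gt0.
apply: (@le_lt_trans _ _ (\int[mu]_s (2%:E * (q a s + q b (1 - s)%R)))%E).
  apply: ge0_le_integral => //.
  - by move=> s _; rewrite lee_fin mulr_ge0 ?power_kernel_ge0.
  - apply/measurable_EFinP; apply: measurable_funM; first exact: measurable_power_kernel.
    exact: measurable_power_kernel_sub.
  - by apply: measurable_funeM; exact: emeasurable_funD.
  - move=> s _.
    have RHS0 : (0 <= 2%:E * (q a s + q b (1 - s)%R))%E.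
      by rewrite mule_ge0// adde_ge0.
    have [s0|s0] := leP s 0; first by rewrite power_kernel0// mul0r.
    have [s1|s1] := leP 1 s; first by rewrite (@power_kernel0 b (1 - s)) ?mulr0// subr_le0.
    have qa : q a s = (power_kernel a s)%:E by rewrite /q patchE mem_set//= in_itv/= s0 ltW.
    have qb : q b (1 - s)%R = (power_kernel b (1 - s))%:E.
      by rewrite /q patchE mem_set//= in_itv/= subr_gt0 s1/= lerBlDr lerDl ltW.
    rewrite qa qb -EFinD -EFinM lee_fin mulrDr.
    have [s2|s2] := leP s 2^-1.
      apply: (@le_trans _ _ (2 * power_kernel a s)); last by rewrite lerDl mulr_ge0 ?power_kernel_ge0.
      rewrite mulrC ler_wpM2r ?power_kernel_ge0//.
      apply: half => //; first by rewrite lerBrDr -lerBrDl (le_trans s2)//; lra.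
      by rewrite ltrBlDr ltrDl.
    apply: (@le_trans _ _ (2 * power_kernel b (1 - s))); last by rewrite lerDr mulr_ge0 ?power_kernel_ge0.
    rewrite ler_wpM2r ?power_kernel_ge0//.
    by apply: half => //; exact: ltW.
rewrite ge0_integralZl_EFin//; last 2 first.
- by move=> s _; rewrite adde_ge0.
- exact: emeasurable_funD.
apply: lte_mul_pinfty => //.
rewrite ge0_integralD// lte_add_pinfty ?qlt//.
have := @ge0_integral_affine R (- 1) 1 (q b) _ (mq b) (q0 b).
rewrite (_ : (fun x => _) = (fun s => q b (1 - s)%R)); last first.
  by apply/funext => s; rewrite mulN1r addrC.
by move=> ->; rewrite ?oppr_eq0 ?oner_neq0// normrN1 invr1 mul1e qlt.
Qed.

(** For a, b at most 1 both factors are at least 1 on ]0, 1[. *)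
Lemma beta_integral_gt0 a b : 0 < a <= 1 -> 0 < b <= 1 -> (0 < beta_integral a b)%E.
Proof.
move=> /andP[a0 a1] /andP[b0 b1].
apply: (@lt_le_trans _ _ 1%E); first by rewrite lte_fin.
have -> : 1%E = (\int[mu]_s (\1_`]0%R, 1%R[ s : R)%:E)%E.
  have <- : mu (`]0%R, 1%R[%classic : set R) = 1%E.
    by rewrite lebesgue_measure_itv/= lte_fin ltr01 sube0.
  by rewrite integral_indic ?setIT.
apply: ge0_le_integral => //.
- by apply/measurable_EFinP; exact: measurable_indic.
- apply/measurable_EFinP; apply: measurable_funM; first exact: measurable_power_kernel.
  exact: measurable_power_kernel_sub.
- move=> s _; rewrite lee_fin indicE; have [|_] := boolP (s \in _); last first.
    by rewrite mulr_ge0 ?power_kernel_ge0.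
  move=> /[!inE]/= /[!in_itv]/= /andP[s0 s1].
  have ge1 c (r : R) : c <= 1 -> 0 < r -> r < 1 -> 1 <= power_kernel c r.
    move=> c1 r0 r1; rewrite power_kernelE// -[leLHS](powRr0 r).
    by apply: ger_powR; [rewrite r0 ltW|rewrite subr_le0].
  rewrite -[leLHS]mulr1 ler_pM//; first exact: ge1.
  by apply: ge1 => //; rewrite ?subr_gt0// ltrBlDr ltrDl.
Qed.

Lemma measurable_expRN (d : R) : measurable_fun setT ((fun s => expR (- (d * s))) : measurableTypeR R -> R).
Proof.
apply: (measurableT_comp (f := @expR R)) => //.
by under eq_fun do rewrite -mulNr; exact: measurable_funM.
Qed.

Lemma power_kernel_expR_integrable a (d : R) : 0 < a <= 1 -> 0 < d ->
  mu.-integrable setT (fun s => (power_kernel a s * expR (- (d * s)))%:E).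
Proof.
move=> ha d0; apply/integrableP; split.
  apply/measurable_EFinP; apply: measurable_funM; first exact: measurable_power_kernel.
  exact: measurable_expRN.
have -> : (\int[mu]_s `|(power_kernel a s * expR (- (d * s)))%:E| =
    \int[mu]_s ((power_kernel a s)%:E * (expR (- (d * s)))%:E))%E.
  apply: eq_integral => s _.
  by rewrite gee0_abs ?EFinM// lee_fin mulr_ge0 ?power_kernel_ge0 ?expR_ge0.
by rewrite power_kernel_integral; under eq_integral do rewrite -EFinM; exact: gamma_integral_lty.
Qed.

Lemma power_kernel_integrable a (h : measurableTypeR R -> R) (M d : R) :
  0 < a <= 1 -> 0 < d -> measurable_fun setT h ->
  (forall t, 0 < t -> `|h t| <= M * expR (- (d * t))) ->
  mu.-integrable setT (fun s => (power_kernel a s * h s)%:E).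
Proof.
move=> ha d0 mh hM.
apply: le_integrable (integrableZl measurableT M (power_kernel_expR_integrable ha d0)) => //.
  by apply/measurable_EFinP; apply: measurable_funM => //; exact: measurable_power_kernel.
move=> s _; rewrite -EFinM lee_fin; have [s0|s0] := leP s 0.
  by rewrite power_kernel0// !mul0r normr0.
have -> : M * (power_kernel a s * expR (- (d * s))) = power_kernel a s * (M * expR (- (d * s))) by ring.
rewrite !(normrM (power_kernel a s)) !(ger0_norm (power_kernel_ge0 a s)).
by rewrite ler_wpM2l ?power_kernel_ge0// (le_trans (hM _ s0))// ler_norm.
Qed.

(** The scalar form of the composition law for negative powers: exchanging the integrals leaves the
    convolution of two power kernels inside. The exchange is justified by Tonelli, since the same
    computation with |h| is finite by the exponential decay of h. *)
Lemma power_kernel_fubini a b (h : measurableTypeR R -> R) (M d : R) :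
  0 < a -> 0 < b -> a + b <= 1 -> 0 < d ->
  measurable_fun setT h -> (forall t, t <= 0 -> h t = 0) ->
  (forall t, 0 < t -> `|h t| <= M * expR (- (d * t))) ->
  \int[mu]_s (power_kernel a s * \int[mu]_t (power_kernel b (t - s) * h t)) =
  fine (beta_integral a b) * \int[mu]_t (power_kernel (a + b) t * h t).
Proof.
move=> a0 b0 ab1 d0 mh h0 hM.
have a1 : a <= 1 by rewrite (le_trans _ ab1)// lerDl ltW.
have b1 : b <= 1 by rewrite (le_trans _ ab1)// lerDr ltW.
have ab01 : 0 < a + b <= 1 by rewrite addr_gt0.
pose f (st : measurableTypeR R * measurableTypeR R) : \bar R :=
  (power_kernel a st.1 * (power_kernel b (st.2 - st.1) * h st.2))%:E.
have mf : measurable_fun setT f.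
  apply/measurable_EFinP; apply: measurable_funM.
    exact: (measurableT_comp (measurable_power_kernel a)).
  apply: measurable_funM; last exact: (measurableT_comp mh).
  apply: (measurableT_comp (measurable_power_kernel b)).
  exact: measurable_funB.
have bl : (beta_integral a b < +oo)%E by apply: beta_integral_lty; rewrite ?a0 ?b0.
have bfin : beta_integral a b \is a fin_num.
  rewrite ge0_fin_numE//; apply: ltW; apply: beta_integral_gt0; rewrite ?a0 ?b0//.
have mk c t : measurable_fun setT (fun s : measurableTypeR R => (power_kernel a s * power_kernel c (t - s))%:E).
  apply/measurable_EFinP; apply: measurable_funM; first exact: measurable_power_kernel.
  exact: measurable_power_kernel_sub.
have inner t : (\int[mu]_s `|f (s, t)| = (`|h t| * power_kernel (a + b) t)%:E * beta_integral a b)%E.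
  have [t0|t0] := leP t 0.
    rewrite h0// normr0 mul0r mul0e integral0_eq// => s _.
    by rewrite /f/= h0// !mulr0 normr0.
  rewrite EFinM -muleA -power_kernel_conv// -ge0_integralZl_EFin//.
  - apply: eq_integral => s _; rewrite /f /= -EFinM; congr EFin.
    by rewrite mulrA normrM mulrC [X in _ * X]ger0_norm// mulr_ge0 ?power_kernel_ge0.
  - by move=> s _; rewrite lee_fin mulr_ge0 ?power_kernel_ge0.
have intf : (mu \x mu)%E.-integrable setT f.
  apply/(integrable21ltyP _ _ mf) => //.
  under eq_integral do rewrite inner muleC.
  rewrite ge0_integralZl//; last 3 first.
  - by apply/measurable_EFinP; apply: measurable_funM; [exact: measurableT_comp|exact: measurable_power_kernel].
  - by move=> t _; rewrite lee_fin mulr_ge0 ?power_kernel_ge0.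
  - by apply: ltW; apply: beta_integral_gt0; rewrite ?a0 ?b0.
  have -> : beta_integral a b = (fine (beta_integral a b))%:E by rewrite fineK.
  apply: lte_mul_pinfty; [|by []|].
    by rewrite lee_fin fine_ge0// ltW//; apply: beta_integral_gt0; rewrite ?a0 ?b0.
  have /integrableP[_] := power_kernel_integrable ab01 d0 mh hM.
  apply: le_lt_trans; apply: ae_le_integral => //; first by move=> t _; rewrite lee_fin mulr_ge0 ?power_kernel_ge0.
  by apply: aeW => t _; rewrite lee_fin normrM mulrC ger0_norm ?power_kernel_ge0.
have := Fubini intf => /(congr1 fine).
(* For fixed s the translation by s reduces this to [power_kernel_integrable]: shifting h to the
   left only improves its exponential bound. *)
have intin s : 0 < s -> mu.-integrable setT (EFin \o (fun t => power_kernel b (t - s) * h t)).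
  move=> s0.
  have hb : 0 < b <= 1 by rewrite b0.
  have mhs : measurable_fun setT ((fun t => h (t + s)) : measurableTypeR R -> R).
    by apply: (measurableT_comp mh); apply: measurable_funD => //.
  have hMs t : 0 < t -> `|h (t + s)| <= `|M| * expR (- (d * t)).
    move=> t0; have := hM (t + s) (addr_gt0 t0 s0); move/le_trans; apply.
    apply: (@le_trans _ _ (`|M| * expR (- (d * (t + s))))).
      by rewrite ler_wpM2r ?expR_ge0// ler_norm.
    by rewrite ler_wpM2l// ler_expR lerN2 ler_pM2l// lerDl ltW.
  have /integrableP[_ fin] := power_kernel_integrable hb d0 mhs hMs.
  have mf1 : measurable_fun setT ((fun t => power_kernel b (t - s) * h t) : measurableTypeR R -> R).
    apply: measurable_funM => //; apply: (measurableT_comp (measurable_power_kernel b)).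
    by apply: measurable_funB => //.
  apply/integrableP; split; first exact/measurable_EFinP.
  have := @ge0_integral_affine R 1 s (fun t => `|(power_kernel b (t - s) * h t)%:E|%E) (oner_neq0 _) _ _.
  rewrite normr1 invr1 mul1e => <- //; last first.
    by apply: measurableT_comp => //; exact/measurable_EFinP.
  apply: le_lt_trans fin; rewrite le_eqVlt; apply/orP; left; apply/eqP.
  by apply: eq_integral => t _; rewrite mul1r addrK.
have -> : (\int[mu]_x \int[mu]_y f (x, y) = \int[mu]_s (power_kernel a s * \int[mu]_t (power_kernel b (t - s) * h t))%:E)%E.
  apply: eq_integral => s _; have [s0|s0] := leP s 0.
    rewrite power_kernel0// mul0r integral0_eq// => t _.
    by rewrite /f/= power_kernel0// mul0r.
  rewrite EFinM /Rintegral fineK; last exact: integrable_fin_num (intin s s0).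
  rewrite -integralZl//; last exact: (intin s s0).
have -> : (\int[mu]_y \int[mu]_x f (x, y) = \int[mu]_t (fine (beta_integral a b) * (power_kernel (a + b) t * h t))%:E)%E.
  apply: eq_integral => t _; have [t0|t0] := leP t 0.
    by rewrite h0// !mulr0 integral0_eq// => s _; rewrite /f/= h0// !mulr0.
  under eq_integral do rewrite /f/= mulrA mulrC EFinM.
  rewrite integralZl//; last first.
    apply/integrableP; split; first exact: mk.
    rewrite (_ : (\int[mu]_x _)%E = (\int[mu]_s (power_kernel a s * power_kernel b (t - s))%:E)%E); last first.
      apply: eq_integral => s _.
      by rewrite gee0_abs// lee_fin mulr_ge0 ?power_kernel_ge0.
    rewrite power_kernel_conv// -(fineK bfin) -EFinM; exact: ltry.
  rewrite power_kernel_conv// -[X in (_ * (_ * X))%E](fineK bfin) -!EFinM; congr EFin; ring.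
move=> H; transitivity (\int[mu]_t (fine (beta_integral a b) * (power_kernel (a + b) t * h t))); first exact: H.
by rewrite RintegralZl//; exact: power_kernel_integrable ab01 d0 mh hM.
Qed.

End Convolution.

(** * Negative powers from an exponentially stable semigroup *)

Section FractionalIntegral.
Variables (R : realType) (X : completeNormedModType R).
Notation mu := (@lebesgue_measure R).
Implicit Types (a b r s t N : R) (x y : X).
Variables (S : R -> X -> X) (M d : R).
Hypotheses (M0 : 0 <= M) (d0 : 0 < d).
Hypothesis S_linear : forall t, 0 <= t -> bounded_linear (M * expR (- (d * t))) (S t).
Hypothesis S_id : forall x, S 0 x = x.
Hypothesis S_add : forall t s x, 0 <= t -> 0 <= s -> S (t + s) x = S t (S s x).
Hypothesis S_cvg : forall x, S t x @[t --> 0^'+] --> x.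

Let S_le t x : 0 <= t -> `|S t x| <= M * `|x|.
Proof.
move=> t0; have [_ /(_ x)/le_trans] := S_linear t0; apply.
rewrite ler_wpM2r// -[leRHS]mulr1 ler_wpM2l// -[leRHS]expR0 ler_expR oppr_le0.
by rewrite mulr_ge0// ltW.
Qed.

(** Factoring out S at the smaller time turns right continuity at 0 into a two-sided modulus of
    continuity on all of R_+. *)
Let S_dist r t x : 0 <= r -> 0 <= t -> `|S r x - S t x| <= M * `|S `|r - t| x - x|.
Proof.
move=> r0 t0; wlog rt : r t r0 t0 / r <= t => [H|].
  have [rt|/ltW tr] := leP r t; first exact: H.
  by rewrite distrC [`|r - t|]distrC; exact: H.
rewrite distrC [`|r - t|]distrC (@ger0_norm _ (t - r)) ?subr_ge0//.
have -> : S t x = S r (S (t - r) x) by rewrite -S_add ?subr_ge0// subrKC.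
by rewrite -(bounded_linearB _ _ (S_linear r0)) S_le.
Qed.

Let S_near x e : 0 < e -> exists2 del, 0 < del & forall h, 0 <= h -> h < del -> `|S h x - x| <= e.
Proof.
move=> e0; have /cvgrPdist_le/(_ _ e0)[del /= del0 hdel] := @S_cvg x.
exists del => // h; rewrite le_eqVlt => /predU1P[<- _|h0 hd].
  by rewrite S_id subrr normr0 ltW.
by rewrite distrC; apply: hdel => //=; rewrite sub0r normrN gtr0_norm.
Qed.

Let M1 : 0 < M + 1. Proof. by rewrite ltr_wpDl. Qed.

Let M_le e : 0 <= e -> M * (e / (M + 1)) <= e.
Proof. by move=> e0; rewrite mulrA ler_pdivrMr// mulrC ler_wpM2l// lerDl. Qed.

Lemma semigroup_cvg (r : nat -> R) (y : nat -> X) t x : (forall n, 0 <= r n) -> 0 <= t ->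
  r n @[n --> \oo] --> t -> y n @[n --> \oo] --> x -> S (r n) (y n) @[n --> \oo] --> S t x.
Proof.
move=> r0 t0 rt yx; apply/cvgrPdist_le => e e0.
have e2 : 0 < e / 2 by rewrite divr_gt0.
have e1 : 0 < e / 2 / (M + 1) by rewrite divr_gt0.
have [del del0 hS] := S_near x e1.
near=> n.
rewrite -(subrK (S (r n) x) (S t x)) -addrA (le_trans (ler_normD _ _))// (splitr e) lerD//.
  rewrite distrC (le_trans (S_dist _ (r0 n) t0))// (le_trans _ (M_le (ltW e2)))//.
  rewrite ler_wpM2l//; apply: hS => //; near: n.
  by move/cvgrPdist_lt/(_ _ del0) : rt; apply: filterS => n; rewrite distrC.
rewrite -(bounded_linearB _ _ (S_linear (r0 n))) (le_trans (S_le _ (r0 n)))//.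
rewrite (le_trans _ (M_le (ltW e2)))// ler_wpM2l//; near: n.
by move/cvgrPdist_le/(_ _ e1) : yx.
Unshelve. all: by end_near. Qed.

Lemma semigroup_norm_continuous x : continuous (fun t : R => S `|t| x).
Proof.
move=> t; apply/cvgrPdist_le => e e0.
have e1 : 0 < e / (M + 1) by rewrite divr_gt0.
have [del del0 hS] := S_near x e1.
near=> u; rewrite (le_trans (S_dist _ (normr_ge0 t) (normr_ge0 u)))//.
rewrite (le_trans _ (M_le (ltW e0)))// ler_wpM2l//; apply: hS => //.
rewrite (le_lt_trans (ler_dist_dist _ _))//; near: u.
Unshelve. all: by end_near. Qed.

(** Gamma(a) times the power of order -a of minus the generator of S. Without the normalisation,
    composition produces beta integrals only. *)
Definition pint (a : R) (x : X) : X :=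
  bochner `]0, +oo[ (fun t => t `^ (a - 1) *: S t x).

Let mpos : measurable (`]0, +oo[%classic : set (measurableTypeR R)).
Proof. exact: measurable_itv. Qed.

Let strongly_measurable_integrand a (x : X) :
  strongly_measurable (`]0, +oo[%classic : set (measurableTypeR R)) (fun t => t `^ (a - 1) *: S t x).
Proof.
apply: strongly_measurable_right_continuous.
  by move=> t /=; rewrite in_itv/= andbT => /ltW.
apply: aeW => t /=; rewrite in_itv/= andbT => t0 r hr rt.
apply: cvgZ; last first.
  apply: semigroup_cvg => //; [by move=> n; case/andP: (hr n)|exact: ltW|exact: cvg_cst].
have c : {for (t : R), continuous (fun s : R => s `^ (a - 1))}.
  apply: differentiable_continuous; apply/derivable1_diffP.
  by apply: derivable_powR; rewrite in_itv/= andbT.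
by apply: (@cvg_comp _ _ _ r (fun s : R => s `^ (a - 1)) _ (nbhs (t : R))) => //; exact: c.
Qed.

Let Ia a := fine (\int[mu]_(s in `]0%R, +oo[) (s `^ (a - 1) * expR (- (d * s)))%:E)%E.

Let integrand_le a (x : X) : 0 < a <= 1 ->
  (\int[mu]_(t in `]0%R, +oo[) (`|t `^ (a - 1) *: S t x|)%:E <= (M * `|x| * Ia a)%:E)%E.
Proof.
move=> ha; have fin := gamma_integral_lty ha d0.
rewrite EFinM fineK; last first.
  by rewrite ge0_fin_numE// integral_ge0// => s _; rewrite lee_fin mulr_ge0 ?powR_ge0 ?expR_ge0.
rewrite -ge0_integralZl_EFin//; last 3 first.
- by move=> s _; rewrite lee_fin mulr_ge0 ?powR_ge0 ?expR_ge0.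
- apply/measurable_EFinP; apply: measurable_funM.
    by apply: measurable_funTS; exact: measurable_powR.
  by apply: measurable_funTS; exact: measurable_expRN.
- by rewrite mulr_ge0.
apply: ae_le_integral => //.
  by move=> s _; rewrite -EFinM lee_fin !mulr_ge0 ?powR_ge0 ?expR_ge0.
apply: aeW => t /=; rewrite in_itv/= andbT => t0.
rewrite -EFinM lee_fin normrZ ger0_norm ?powR_ge0// mulrCA ler_wpM2l ?powR_ge0//.
by have [_ /(_ x)] := S_linear (ltW t0); rewrite mulrAC.
Qed.

Lemma pintP a (x : X) : 0 < a <= 1 ->
  is_bochner `]0, +oo[ (fun t => t `^ (a - 1) *: S t x) (pint a x).
Proof.
move=> ha; apply: bochnerE => //; split; first exact: strongly_measurable_integrand.
by apply: le_lt_trans (integrand_le x ha) _; exact: ltry.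
Qed.

Lemma pint_linear a : 0 < a <= 1 -> bounded_linear (M * Ia a) (pint a).
Proof.
move=> ha; split=> [c x y|x].
  apply: (is_bochner_unique mpos (pintP _ ha)).
  have := is_bochnerD mpos (is_bochnerZ c mpos (pintP x ha)) (pintP y ha).
  apply: is_bochner_ae; apply: aeW => t /=; rewrite in_itv/= andbT => t0.
  by have [-> _] := S_linear (ltW t0); rewrite scalerDr !scalerA mulrC.
rewrite -lee_fin (le_trans (is_bochner_norm mpos (pintP x ha)))//.
by rewrite (le_trans (integrand_le x ha))// mulrAC.
Qed.

Lemma pint_comm a t x : 0 < a <= 1 -> 0 <= t -> S t (pint a x) = pint a (S t x).
Proof.
move=> ha t0; apply: (is_bochner_unique mpos _ (pintP _ ha)).
have := is_bochner_linear mpos (pintP x ha) (S_linear t0).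
apply: is_bochner_ae; apply: aeW => s /=; rewrite in_itv/= andbT => /ltW s0.
by rewrite (bounded_linearZ _ _ (S_linear t0)) -!S_add// [t + s]addrC.
Qed.

(** Tested against a functional phi, this is [power_kernel_fubini] for the scalar function phi (S t
    x): the inner power is expanded through the functional phi composed with S s, and its time is
    translated by s. *)
Lemma pint_law a b x : 0 < a -> 0 < b -> a + b <= 1 ->
  pint a (pint b x) = fine (beta_integral a b : \bar R) *: pint (a + b) x.
Proof.
move=> a0 b0 ab1.
have ha : 0 < a <= 1 by rewrite a0 (le_trans _ ab1)// lerDl ltW.
have hb : 0 < b <= 1 by rewrite b0 (le_trans _ ab1)// lerDr ltW.
have hab : 0 < a + b <= 1 by rewrite addr_gt0.
apply: functional_separation => phi hphi.
rewrite (bounded_linearZ _ _ hphi).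
(* The absolute value makes the orbit continuous on the whole line, hence h Borel; the indicator
   removes negative times. *)
pose h (t : measurableTypeR R) : R := \1_`]0, +oo[ t * phi (S `|t| x).
have hE t : 0 < t -> h t = phi (S t x).
  by move=> t0; rewrite /h indicE mem_itv0y t0 mul1r gtr0_norm.
have h0 t : t <= 0 -> h t = 0.
  by move=> t0; rewrite /h indicE mem_itv0y ltNge t0 mul0r.
have mh : measurable_fun setT h.
  apply: measurable_funM; first by apply: measurable_indic; exact: measurable_itv.
  apply: continuous_measurable_fun => t.
  apply: (@cvg_comp _ _ _ (fun t : R => S `|t| x) phi _ (nbhs (S `|t| x))).
    exact: semigroup_norm_continuous.
  exact: (bounded_linear_continuous hphi).
have hM t : 0 < t -> `|h t| <= (M * `|x|) * expR (- (d * t)).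
  move=> t0; rewrite hE//; have [_ /(_ (S t x))/le_trans] := hphi; apply; rewrite mul1r.
  by have [_ /(_ x)] := S_linear (ltW t0); rewrite mulrAC.
have E c (k : R -> R) : \int[mu]_(t in `]0, +oo[) (t `^ (c - 1) * k t) = \int[mu]_t (power_kernel c t * k t).
  rewrite Rintegral_mkcond; apply: eq_Rintegral => t _; rewrite patchE mem_itv0y.
  by have [t0|t0] := ltP; [rewrite power_kernelE|rewrite power_kernel0// mul0r].
have phiE c y : 0 < c <= 1 -> phi (pint c y) = \int[mu]_t (power_kernel c t * phi (S t y)).
  move=> hc; rewrite (is_bochner_weak mpos (pintP y hc) hphi) -E.
  by apply: eq_Rintegral => t _; rewrite (bounded_linearZ _ _ hphi).
apply: etrans (phiE _ _ ha) _; apply: etrans (congr1 ( *%R _) (esym (phiE _ _ hab))).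
transitivity (fine (beta_integral a b : \bar R) * \int[mu]_t (power_kernel (a + b) t * h t)); last first.
  congr (_ * _); apply: eq_Rintegral => t _.
  by have [t0|t0] := ltP 0 t; [rewrite hE|rewrite power_kernel0// !mul0r].
rewrite -(power_kernel_fubini a0 b0 ab1 d0 mh h0 hM).
apply: eq_Rintegral => s _; have [s0|s0] := ltP 0 s; last by rewrite power_kernel0// !mul0r.
congr (_ * _).
have hl := bounded_linear_comp ler01 hphi (S_linear (ltW s0)).
rewrite -[LHS]/((phi \o S s) _) (is_bochner_weak mpos (pintP x hb) hl).
under eq_Rintegral do rewrite (bounded_linearZ _ _ hl).
rewrite E -(@Rintegral_translate R s (fun t => power_kernel b (t - s) * h t)); last first.
  apply: measurable_funM => //; apply: (measurableT_comp (measurable_power_kernel b)).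
  by apply: measurable_funB.
apply: eq_Rintegral => t _; rewrite addrK; have [t0|t0] := ltP 0 t; last by rewrite power_kernel0// !mul0r.
by rewrite hE ?addr_gt0//= -S_add ?ltW// addrC.
Qed.

(** Translation by N shows that the tail of the integral over ]N, +oo[ is S N applied to the whole
    integral. *)
Lemma pint1_split N x : 0 < N ->
  is_bochner `]0, N] (fun r => S r x) (pint 1 x - S N (pint 1 x)).
Proof.
move=> N0; have h1 : 0 < (1 : R) <= 1 by rewrite ltr01 lexx.
have P1 : is_bochner `]0, +oo[ (fun r => S r x) (pint 1 x).
  apply: is_bochner_ae (pintP x h1); apply: aeW => t _.
  by rewrite subrr powRr0 scale1r.
have mN : measurable (`]N, +oo[%classic : set (measurableTypeR R)) by exact: measurable_itv.
have m0N : measurable (`]0, N]%classic : set (measurableTypeR R)) by exact: measurable_itv.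
have P2 : is_bochner `]N, +oo[ (fun r => S r x) (S N (pint 1 x)).
  have := is_bochner_translate (- N) mpos (is_bochner_linear mpos P1 (S_linear (ltW N0))).
  rewrite (_ : _ @^-1` _ = `]N, +oo[%classic); last first.
    by apply/seteqP; split => t /=; rewrite !in_itv/= !andbT subr_gt0.
  apply: is_bochner_ae; apply: aeW => t /=; rewrite in_itv/= andbT => Nt.
  by rewrite -S_add ?subr_ge0 ?ltW// addrC subrK.
have [v Pv] : exists v, is_bochner `]0, N] (fun r => S r x) v.
  apply: bochner_exists => //; apply: (bochner_integrableS mpos) => //.
    by move=> t /=; rewrite !in_itv/= => /andP[->].
  exact: is_bochner_integrable P1.
suff E : pint 1 x = v + S N (pint 1 x) by rewrite [X in X - _]E addrK.
apply: (is_bochner_unique mpos P1).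
rewrite (_ : `]0, +oo[%classic = `]0, N]%classic `|` `]N, +oo[%classic); last first.
  by rewrite -itv_bndbnd_setU ?bnd_simp//= ltW.
apply: is_bochner_setU => //.
apply/disj_set2P/seteqP; split => // s /=; rewrite !in_itv/= andbT => -[/andP[_ s1]].
by rewrite ltNge s1.
Qed.

(** If [pint 1 x] vanishes, so does the integral of S r x over every interval ]0, N]. For small N
    this contradicts S r x being close to x, as seen by a functional norming x. *)
Lemma pint1_inj x : pint 1 x = 0 -> x = 0.
Proof.
move=> x0; have [->//|xn0] := eqVneq x 0; exfalso.
have [phi hphi phix] := norming_functional x.
have nx : 0 < `|x| by rewrite normr_gt0.
have nx2 : 0 < `|x| / 2 by rewrite divr_gt0.
have /cvgrPdist_le/(_ _ nx2)[e /= e0 he] := @S_cvg x.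
have e20 : 0 < e / 2 by rewrite divr_gt0.
have mD : measurable (`]0, e / 2]%classic : set (measurableTypeR R)) by exact: measurable_itv.
have := pint1_split x e20; rewrite x0 (bounded_linear0 (S_linear (ltW e20))) subrr => Hb.
have := is_bochner_weak mD Hb hphi; rewrite (bounded_linear0 hphi) => E0.
suff : `|x| / 2 * (e / 2) <= \int[mu]_(t in `]0, e / 2]) phi (S t x).
  by rewrite -E0 leNgt mulr_gt0.
have mfin : fine (mu (`]0, e / 2]%classic : set R)) = e / 2.
  by rewrite lebesgue_measure_itv/= lte_fin e20/= subr0.
rewrite -{1}mfin -(Rintegral_cst _ mD).
have cphi : continuous (fun t : R => phi (S `|t| x)).
  move=> t; apply: (@cvg_comp _ _ _ (fun t : R => S `|t| x) phi _ (nbhs (S `|t| x))).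
    exact: semigroup_norm_continuous.
  exact: (bounded_linear_continuous hphi).
have Ephi : {in (`]0, e / 2]%classic : set R), (fun t => phi (S `|t| x)) =1 (fun t => phi (S t x))}.
  by move=> t /[!inE]/= /[!in_itv]/= /andP[t0 _]; rewrite gtr0_norm.
apply: le_Rintegral => //.
- exact: (@bounded_integrable_itv R _ `| `|x| / 2 |).
- apply: (@bounded_integrable_itv R _ (M * `|x|)).
    apply: eq_measurable_fun Ephi _; apply: measurable_funTS.
    exact: continuous_measurable_fun.
  move=> t /andP[t0 te]; have [_ /(_ (S t x))/le_trans] := hphi; apply.
  by rewrite mul1r S_le// ltW.
- move=> t /=; rewrite in_itv/= => /andP[t0 te].
  have : `|phi x - phi (S t x)| <= `|x| / 2.
    rewrite -(bounded_linearB _ _ hphi); have [_ /(_ (x - S t x))/le_trans] := hphi; apply.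
    rewrite mul1r; apply: he => //=; rewrite sub0r normrN gtr0_norm//.
    by rewrite (le_lt_trans te)// ltr_pdivrMr// ltr_pMr// ltr1n.
  move/(le_trans (ler_norm _)); rewrite phix; set v : R := phi (S t x) => h.
  by rewrite /= in h *; lra.
Qed.

(** The power of complementary order 1 - a reduces the claim to order one. *)
Lemma pint_inj a x : 0 < a <= 1 -> pint a x = 0 -> x = 0.
Proof.
move=> /andP[a0]; rewrite le_eqVlt => /predU1P[->|a1]; first exact: pint1_inj.
have b0 : 0 < 1 - a by rewrite subr_gt0.
have ha : 0 < a <= 1 by rewrite a0 ltW.
have hb : 0 < 1 - a <= 1 by rewrite b0 lerBlDr lerDl ltW.
move=> x0; apply: pint1_inj; apply/eqP.
have := pint_law x b0 a0; rewrite subrK lexx x0 (bounded_linear0 (pint_linear hb)) => /(_ isT)/esym/eqP.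
rewrite scaler_eq0 fine_eq0 ?gt_eqF//; first exact: beta_integral_gt0.
by rewrite ge0_fin_numE ?beta_integral_lty// ltW// beta_integral_gt0.
Qed.

(** Q t stands for minus the derivative of S at t, known through functionals; for the rescaled
    semigroup it is (omega I - A) S t. *)
Variables (Q : R -> X -> X) (K : R).
Hypothesis Q_le : forall t x, 0 < t -> `|Q t x| <= K / t * `|x|.
Hypothesis Q_add : forall s t x, 0 <= s -> 0 < t -> S s (Q t x) = Q (s + t) x.
Hypothesis Q_derive : forall t x C (phi : X -> R^o), 0 < t -> bounded_linear C phi ->
  is_derive t (1 : R) (fun r => phi (S r x)) (- phi (Q t x)).

(** The difference z of the two sides satisfies z = S N z for all N > 0: by [pint1_split] and the
    fundamental theorem of calculus, both z and S N z account for the same integral of Q (r + t) x.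
    Exponential decay then forces z = 0. *)
Lemma pint1_derivative t x : 0 < t -> pint 1 (Q t x) = S t x.
Proof.
move=> t0; set z := pint 1 (Q t x) - S t x.
suff zS N : 0 < N -> z = S N z.
  apply/eqP; rewrite -subr_eq0 -/z -normr_eq0; apply/eqP/le_anti; rewrite normr_ge0 andbT.
  apply/ler_addgt0Pl => e e0; rewrite addr0.
  (* N is chosen so that M |z| is at most e (1 + d N), which is at most e times exp(d N); the
     summand 1 makes it positive. *)
  pose N := M * `|z| / (d * e) + 1.
  have N0 : 0 < N by rewrite ltr_wpDl// divr_ge0 ?mulr_ge0// ltW.
  rewrite (zS N N0); have [_ /(_ z)/le_trans] := S_linear (ltW N0); apply.
  rewrite mulrAC expRN ler_pdivrMr ?expR_gt0//.
  apply: (@le_trans _ _ (e * (1 + d * N))); last first.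
    by apply: ler_wpM2l; [exact: ltW|exact: expR_ge1Dx].
  rewrite mulrDr mulr1 mulrDr mulr1 mulrDr.
  have -> : e * (d * (M * `|z| / (d * e))) = M * `|z| by field; rewrite !gt_eqF.
  by rewrite addrCA lerDl addr_ge0 ?mulr_ge0 ?ltW.
move=> N0; set P := pint 1 (Q t x).
have swap (a b c e : X) : a - c = b - e -> a - b = c - e.
  by move/eqP; rewrite subr_eq => /eqP ->; rewrite addrAC (addrC b) addrK addrC.
rewrite /z (bounded_linearB _ _ (S_linear (ltW N0))); apply: swap.
have mD : measurable (`]0, N]%classic : set (measurableTypeR R)) by exact: measurable_itv.
apply: functional_separation => phi hphi.
rewrite (is_bochner_weak mD (pint1_split (Q t x) N0) hphi).
pose F r : R := - phi (S (r + t) x).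
pose f r : R := phi (S `|r| (Q t x)).
have dF r : - t < r -> is_derive r (1 : R) F (phi (Q (r + t) x)).
  rewrite -subr_gt0 opprK => rt.
  have d1 := Q_derive x rt hphi.
  have d2 : is_derive r (1 : R) (shift t : R -> R) 1 by exact: is_derive_shift.
  have := is_deriveN (is_derive1_comp (f := fun s => phi (S s x)) (g := shift t) (x := r) d1 d2).
  by rewrite mulr1 opprK.
have cF r : - t < r -> {for r, continuous F}.
  by move=> /dF h; apply: differentiable_continuous; apply/derivable1_diffP; case: h.
have cf : continuous f.
  move=> r; apply: (@cvg_comp _ _ _ (fun r : R => S `|r| (Q t x)) phi _ (nbhs (S `|r| (Q t x)))).
    exact: semigroup_norm_continuous.
  exact: (bounded_linear_continuous hphi).
have tn0 : - t < 0 by rewrite oppr_lt0.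
have := @continuous_FTC2 R f F 0 N N0 (continuous_subspaceT cf).
rewrite -integral_itv_obnd_cbnd; last first.
  by apply/measurable_EFinP; apply: measurable_funTS; exact: continuous_measurable_fun.
move=> FTC; rewrite (bounded_linearB _ _ hphi) -S_add ?(ltW N0) ?(ltW t0)//.
have -> : phi (S t x) - phi (S (N + t) x) = fine ((F N)%:E - (F 0)%:E)%E.
  by rewrite /F /= add0r opprK addrC.
rewrite -FTC.
- congr fine; apply: eq_integral => r /[!inE]/= /[!in_itv]/= /andP[r0 _].
  by rewrite /f gtr0_norm.
- split.
  + by move=> r /[!in_itv]/= /andP[r0 _]; case: (dF r (lt_trans tn0 r0)).
  + by apply: cvg_at_right_filter; exact: cF.
  + by apply: cvg_at_left_filter; apply: cF; exact: lt_trans N0.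
- move=> r /[!in_itv]/= /andP[r0 _]; rewrite derive1E.
  have h := dF r (lt_trans tn0 r0); rewrite derive_val /f gtr0_norm// Q_add//.
  exact: ltW.
Qed.

(** Formally the power of order a of S t is the power of order -(1 - a) of Q t, and this is the
    witness y, up to the beta factor. Its integral has integrand s^-a Q (s + t) x, bounded through
    [stieltjes_integral]. *)
Lemma pint_range a t x : 0 < a < 1 -> 0 < t -> exists2 y, pint a y = S t x &
  `|y| <= (fine (beta_integral a (1 - a) : \bar R))^-1 * (K * (1 / (1 - a) + 1 / a)) * t `^ (- a) * `|x|.
Proof.
move=> /andP[a0 a1] t0.
have b0 : 0 < 1 - a by rewrite subr_gt0.
have ha : 0 < a <= 1 by rewrite a0 ltW.
have hb : 0 < 1 - a <= 1 by rewrite b0 lerBlDr lerDl ltW.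
have B0 : 0 < fine (beta_integral a (1 - a) : \bar R).
  by apply: fine_gt0; rewrite beta_integral_gt0// beta_integral_lty.
exists ((fine (beta_integral a (1 - a) : \bar R))^-1 *: pint (1 - a) (Q t x)).
  rewrite (bounded_linearZ _ _ (pint_linear ha)) pint_law//; last by rewrite subrKC.
  by rewrite scalerA mulVf ?gt_eqF// scale1r subrKC pint1_derivative.
have Bi : 0 <= (fine (beta_integral a (1 - a) : \bar R))^-1 by rewrite invr_ge0 ltW.
rewrite normrZ (ger0_norm Bi) -!mulrA ler_wpM2l//.
rewrite -lee_fin (le_trans (is_bochner_norm mpos (pintP _ hb)))//.
have K0 : 0 <= K * `|x|.
  by have := Q_le x ltr01; rewrite divr1; exact: le_trans.
apply: (@le_trans _ _ (\int[mu]_(s in `]0%R, +oo[) ((K * `|x|)%:E * (s `^ (- a) * (s + t) `^ (- 1))%:E))%E).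
  apply: ae_le_integral => //.
    by move=> s _; rewrite mule_ge0// lee_fin mulr_ge0 ?powR_ge0.
  apply: aeW => s /=; rewrite in_itv/= andbT => s0.
  rewrite -EFinM lee_fin normrZ ger0_norm ?powR_ge0// addrAC subrr sub0r.
  rewrite mulrCA ler_wpM2l ?powR_ge0// (Q_add _ (ltW s0) t0).
  have st0 : 0 < s + t by rewrite addr_gt0.
  by rewrite (le_trans (Q_le _ st0))// powR_inv1 ?(ltW st0)// mulrAC.
rewrite ge0_integralZl_EFin//; last 2 first.
- by move=> s _; rewrite lee_fin mulr_ge0 ?powR_ge0.
- apply/measurable_EFinP; apply: measurable_funM; first by apply: measurable_funTS; exact: measurable_powR.
  apply: measurable_funTS; apply: (measurableT_comp (measurable_powR (- 1))).
  exact: measurable_funD.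
apply: (@le_trans _ _ ((K * `|x|)%:E * ((1 / (1 - a) + 1 / a) * t `^ (- a))%:E)%E).
  by apply: lee_wpmul2l; [rewrite lee_fin|apply: stieltjes_integral; rewrite ?a0].
by rewrite -EFinM lee_fin le_eqVlt; apply/orP; left; apply/eqP; ring.
Qed.

End FractionalIntegral.

(** * Cauchy's estimate in real coordinates *)

Section CauchyEstimate.
Variable R : realType.
Notation mu := (@lebesgue_measure R).
Implicit Types (a b r s t e : R) (u v p q : R -> R -> R).

Definition is_total_derivative u a b (p q : R) := forall e, 0 < e -> exists2 d, 0 < d &
  forall h k, `|h| < d -> `|k| < d ->
    `|u (a + h) (b + k) - u a b - (p * h + q * k)| <= e * (`|h| + `|k|).

Lemma is_derive_total u (a b : R -> R) t (p q a' b' : R) :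
  is_total_derivative u (a t) (b t) p q ->
  is_derive t (1 : R) a a' -> is_derive t (1 : R) b b' ->
  is_derive t (1 : R) (fun s => u (a s) (b s)) (p * a' + q * b').
Proof.
move=> hu da db.
have ca : {for t, continuous a}.
  by apply: differentiable_continuous; apply/derivable1_diffP; case: da.
have cb : {for t, continuous b}.
  by apply: differentiable_continuous; apply/derivable1_diffP; case: db.
have la : h^-1 *: (a (h + t) - a t) @[h --> 0^'] --> a'.
  by have [H <-] := da; move: H => /cvg_ex[l hl]; rewrite /derive (cvg_lim _ hl)//; move: hl; under eq_fun do rewrite scaler1.
have lb : h^-1 *: (b (h + t) - b t) @[h --> 0^'] --> b'.
  by have [H <-] := db; move: H => /cvg_ex[l hl]; rewrite /derive (cvg_lim _ hl)//; move: hl; under eq_fun do rewrite scaler1.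
suff L : h^-1 *: (u (a (h *: 1 + t)) (b (h *: 1 + t)) - u (a t) (b t)) @[h --> 0^'] --> p * a' + q * b'.
  by apply: DeriveDef; [apply/cvg_ex; eexists; exact: L|exact/cvg_lim].
under eq_fun do rewrite scaler1.
apply/cvgrPdist_le => e e0.
(* N eventually bounds the sum of the two difference quotients, which fixes the precision e / 2 / N
   asked of u. *)
pose N := `|a'| + 1 + (`|b'| + 1).
have N0 : 0 < N by rewrite addr_gt0// ltr_wpDl.
have eN : 0 < e / 2 / N by rewrite !divr_gt0.
have [d d0 hd] := hu _ eN.
have lpq : p * (h^-1 *: (a (h + t) - a t)) + q * (h^-1 *: (b (h + t) - b t)) @[h --> 0^'] --> p * a' + q * b'.
  by apply: cvgD; apply: cvgMr.
have shiftc (g : R -> R) : {for t, continuous g} -> g (h + t) - g t @[h --> 0^'] --> (0 : R).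
  move=> cg.
  suff L : g (h + t) - g t @[h --> 0^'] --> g t - g t by rewrite [g t - g t]subrr in L.
  apply: cvgB; last exact: cvg_cst.
  apply: (@cvg_comp _ _ _ (fun h => h + t) g _ (nbhs t)) => //.
  have c0 : h + t @[h --> (0 : R)] --> t.
    suff L : h + t @[h --> (0 : R)] --> 0 + t by rewrite add0r in L.
    by apply: cvgD; [exact: cvg_id|exact: cvg_cst].
  by apply: cvg_trans c0; apply: cvg_app; exact: cvg_within.
have e20 : 0 < e / 2 by rewrite divr_gt0.
near=> h.
have h0 : h != 0 by near: h; exact: nbhs_dnbhs_neq.
rewrite -(subrK (p * (h^-1 *: (a (h + t) - a t)) + q * (h^-1 *: (b (h + t) - b t))) (p * a' + q * b')).
rewrite -addrA (le_trans (ler_normD _ _))// [leRHS](splitr e) lerD//.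
  by near: h; move/cvgrPdist_le : lpq; exact.
set x := a (h + t) - a t; set y := b (h + t) - b t.
have -> : p * (h^-1 *: x) + q * (h^-1 *: y) - h^-1 *: (u (a (h + t)) (b (h + t)) - u (a t) (b t)) =
    - (h^-1 * (u (a t + x) (b t + y) - u (a t) (b t) - (p * x + q * y))).
  by rewrite /x /y !subrKC /GRing.scale/=; ring.
rewrite normrN normrM.
apply: (@le_trans _ _ (`|h^-1| * (e / 2 / N * (`|x| + `|y|)))).
  rewrite ler_wpM2l//; apply: hd; rewrite /x /y; near: h.
    by move/cvgr0_norm_lt : (shiftc _ ca); exact.
  by move/cvgr0_norm_lt : (shiftc _ cb); exact.
rewrite mulrCA mulrDr -!normrM -[leRHS](divfK (lt0r_neq0 N0)) ler_wpM2l//; first exact: ltW.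
rewrite lerD//.
  rewrite (_ : _ * x = h^-1 *: (a (h + t) - a t))//; near: h.
  have /cvgrPdist_le/(_ 1 ltr01) := la; apply: filterS => h hh.
  by rewrite -lerBlDl (le_trans (lerB_dist _ _))// distrC.
rewrite (_ : _ * y = h^-1 *: (b (h + t) - b t))//; near: h.
have /cvgrPdist_le/(_ 1 ltr01) := lb; apply: filterS => h hh.
by rewrite -lerBlDl (le_trans (lerB_dist _ _))// distrC.
Unshelve. all: by end_near. Qed.

(** A holomorphic function f = u + iv with derivative p + iq. The gradients (p, -q) of u and (q, p)
    of v carry the Cauchy-Riemann equations. *)
Variables (u v p q : R -> R -> R) (r0 C C' : R).
Hypothesis r00 : 0 < r0.
Let disc a b := a ^+ 2 + b ^+ 2 < r0 ^+ 2.
Hypothesis du : forall a b, disc a b -> is_total_derivative u a b (p a b) (- q a b).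
Hypothesis dv : forall a b, disc a b -> is_total_derivative v a b (q a b) (p a b).
Hypothesis cp : forall r, 0 < r < r0 -> continuous (fun t => p (r * cos t) (r * sin t)).
Hypothesis bp : forall a b, disc a b -> `|p a b| <= C'.
Hypothesis bu : forall a b, disc a b -> `|u a b| <= C.
Hypothesis bv : forall a b, disc a b -> `|v a b| <= C.
Hypotheses (u0 : u 0 0 = 0) (v0 : v 0 0 = 0).

(** At z = r e^{it}, h is the real part of f(z) / z and k the imaginary part of f(z) e^{-it}. By the
    Cauchy-Riemann equations r^2 times the r-derivative of h is the t-derivative of k; as k takes
    the same value at 0 and 2 pi, the derivative of J vanishes. *)
Let h r t := (u (r * cos t) (r * sin t) * cos t + v (r * cos t) (r * sin t) * sin t) / r.
Let k r t := v (r * cos t) (r * sin t) * cos t - u (r * cos t) (r * sin t) * sin t.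
Let J r := \int[mu]_(t in `[0, pi *+ 2]) h r t.

Let polar r t : 0 < r < r0 -> disc (r * cos t) (r * sin t).
Proof.
by move=> /andP[rp rr]; rewrite /disc !exprMn -mulrDr cos2Dsin2 mulr1 ltr_pXn2r ?nnegrE// ltW.
Qed.

Let dh r t : 0 < r < r0 ->
  is_derive r (1 : R) (h ^~ t) (p (r * cos t) (r * sin t) / r - h r t / r).
Proof.
move=> rr; have /andP[rp _] := rr.
have dc : is_derive r (1 : R) (fun s => s * cos t) (cos t).
  by apply: is_derive_eq; rewrite /GRing.scale/=; ring.
have ds : is_derive r (1 : R) (fun s => s * sin t) (sin t).
  by apply: is_derive_eq; rewrite /GRing.scale/=; ring.
have d1 := is_derive_total (a := fun s => s * cos t) (b := fun s => s * sin t) (t := r) (du (polar t rr)) dc ds.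
have d2 := is_derive_total (a := fun s => s * cos t) (b := fun s => s * sin t) (t := r) (dv (polar t rr)) dc ds.
have rn0 : r != 0 by rewrite gt_eqF.
have d3 : is_derive r (1 : R) (fun s : R => s^-1) (- r ^- 2).
  by have := is_deriveV rn0 (is_derive_id r (1 : R)); rewrite /GRing.scale/= mulr1.
apply: is_derive_eq; rewrite /h /GRing.scale/=.
have := cos2Dsin2 t; set c := cos t; set s := sin t => E.
have -> : p (r * c) (r * s) / r = p (r * c) (r * s) * (c ^+ 2 + s ^+ 2) / r by rewrite E mulr1.
by field.
Qed.

Let dk r t : 0 < r < r0 ->
  is_derive t (1 : R) (k r) (p (r * cos t) (r * sin t) * r - h r t * r).
Proof.
move=> rr; have /andP[rp _] := rr.
have dc : is_derive t (1 : R) (fun s => r * cos s) (- (r * sin t)).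
  by apply: is_derive_eq; rewrite /GRing.scale/=; ring.
have ds : is_derive t (1 : R) (fun s => r * sin s) (r * cos t).
  by apply: is_derive_eq; rewrite /GRing.scale/=; ring.
have d1 := is_derive_total (a := fun s => r * cos s) (b := fun s => r * sin s) (t := t) (du (polar t rr)) dc ds.
have d2 := is_derive_total (a := fun s => r * cos s) (b := fun s => r * sin s) (t := t) (dv (polar t rr)) dc ds.
have rn0 : r != 0 by rewrite gt_eqF.
apply: is_derive_eq; rewrite /h /GRing.scale/=.
have := cos2Dsin2 t; set c := cos t; set s := sin t => E.
have -> : p (r * c) (r * s) * r = p (r * c) (r * s) * (c ^+ 2 + s ^+ 2) * r by rewrite E mulr1.
by field.
Qed.

Let pi20 : 0 < (pi : R) *+ 2. Proof. by rewrite mulrn_wgt0// pi_gt0. Qed.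

Let continuous_polar (w wp wq : R -> R -> R) r : 0 < r < r0 ->
  (forall a b, disc a b -> is_total_derivative w a b (wp a b) (wq a b)) ->
  continuous (fun t => w (r * cos t) (r * sin t)).
Proof.
move=> rr dw t.
have dc : is_derive t (1 : R) (fun s => r * cos s) (- (r * sin t)).
  by apply: is_derive_eq; rewrite /GRing.scale/=; ring.
have ds : is_derive t (1 : R) (fun s => r * sin s) (r * cos t).
  by apply: is_derive_eq; rewrite /GRing.scale/=; ring.
have [D _] := is_derive_total (a := fun s => r * cos s) (b := fun s => r * sin s) (t := t) (dw _ _ (polar t rr)) dc ds.
by apply: differentiable_continuous; apply/derivable1_diffP.
Qed.

Let ch r : 0 < r < r0 -> continuous (h r).
Proof.
move=> rr t; apply: cvgM; last exact: cvg_cst.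
apply: cvgD; apply: cvgM.
- exact: (continuous_polar rr du).
- exact: continuous_cos.
- exact: (continuous_polar rr dv).
- exact: continuous_sin.
Qed.

Let integrable_circle (g : R -> R) : continuous g ->
  mu.-integrable (`[0, pi *+ 2]%classic : set (measurableTypeR R)) (EFin \o g).
Proof.
move=> cg; apply: continuous_compact_integrable; first exact: segment_compact.
exact: continuous_subspaceT.
Qed.

Let integral_dh r : 0 < r < r0 ->
  \int[mu]_(t in `[0, pi *+ 2]) (p (r * cos t) (r * sin t) / r - h r t / r) = 0.
Proof.
move=> rr; have /andP[rp _] := rr; have rn0 : r != 0 by rewrite gt_eqF.
pose g t := p (r * cos t) (r * sin t) * r - h r t * r.
have cg : continuous g.
  move=> t; apply: cvgB; apply: cvgM; try exact: cvg_cst.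
    exact: cp.
  exact: ch.
have -> : \int[mu]_(t in `[0, pi *+ 2]) (p (r * cos t) (r * sin t) / r - h r t / r) =
    \int[mu]_(t in `[0, pi *+ 2]) ((r ^+ 2)^-1 * g t).
  by apply: eq_Rintegral => t _; rewrite /g; field.
rewrite RintegralZl//; last exact: integrable_circle.
rewrite /Rintegral (@continuous_FTC2 R g (k r))//.
- by rewrite /k cos2pi sin2pi cos0 sin0 -EFinB subrr/= mulr0.
- exact: continuous_subspaceT.
- have ck : continuous (k r).
    by move=> t; apply: differentiable_continuous; apply/derivable1_diffP; case: (dk t rr).
  split; first by move=> t _; case: (dk t rr).
    by apply: cvg_at_right_filter; exact: ck.
  by apply: cvg_at_left_filter; exact: ck.
- by move=> t _; rewrite derive1E; have d := dk t rr; rewrite derive_val.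
Qed.

Let h_le r t : 0 < r < r0 -> `|h r t| <= 2 * C / r.
Proof.
move=> rr; have /andP[rp _] := rr.
rewrite /h normrM normfV (gtr0_norm rp) ler_pM2r ?invr_gt0//.
rewrite (le_trans (ler_normD _ _))// mulrDl mul1r !normrM lerD//.
- rewrite -[leRHS]mulr1; apply: ler_pM => //; first by apply: bu; exact: polar.
  by rewrite ler_norml cos_geN1 cos_le1.
- rewrite -[leRHS]mulr1; apply: ler_pM => //; first by apply: bv; exact: polar.
  by rewrite ler_norml sin_geN1 sin_le1.
Qed.

Let dJ r : 0 < r < r0 -> is_derive r (1 : R) J 0.
Proof.
move=> rr; have /andP[rp rr0] := rr.
have r20 : 0 < r / 2 by rewrite divr_gt0.
(* G dominates the r-derivative of h for all radii above r / 2. The bound C' of p serves the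
   domination only and does not enter the final estimate. *)
pose G := C' / (r / 2) + 2 * C / (r / 2) / (r / 2).
have C'0 : 0 <= C' by apply: le_trans (bp (polar 0 rr)).
have C0 : 0 <= C by apply: le_trans (bu (polar 0 rr)).
have sub x : x \in `]r / 2, r0[ -> 0 < x < r0.
  by rewrite in_itv/= => /andP[x1 ->]; rewrite (lt_trans r20).
have Ir : r \in `]r / 2, r0[ by rewrite in_itv/= rr0 andbT ltr_pdivrMr// ltr_pMr// ltr1n.
have E x t : 0 < x < r0 -> partial1of2 h x t = p (x * cos t) (x * sin t) / x - h x t / x.
  by move=> xx; rewrite partial1of2E; have d := dh t xx; rewrite derive_val.
have := @cvg_differentiation_under_integral R _ _ mu h `[0, pi *+ 2]%classic
  (measurable_itv _) r (r / 2) r0 Ir _ _ (fun=> G) _ _ _.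
have -> : \int[mu]_(t in `[0, pi *+ 2]) partial1of2 h r t = 0.
  by rewrite -[RHS](integral_dh rr); apply: eq_Rintegral => t _; rewrite E.
move=> L; have {}L : x^-1 *: (J (x *: 1 + r) - J r) @[x --> 0^'] --> (0 : R).
  under eq_fun do rewrite scaler1.
  apply: L.
  - by move=> x /sub xx; apply: integrable_circle; exact: ch.
  - by move=> x t /sub xx _; case: (dh t xx).
  - have r2 : 0 <= r := ltW rp.
    by move=> _; rewrite /G addr_ge0 ?divr_ge0 ?mulr_ge0.
  - by apply: integrable_circle => t; exact: cvg_cst.
  - move=> x t xi _; have xx := sub _ xi; rewrite E// /G.
    move: xi => /=; rewrite in_itv/= => /andP[x1 _]; have x0 := lt_trans r20 x1.
    have xr : x^-1 <= (r / 2)^-1 by rewrite lef_pV2 ?posrE// ltW.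
    rewrite (le_trans (ler_normB _ _))// (normrM (p _ _)) (normrM (h x t)) (ger0_norm (x := x^-1)) ?invr_ge0 ?(ltW x0)//.
    rewrite lerD//; apply: ler_pM => //; rewrite ?invr_ge0 ?(ltW x0)//.
      by apply: bp; exact: polar.
    by rewrite (le_trans (h_le _ xx))// ler_wpM2l// mulr_ge0.
by apply: DeriveDef; [apply/cvg_ex; eexists; exact: L|exact/cvg_lim].
Qed.

Let J_cst r s : 0 < r -> r < s -> s < r0 -> J r = J s.
Proof.
move=> rp rs sr.
have dJx x : x \in `]r, s[ -> is_derive x (1 : R) J 0.
  by rewrite in_itv/= => /andP[x1 x2]; apply: dJ; rewrite (lt_trans rp x1) (lt_trans x2 sr).
have [|c _] := @MVT _ J (fun=> 0) _ _ rs dJx.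
  apply: derivable_within_continuous => x /=; rewrite in_itv/= => /andP[x1 x2].
  by case: (@dJ x) => //; rewrite (lt_le_trans rp x1) (le_lt_trans x2 sr).
by rewrite mul0r => /eqP; rewrite subr_eq0 => /eqP.
Qed.

Let integral_cst c : \int[mu]_(t in `[0%R, pi *+ 2]) c = c * (pi *+ 2).
Proof.
have E : mu (`[0, pi *+ 2]%classic : set R) = (pi *+ 2)%:E.
  by rewrite lebesgue_measure_itv/= lte_fin pi20 sube0.
transitivity (c * fine (mu (`[0, pi *+ 2]%classic : set R))); first exact: Rintegral_cst.
by rewrite E.
Qed.

Let le_integral_circle (g : R -> R) c : continuous g -> (forall t, `|g t| <= c) ->
  `|\int[mu]_(t in `[0, pi *+ 2]) g t| <= c * (pi *+ 2).
Proof.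
move=> cg gc; rewrite -integral_cst.
rewrite (le_trans (le_normr_Rintegral _ _))//; first exact: integrable_circle.
apply: le_Rintegral => //; apply: integrable_circle => t.
  by apply: cvg_norm; exact: cg.
exact: cvg_cst.
Qed.

(* With f = u + iv, the integral J r = \int_0^{2 pi} Re (f(r e^{it}) / (r e^{it})) dt does not depend on r, and tends to 2 pi Re f'(0) as r tends to 0. *)
Lemma cauchy_estimate : `|p 0 0| <= 4 * C / r0.
Proof.
have d0 : disc 0 0 by rewrite /disc expr0n/= addr0 exprn_gt0.
apply/ler_addgt0Pr => e e0.
(* The error e is shared among the two functions u and v and the two increments, each of size at
   most r. *)
have e2 : 0 < e / 4 by rewrite divr_gt0.
have [d1 d10 h1] := du d0 e2.
have [d2 d20 h2] := dv d0 e2.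
have r2 : 0 < r0 / 2 < r0 by rewrite divr_gt0//= ltr_pdivrMr// ltr_pMr// ltr1n.
pose r := Num.min (r0 / 2) (Num.min d1 d2) / 2.
have m0 : 0 < Num.min (r0 / 2) (Num.min d1 d2) by rewrite !lt_min d10 d20 divr_gt0.
have rp : 0 < r by rewrite divr_gt0.
have : r < Num.min (r0 / 2) (Num.min d1 d2) by rewrite ltr_pdivrMr// ltr_pMr// ltr1n.
rewrite !lt_min => /and3P[rr0 rd1 rd2].
have rr : 0 < r < r0 by rewrite rp (lt_trans rr0); case/andP: r2.
(* |h r t| is at most 2 C / r; at r = r0 / 2 this is the constant 4 C / r0 of the conclusion. *)
have J2 : `|J (r0 / 2)| <= 4 * C / r0 * (pi *+ 2).
  apply: le_integral_circle; first exact: ch.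
  move=> t; rewrite (le_trans (h_le _ r2))// le_eqVlt; apply/orP; left; apply/eqP.
  by field; rewrite gt_eqF.
have Jr : `|J r - p 0 0 * (pi *+ 2)| <= e * (pi *+ 2).
  rewrite -integral_cst /J -RintegralB//; last 2 first.
    by apply: integrable_circle; exact: ch.
    by apply: integrable_circle => t; exact: cvg_cst.
  apply: le_integral_circle; first by move=> t; apply: cvgB; [exact: ch|exact: cvg_cst].
  move=> t.
  have c1 : `|cos t| <= 1 by rewrite ler_norml cos_geN1 cos_le1.
  have s1 : `|sin t| <= 1 by rewrite ler_norml sin_geN1 sin_le1.
  have rc : `|r * cos t| <= r.
    by rewrite normrM (gtr0_norm rp) -[leRHS]mulr1 ler_wpM2l// ltW.
  have rs : `|r * sin t| <= r.
    by rewrite normrM (gtr0_norm rp) -[leRHS]mulr1 ler_wpM2l// ltW.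
  have := h1 _ _ (le_lt_trans rc rd1) (le_lt_trans rs rd1).
  have := h2 _ _ (le_lt_trans rc rd2) (le_lt_trans rs rd2).
  rewrite !add0r u0 v0 !subr0.
  set x := (X in `|X|) => hx; set y := (X in `|X|) => hy.
  have -> : h r t - p 0 0 = (y * cos t + x * sin t) / r.
    rewrite /h /x /y; have := cos2Dsin2 t; move: (u _ _) (v _ _) => U V.
    set c := cos t; set s := sin t => E.
    rewrite [RHS](_ : _ = (U * c + V * s) / r - p 0 0 * (c ^+ 2 + s ^+ 2)); first by rewrite E mulr1.
    by field; rewrite gt_eqF.
  rewrite normrM normfV (gtr0_norm rp) ler_pdivrMr// (le_trans (ler_normD _ _))//.
  rewrite !normrM.
  have B z w : `|z| <= e / 4 * (`|r * cos t| + `|r * sin t|) -> `|w| <= 1 -> `|z| * `|w| <= e / 2 * r.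
    move=> hz hw; rewrite -[leRHS]mulr1 ler_pM// (le_trans hz)//.
    have -> : e / 2 * r = e / 4 * (r + r) by field.
    by rewrite ler_wpM2l ?lerD// ltW.
  have -> : e * r = e / 2 * r + e / 2 * r by field.
  by rewrite lerD// B.
have E : J r = J (r0 / 2) by apply: J_cst => //; case/andP: r2.
rewrite -(ler_pM2r pi20) mulrDl.
have -> : `|p 0 0| * (pi *+ 2) = `|p 0 0 * (pi *+ 2)| by rewrite normrM (gtr0_norm pi20).
rewrite -[X in `|X|](subrK (J r)) addrC (le_trans (ler_normD _ _))//.
by rewrite lerD// ?E// distrC -E.
Qed.

End CauchyEstimate.

(** * The derivative of an analytic semigroup for small times *)

Section AnalyticSemigroup.
Import complex.
Variables (R : realType) (X : completeNormedModType R).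
Variables (T : R -> X -> X) (m : R) (S : complex.complex R -> X * X -> X * X).
Implicit Types (a b d e h k s t : R) (x y : X) (P : X * X).
Notation Cx := (@complex.Complex R).
Notation normc := (@complex.ComplexField.Normc.normc R).
Notation cscale := (@Defs.cscale R X).
Notation cbounded := (@cbounded_operator R X).
Hypothesis m0 : 0 < m.
Hypothesis S_op : forall z, sector m z -> cbounded (S z).
Hypothesis S_real : forall t, 0 < t -> forall P, S (Cx t 0) P = (T t P.1, T t P.2).
Hypothesis S_add : forall z w, sector m z -> sector m w -> forall P, S (z + w) P = S z (S w P).
Hypothesis S_diff : forall z, sector m z -> exists2 D, cbounded D &
  forall e, 0 < e -> exists2 d, 0 < d & forall w, normc w < d -> sector m (z + w) ->
    forall P, `|S (z + w) P - S z P - cscale w (D P)| <= e * normc w * `|P|.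
Hypothesis S_cvg0 : forall m', 0 < m' -> m' < m -> forall P e, 0 < e ->
  exists2 d, 0 < d & forall z, sector m' z -> normc z < d -> `|S z P - P| < e.

Let normc_le a b : normc (Cx a b) <= `|a| + `|b|.
Proof.
rewrite /complex.ComplexField.Normc.normc -(@ler_pXn2r _ 2) ?nnegrE ?sqrtr_ge0 ?addr_ge0//.
rewrite sqr_sqrtr ?addr_ge0 ?sqr_ge0// sqrrD !real_normK ?num_real// lerD2r lerDl.
by rewrite mulrn_wge0// mulr_ge0.
Qed.

Let cscale_le h k P : `|cscale (Cx h k) P| <= (`|h| + `|k|) * `|P|.
Proof.
rewrite /Defs.cscale prod_normE ge_max /= mulrDl; apply/andP; split.
  rewrite (le_trans (ler_normB _ _))// !normrZ lerD// ler_wpM2l// prod_normE le_max lexx ?orbT//.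
rewrite (le_trans (ler_normD _ _))// !normrZ lerD// ler_wpM2l// prod_normE le_max lexx ?orbT//.
Qed.

Let norm_fst P : `|P.1| <= `|P|. Proof. by rewrite prod_normE le_max lexx. Qed.
Let norm_snd P : `|P.2| <= `|P|. Proof. by rewrite prod_normE le_max lexx orbT. Qed.

Let norm_inl x : `|(x, 0 : X)| = `|x|.
Proof. by rewrite prod_normE /= normr0; apply/max_idPl. Qed.

Let cscale_real a P : cscale (Cx a 0) P = a *: P.
Proof. by rewrite /Defs.cscale /= !scale0r subr0 addr0; case: P. Qed.

Let cop_linear D : cbounded D -> exists2 C, 0 < C & bounded_linear C D.
Proof.
move=> [hD hZ cD]; apply: bounded_operatorP; split => // a P Q.
by rewrite hD -!cscale_real hZ.
Qed.

Let S_linear z : sector m z -> exists2 C, 0 < C & bounded_linear C (S z).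
Proof. by move=> /S_op; exact: cop_linear. Qed.

(** Strong continuity at 0 gives boundedness for each vector only. If no uniform bound existed near
    0, points tending to 0 with ever larger operator norms could be chosen, and the Banach-Steinhaus
    theorem would bound them all. *)
Let S_bounded_real m' : 0 < m' -> m' < m -> exists (d M : R), [/\ 0 < d, 0 <= M &
  forall z, sector m' z -> normc z < d -> forall x, `|S z (x, 0)| <= M * `|x|].
Proof.
move=> m'0 m'm; apply: contrapT => H.
have bad n : exists q : complex.complex R * X, [/\ sector m' q.1, normc q.1 < n.+1%:R^-1 &
    n%:R * `|q.2| < `|S q.1 (q.2, 0)|].
  apply: contrapT => Hn; apply: H; exists n.+1%:R^-1, n%:R; split => // z hz zn x.
  by rewrite leNgt; apply/negP => hx; apply: Hn; exists (z, x).
have [q hq] := choice bad.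
have qs n : sector m (q n).1.
  have [h _ _] := hq n; move: h; rewrite /sector /= => h.
  have re0 : 0 < complex.Re (q n).1 by rewrite -(pmulr_rgt0 _ m'0) (le_lt_trans _ h).
  by rewrite (lt_trans h)// ltr_pM2r.
pose F := [set g : X -> X * X | exists n, g = fun x => S (q n).1 (x, 0)].
have lin n : exists2 C, 0 < C & bounded_linear C (fun x => S (q n).1 (x, 0)).
  have [C C0 [h1 h2]] := S_linear (qs n); exists C => //; split=> [a x y|x].
    rewrite -h1; congr (S _ _); rewrite /= [RHS]surjective_pairing/=.
    by rewrite scaler0 addr0.
  by rewrite (le_trans (h2 _))// norm_inl.
have FB : uniform_bounded F.
  apply: Banach_Steinhauss => [g [n ->]|x].
    have [C C0 [h1 h2]] := lin n; split=> [r|]; last exact: h1.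
    by exists (C * r) => x xr; rewrite (le_trans (h2 x))// ler_wpM2l// ltW.
  have [d d0 hd] := S_cvg0 m'0 m'm (x, 0) ltr01.
  pose N := Num.truncn d^-1.
  (* Points of index above N are within d of 0, where the value is within 1 of x; the finitely many
     others are covered by the sum. *)
  exists (`|x| + 1 + \sum_(n < N.+1) `|S (q n).1 (x, 0)|) => g [n ->].
  have [nN|Nn] := ltnP n N.+1.
    rewrite (bigD1 (Ordinal nN))//= addrCA lerDl addr_ge0// ?sumr_ge0// addr_ge0//.
  rewrite -[leLHS]addr0 lerD ?sumr_ge0//.
  have [s1 s2 _] := hq n.
  have sd : normc (q n).1 < d.
    rewrite (lt_trans s2)// invf_plt ?posrE// (lt_le_trans (truncnS_gt _))//.
    by rewrite ler_nat ltnW// ltnS ltnW.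
  rewrite -[S _ _](subrK (x, 0)) (le_trans (ler_normD _ _))// norm_inl addrC lerD//.
  exact: ltW (hd _ s1 sd).
have [M hM] := FB 1.
have := truncnS_gt `|M|; set n := (Num.truncn _).+1 => nM.
have [_ _] := hq n; set x := (q n).2 => hx.
have [C C0 hl] := lin n.
have x0 : x != 0.
  apply/negP => /eqP x0; move: hx; rewrite x0 normr0 mulr0.
  by rewrite (bounded_linear0 hl) normr0 ltxx.
have nx0 : 0 < `|x| by rewrite normr_gt0.
have := hM _ (ex_intro _ n erefl) (`|x|^-1 *: x).
rewrite normrZ normfV normr_id mulVf ?normr_eq0// => /(_ (lexx _)).
rewrite (bounded_linearZ _ _ hl) normrZ normfV normr_id mulrC ler_pdivrMr// => h.
have := lt_le_trans hx h; rewrite ltr_pM2r// ltNge => /negP; apply.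
by rewrite (le_trans (ler_norm _))// ltW.
Qed.

Let S_bounded m' : 0 < m' -> m' < m -> exists (d M : R), [/\ 0 < d, 0 <= M &
  forall z, sector m' z -> normc z < d -> forall x, `|S z (x, 0)| <= M * `|x|].
Proof. exact: S_bounded_real. Qed.

(** A choice of the complex derivative of S at the real point t; only positive t matter. *)
Let Dop t := xget (fun=> 0) [set D | 0 < t -> cbounded D /\
  forall e, 0 < e -> exists2 d, 0 < d & forall w, normc w < d -> sector m (Cx t 0 + w) ->
    forall P, `|S (Cx t 0 + w) P - S (Cx t 0) P - cscale w (D P)| <= e * normc w * `|P|].

Let sector_real t : 0 < t -> sector m (Cx t 0).
Proof. by move=> t0; rewrite /sector /= normr0 mulr_gt0. Qed.

Let addCx a b c d : Cx a b + Cx c d = Cx (a + c) (b + d).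
Proof. by []. Qed.

Let DopP t : 0 < t -> cbounded (Dop t) /\
  forall e, 0 < e -> exists2 d, 0 < d & forall h k, `|h| < d -> `|k| < d ->
    sector m (Cx (t + h) k) /\ forall P, `|S (Cx (t + h) k) P - S (Cx t 0) P - cscale (Cx h k) (Dop t P)| <= e * (`|h| + `|k|) * `|P|.
Proof.
move=> t0; have [D hD hD'] := S_diff (sector_real t0).
have [//|cD dD] := @xgetPex _ (fun=> 0 : X * X) [set D | 0 < t -> cbounded D /\
  forall e, 0 < e -> exists2 d, 0 < d & forall w, normc w < d -> sector m (Cx t 0 + w) ->
    forall P, `|S (Cx t 0 + w) P - S (Cx t 0) P - cscale w (D P)| <= e * normc w * `|P|]
  (ex_intro _ D (fun _ => conj hD hD')).
split => // e e0; have [d d0 hd] := dD e e0.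
(* Half of d for each coordinate bounds the complex modulus; t / 2 and m t / 2 keep t + h + ik
   inside the sector. *)
pose d' := Num.min (d / 2) (Num.min (t / 2) (m * t / 2)).
exists d'; first by rewrite !lt_min !divr_gt0// mulr_gt0.
move=> h k; rewrite !lt_min => /and3P[h1 h2 _] /and3P[k1 _ k2].
have nd : normc (Cx h k) < d by rewrite (le_lt_trans (normc_le _ _))// (splitr d) ltrD.
have sec : sector m (Cx t 0 + Cx h k).
  rewrite /sector /= add0r (lt_trans k2)// -mulrA ltr_pM2l//.
  have := ler_norm (- h); rewrite normrN => hh.
  by lra.
have E : Cx t 0 + Cx h k = Cx (t + h) k by rewrite addCx add0r.
split=> [|P]; first by rewrite -E.
have := hd _ nd sec P; rewrite E.
move=> /le_trans; apply; rewrite ler_wpM2r// ler_wpM2l ?(ltW e0)//.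
Qed.


(** The derivative at t, written as the derivative at t / 4 applied after T (3 t / 4). One fixed
    bounded operator thus gives the complex derivative on a whole disc around t: only the argument
    of S near 3 t / 4 moves, which provides the continuity and the bound required by
    [cauchy_estimate]. *)
Definition semigroup_derivative t x : X := (Dop (t / 4) (T (t - t / 4) x, 0)).1.
Notation D := semigroup_derivative.

Let T0 t : 0 < t -> T t 0 = 0.
Proof.
move=> t0; have [C C0 hC] := S_linear (sector_real t0).
by have := bounded_linear0 hC; rewrite S_real//= => -[].
Qed.

Let T_add s t x : 0 < s -> 0 < t -> T (s + t) x = T s (T t x).
Proof.
move=> s0 t0; have := S_add (sector_real s0) (sector_real t0) (x, 0).
by rewrite addCx addr0 !S_real//= ?addr_gt0// => -[].
Qed.

Lemma semigroup_derivativeP t x e : 0 < t -> 0 < e -> exists2 d, 0 < d & forall h, `|h| < d ->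
  `|T (t + h) x - T t x - h *: D t x| <= e * `|h|.
Proof.
move=> t0 e0; have t4 : 0 < t / 4 by rewrite divr_gt0.
have tt4 : 0 < t - t / 4 by lra.
have [_ H] := DopP t4; set y := T (t - t / 4) x.
have N0 : 0 < `|y| + 1 by rewrite ltr_wpDl.
have [d d0 hd] := H _ (divr_gt0 e0 N0).
exists (Num.min d (t / 8)); first by rewrite lt_min d0 divr_gt0.
move=> h; rewrite lt_min => /andP[h1 h2].
have h3 : - (t / 8) < h by have := ler_norm (- h); rewrite normrN; lra.
have th : 0 < t / 4 + h by lra.
have n0d : `|0 : R| < d by rewrite normr0.
have [_ /(_ (y, 0))] := hd h 0 h1 n0d.
rewrite normr0 addr0 !S_real//= cscale_real norm_inl.
move=> /(le_trans (norm_fst _)) /=.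
rewrite /D -/y -!T_add//.
have -> : t / 4 + h + (t - t / 4) = t + h by ring.
have -> : t / 4 + (t - t / 4) = t by ring.
move=> /le_trans; apply; rewrite mulrAC ler_wpM2r// mulrAC ler_pdivrMr// ler_wpM2l ?lerDl ?(ltW e0)//.
Qed.

Let S_continuous (a b : R -> R) s P : {for s, continuous a} -> {for s, continuous b} ->
  sector m (Cx (a s) (b s)) -> {for s, continuous (fun s => S (Cx (a s) (b s)) P)}.
Proof.
move=> ca cb sec; have [E hE hd] := S_diff sec.
have [d d0 {}hd] := hd _ ltr01.
apply/cvgrPdist_le => e e0.
pose N := `|P| + `|E P| + 1.
have N0 : 0 < N by rewrite ltr_wpDl// addr_ge0.
(* g is the margin by which the point satisfies the sector condition; increments below g / (1 + m)
   satisfy |k| + m |h| < g and preserve it. *)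
pose g := m * a s - `|b s|.
have g0 : 0 < g by rewrite subr_gt0.
have m1 : 0 < 1 + m by rewrite addr_gt0.
pose del := Num.min (d / 2) (Num.min (g / (1 + m)) (e / N / 2)).
have del0 : 0 < del by rewrite !lt_min !divr_gt0.
near=> r.
set h := a r - a s; set k := b r - b s.
have hdel : `|h| < del.
  rewrite /h distrC; near: r; by move/cvgrPdist_lt : ca; apply.
have kdel : `|k| < del.
  rewrite /k distrC; near: r; by move/cvgrPdist_lt : cb; apply.
move: hdel kdel; rewrite !lt_min => /and3P[h1 h2 h3] /and3P[k1 k2 k3].
have Eab : Cx (a s) (b s) + Cx h k = Cx (a r) (b r) by rewrite addCx /h /k !subrKC.
have nd : normc (Cx h k) < d by rewrite (le_lt_trans (normc_le _ _))// (splitr d) ltrD.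
have sec' : sector m (Cx (a s) (b s) + Cx h k).
  rewrite /sector /= (le_lt_trans (ler_normD _ _))// mulrDr.
  have mh : m * `|h| < m * (g / (1 + m)) by rewrite ltr_pM2l.
  have hh : - (m * `|h|) <= m * h.
    by rewrite -mulrN ler_wpM2l// ?(ltW m0)// lerNl -normrN ler_norm.
  have : g / (1 + m) + m * (g / (1 + m)) = g by field; rewrite gt_eqF.
  rewrite /g in mh h2 k2 *; lra.
have := hd _ nd sec' P; rewrite Eab mul1r => hS.
rewrite distrC -[X in `|X|](subrK (cscale (Cx h k) (E P))) (le_trans (ler_normD _ _))//.
rewrite (le_trans (lerD hS (cscale_le _ _ _)))//.
apply: (@le_trans _ _ ((`|h| + `|k|) * N)).
  rewrite /N -addrA mulrDr lerD//; first by rewrite ler_wpM2r.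
  by rewrite ler_wpM2l ?addr_ge0// lerDl.
by rewrite -ler_pdivlMr// (splitr (e / N)) lerD// ltW.
Unshelve. all: by end_near. Qed.

Let disc_bound r a b : 0 < r -> a ^+ 2 + b ^+ 2 < r ^+ 2 -> `|a| < r /\ `|b| < r.
Proof.
move=> r0 h; split; rewrite -(@ltr_pXn2r _ 2) ?nnegrE ?(ltW r0)// real_normK ?num_real//.
  by rewrite (le_lt_trans _ h)// lerDl sqr_ge0.
by rewrite (le_lt_trans _ h)// lerDr sqr_ge0.
Qed.

(** Cauchy's estimate on the disc of radius c t around t. The radius is proportional to t because
    the sector is a cone, which yields K / t; the restriction to small t comes from S being bounded
    only near 0 on the smaller sector. *)
Lemma semigroup_derivative_le : exists (t0 K : R), [/\ 0 < t0, 0 <= K &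
  forall t x, 0 < t <= t0 -> `|D t x| <= K / t * `|x|].
Proof.
pose m2 := m / 2.
have m20 : 0 < m2 by rewrite divr_gt0.
have m2m : m2 < m by rewrite ltr_pdivrMr// ltr_pMr// ltr1n.
have [d [M [d0 M0 SM]]] := S_bounded m20 m2m.
(* Chosen so that c (1 + m2) = m2 / 2: then |a|, |b| < c t and s at least 3 t / 4 imply |b| < m2 (s
   + a). *)
pose c := m2 / (2 * (1 + m2)).
have m21 : 0 < 1 + m2 by rewrite addr_gt0.
have c0 : 0 < c by rewrite divr_gt0// mulr_gt0.
have cE : c * (1 + m2) = m2 / 2 by rewrite /c; field; rewrite gt_eqF.
have c2 : c <= 1 / 2.
  by rewrite /c ler_pdivrMr ?mulr_gt0//; have := ltW m20; lra.
(* With c at most 1 / 2 the disc has modulus at most 2 t < d. The constant is 4 times the bound 2 M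
   of the centred functions, divided by the radius c t. *)
exists (d / 4), (8 * M / c); split; [by rewrite divr_gt0|by rewrite divr_ge0 ?(ltW c0)// mulr_ge0|].
move=> t x /andP[t0 td].
have ct0 : 0 < c * t by rewrite mulr_gt0.
have ct2 : c * t <= t / 2 by rewrite mulrC ler_wpM2l ?(ltW t0)// -[leRHS]mul1r.
have t4 : 0 < t / 4 by rewrite divr_gt0.
have tt4 : 0 < t - t / 4 by lra.
have cmt : c * t + m2 * (c * t) = m2 * (t / 2).
  by transitivity (c * (1 + m2) * t); [ring|rewrite cE; ring].
have sect a b s : t - t / 4 <= s -> `|a| < c * t -> `|b| < c * t -> sector m2 (Cx (s + a) b).
  move=> st ha hb; rewrite /sector /= (lt_le_trans hb)//.
  have h : - (c * t) <= a by have := ler_norm (- a); rewrite normrN; lra.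
  apply: (@le_trans _ _ (m2 * (t - t / 4 - c * t))); last by rewrite ler_pM2l//; lra.
  rewrite mulrBr; have : m2 * (t / 2) <= m2 * (t - t / 4) by rewrite ler_pM2l//; lra.
  by lra.
have sectm w : sector m2 w -> sector m w.
  rewrite /sector /= => h; have re0 : 0 < complex.Re w by rewrite -(pmulr_rgt0 _ m20) (le_lt_trans _ h).
  by rewrite (lt_trans h)// ltr_pM2r.
have normd a b s : t - t / 4 <= s <= t -> `|a| < c * t -> `|b| < c * t -> normc (Cx (s + a) b) < d.
  move=> /andP[st1 st2] ha hb; rewrite (le_lt_trans (normc_le _ _))//.
  have := ler_normD s a; rewrite (@ger0_norm _ s); last by lra.
  by lra.
have SMab a b s : t - t / 4 <= s <= t -> `|a| < c * t -> `|b| < c * t -> `|S (Cx (s + a) b) (x, 0)| <= M * `|x|.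
  by move=> /andP[st1 st2] ha hb; apply: SM; [exact: sect|apply: normd => //; rewrite st1].
have s1 : t - t / 4 <= t - t / 4 <= t by rewrite lexx; lra.
have s2 : t - t / 4 <= t <= t by rewrite lexx andbT; lra.
have [phi hphi phiD] := norming_functional (D t x).
have phi_le P (i : X * X -> X) : `|i P| <= `|P| -> `|phi (i P)| <= `|P|.
  by move=> h; rewrite (le_trans (hphi.2 _))// mul1r.
have [cD hD] := DopP t4; have [CD CD0 lD] := cop_linear cD.
pose Y a b := S (Cx (t - t / 4 + a) b) (x, 0).
pose P a b := Dop (t / 4) (Y a b).
pose u0 : R := phi (S (Cx t 0) (x, 0)).1.
pose v0 : R := phi (S (Cx t 0) (x, 0)).2.
(* phi on both components is a complex functional on the complexification, and phi norms D t x, so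
   that p 0 0 = |D t x|. Subtracting the value at the centre provides u 0 0 = v 0 0 = 0 and doubles
   the bound M |x|. *)
pose u a b : R := phi (S (Cx (t + a) b) (x, 0)).1 - u0.
pose v a b : R := phi (S (Cx (t + a) b) (x, 0)).2 - v0.
pose p a b : R := phi (P a b).1.
pose q a b : R := phi (P a b).2.
have key a b e : a ^+ 2 + b ^+ 2 < (c * t) ^+ 2 -> 0 < e -> exists2 del, 0 < del &
    forall h k, `|h| < del -> `|k| < del ->
      `|S (Cx (t + (a + h)) (b + k)) (x, 0) - S (Cx (t + a) b) (x, 0) - cscale (Cx h k) (P a b)| <= e * (`|h| + `|k|).
  move=> /(disc_bound ct0)[ha hb] e0.
  have N0 : 0 < M * `|x| + 1 by rewrite ltr_wpDl// mulr_ge0.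
  have [del del0 hdel] := hD _ (divr_gt0 e0 N0).
  exists del => // h k hh hk; have [sec /(_ (Y a b))] := hdel h k hh hk.
  have sY := sectm _ (sect a b _ (lexx _) ha hb).
  rewrite -!S_add//; last exact: sector_real.
  rewrite !addCx (_ : t / 4 + h + (t - t / 4 + a) = t + (a + h)); last by ring.
  rewrite (addrC k) (_ : t / 4 + (t - t / 4 + a) = t + a); last by ring.
  rewrite add0r => /le_trans; apply.
  rewrite mulrAC ler_wpM2r ?addr_ge0// mulrAC ler_pdivrMr// ler_wpM2l ?(ltW e0)//.
  by rewrite (le_trans (SMab a b _ s1 ha hb))// lerDl.
have disc0 : (0 : R) ^+ 2 + 0 ^+ 2 < (c * t) ^+ 2 by rewrite expr0n/= addr0 exprn_gt0.
have := @cauchy_estimate R u v p q (c * t) (2 * (M * `|x|)) (CD * (M * `|x|)) ct0.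
have -> : `|p 0 0| = `|D t x|.
  rewrite /p /P /Y addr0 S_real//= (T0 tt4) -/(D t x) phiD ger0_norm//.
have -> : 8 * M / c / t * `|x| = 4 * (2 * (M * `|x|)) / (c * t).
  by field; rewrite !gt_eqF.
apply.
- move=> a b hab e e0; have [del del0 hdel] := key a b e hab e0; exists del => // h k hh hk.
  rewrite (le_trans _ (hdel h k hh hk))//; set V := (X in _ <= `|X|).
  apply: le_trans (phi_le V fst (norm_fst V)).
  rewrite le_eqVlt; apply/orP; left; apply/eqP; congr (`| _ |).
  rewrite /V /= !(bounded_linearB _ _ hphi) !(bounded_linearZ _ _ hphi) /u /p /q /GRing.scale/=.
  by ring.
- move=> a b hab e e0; have [del del0 hdel] := key a b e hab e0; exists del => // h k hh hk.
  rewrite (le_trans _ (hdel h k hh hk))//; set V := (X in _ <= `|X|).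
  apply: le_trans (phi_le V snd (norm_snd V)).
  rewrite le_eqVlt; apply/orP; left; apply/eqP; congr (`| _ |).
  rewrite /V /= !(bounded_linearB _ _ hphi) (bounded_linearD _ _ hphi) !(bounded_linearZ _ _ hphi) /v /p /q /GRing.scale/=.
  by ring.
- move=> r /andP[r0 rc] th.
  have sc : sector m (Cx (t - t / 4 + r * cos th) (r * sin th)).
    have [] := @disc_bound (c * t) (r * cos th) (r * sin th) ct0.
      by rewrite (exprMn _ r (cos th)) (exprMn _ r (sin th)) -mulrDr cos2Dsin2 mulr1 ltr_pXn2r// nnegrE ltW.
    by move=> h1 h2; apply: sectm; exact: sect.
  have cY : {for th, continuous (fun th => S (Cx (t - t / 4 + r * cos th) (r * sin th)) (x, 0))}.
    apply: S_continuous => //.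
      by apply: cvgD; [exact: cvg_cst|apply: cvgMr; exact: continuous_cos].
    by apply: cvgMr; exact: continuous_sin.
  apply: (@cvg_comp _ _ _ _ phi _ (nbhs (P (r * cos th) (r * sin th)).1)); last first.
    exact: (bounded_linear_continuous hphi).
  apply: (@cvg_comp _ _ _ _ fst _ (nbhs (P (r * cos th) (r * sin th)))); last exact: cvg_fst.
  apply: (@cvg_comp _ _ _ _ (Dop (t / 4)) _ (nbhs (Y (r * cos th) (r * sin th)))); first exact: cY.
  exact: (bounded_linear_continuous lD).
- move=> a b /(disc_bound ct0)[ha hb]; rewrite (le_trans (phi_le (P a b) fst (norm_fst _)))//.
  rewrite (le_trans (lD.2 _))// ler_wpM2l ?(ltW CD0)//; exact: SMab.
- move=> a b /(disc_bound ct0)[ha hb]; rewrite (le_trans (ler_normB _ _))// mulr_natl mulr2n lerD//.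
    rewrite (le_trans (phi_le (S _ _) fst (norm_fst _)))//; exact: SMab.
  rewrite (le_trans (phi_le (S _ _) fst (norm_fst _)))//.
  by have := SMab 0 0 _ s2; rewrite addr0 normr0; apply.
- move=> a b /(disc_bound ct0)[ha hb]; rewrite (le_trans (ler_normB _ _))// mulr_natl mulr2n lerD//.
    rewrite (le_trans (phi_le (S _ _) snd (norm_snd _)))//; exact: SMab.
  rewrite (le_trans (phi_le (S _ _) snd (norm_snd _)))//.
  by have := SMab 0 0 _ s2; rewrite addr0 normr0; apply.
- by rewrite /u addr0 subrr.
- by rewrite /v addr0 subrr.
Qed.

End AnalyticSemigroup.

(** * Fractional powers of omega I - A *)

Section SectorialSemigroup.
Variables (R : realType) (X : completeNormedModType R).
Notation mu := (@lebesgue_measure R).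
Variables (T : R -> X -> X) (omega : R).
Hypotheses (T_C0 : C0_semigroup T) (T_analytic : analytic T).
Hypothesis T_growth : (growth_bound T < omega%:E)%E.
Implicit Types (a b e h s t : R) (x y : X).

(** The semigroup generated by A - omega I; since omega exceeds the growth bound of T it decays
    exponentially, so that integrals up to infinity converge. *)
Definition rescaled_semigroup t x := expR (- (omega * t)) *: T t x.
Notation S := rescaled_semigroup.

Lemma semigroup_growth : exists (w M : R), [/\ w < omega, 0 <= M &
  forall t, 0 <= t -> bounded_linear (M * expR (w * t)) (T t)].
Proof.
have [_ [w [M hM] <-] wo] := ereal_inf_lt T_growth.
exists w, `|M|; rewrite lte_fin in wo; split => // t t0.
have [/(_ _ t0)[lT _] _ _ _] := T_C0; split=> [a x y|x]; first by rewrite lT.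
by rewrite (le_trans (hM t t0 x))// ler_wpM2r// ler_wpM2r ?expR_ge0// ler_norm.
Qed.

Lemma rescaled_semigroupP : exists (M d : R), [/\ 0 <= M, 0 < d,
  forall t, 0 <= t -> bounded_linear (M * expR (- (d * t))) (S t) &
  [/\ forall x, S 0 x = x,
      forall t s x, 0 <= t -> 0 <= s -> S (t + s) x = S t (S s x) &
      forall x, S t x @[t --> 0^'+] --> x]].
Proof.
have [w [M [wo M0 hM]]] := semigroup_growth.
have [Tb T0 Tadd Tcvg] := T_C0.
exists M, (omega - w); split => //; first by rewrite subr_gt0.
  move=> t t0; have [h1 h2] := hM t t0; split=> [a x y|x].
    by rewrite /S h1 scalerDr !scalerA mulrC.
  rewrite normrZ ger0_norm ?expR_ge0//.
  have -> : expR (- ((omega - w) * t)) = expR (- (omega * t)) * expR (w * t).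
    by rewrite -expRD; congr expR; ring.
  by rewrite mulrCA -mulrA ler_wpM2l ?expR_ge0// h2.
split.
- by move=> x; rewrite /S mulr0 oppr0 expR0 scale1r T0.
- move=> t s x t0 s0; rewrite /S Tadd// (bounded_linearZ _ _ (hM t t0)) scalerA -expRD.
  by congr (expR _ *: _); ring.
- move=> x; have -> : nbhs x = nbhs (expR (- (omega * 0)) *: x) by rewrite mulr0 oppr0 expR0 scale1r.
  apply: cvgZ; last exact: Tcvg.
  apply: cvg_at_right_filter; apply: continuous_comp; last exact: continuous_expR.
  by apply: cvgN; apply: cvgMr; exact: cvg_id.
Qed.

(** Q t is e^{-omega t} (omega T t - T'(t)). Up to [t0] its bound is Cauchy's estimate; beyond,
    T'(t) = T (t - t0) T'(t0) and exponential decay is weakened to 1 / (d t), so that K / t holds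
    for all t > 0. *)
Lemma rescaled_semigroup_derivative : exists (Q : R -> X -> X) (K : R),
  [/\ forall t x, 0 < t -> `|Q t x| <= K / t * `|x|,
      forall s t x, 0 <= s -> 0 < t -> S s (Q t x) = Q (s + t) x &
      forall t x C (phi : X -> R^o), 0 < t -> bounded_linear C phi ->
        is_derive t (1 : R) (fun r => phi (S r x)) (- phi (Q t x))].
Proof.
have [w [M [wo M0 hM]]] := semigroup_growth.
have [Tb T0 Tadd Tcvg] := T_C0.
have [m [V [m0 [V1 V2 V3 V4 V5]]]] := T_analytic.
pose D := semigroup_derivative T m V.
have DP := semigroup_derivativeP m0 V2 V3 V4.
have [t0 [K [t00 K0 DK]]] := semigroup_derivative_le m0 V1 V2 V3 V4 V5.
(* Both sides are limits of the same difference quotient: T s applied to the expansion at t is the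
   expansion at s + t. A common step h makes both errors small. *)
have Dadd s t x : 0 <= s -> 0 < t -> T s (D t x) = D (s + t) x.
  move=> s0 tp; have st : 0 < s + t by rewrite ltr_wpDl.
  have [C C0 lT] := bounded_operatorP (Tb s s0).
  apply/eqP; rewrite -subr_eq0 -normr_eq0; apply/eqP/le_anti; rewrite normr_ge0 andbT.
  apply/ler_addgt0Pl => e e0; rewrite addr0.
  have C1 : 0 < C + 1 by rewrite addr_gt0.
  have e1 : 0 < e / (C + 1) by rewrite divr_gt0.
  have [d1 d10 h1] := DP t x _ tp e1.
  have [d2 d20 h2] := DP (s + t) x _ st e1.
  pose h := Num.min d1 d2 / 2.
  have md : 0 < Num.min d1 d2 by rewrite lt_min d10.
  have h0 : 0 < h by rewrite divr_gt0.
  have : h < Num.min d1 d2 by rewrite ltr_pdivrMr// ltr_pMr// ltr1n.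
  rewrite lt_min => /andP[hd1 hd2].
  rewrite -(ler_pM2l h0) -[X in X * `|_|](gtr0_norm h0) -normrZ scalerBr.
  have -> : h *: T s (D t x) - h *: D (s + t) x =
      (T (s + t + h) x - T (s + t) x - h *: D (s + t) x) - T s (T (t + h) x - T t x - h *: D t x).
    rewrite !(bounded_linearB _ _ lT) (bounded_linearZ _ _ lT) -!Tadd ?addr_ge0 ?(ltW tp) ?(ltW h0)// !addrA.
    by rewrite [X in _ = _ - X](_ : _ = T (s + t + h) x - T (s + t) x - h *: T s (D t x))// opprB [RHS]addrC subrKA.
  rewrite (le_trans (ler_normB _ _))//.
  have hn : `|h| = h by rewrite gtr0_norm.
  have := h1 h; have := h2 h; rewrite hn => /(_ hd2) H2 /(_ hd1) H1.
  rewrite (le_trans (lerD H2 (le_trans (lT.2 _) (ler_wpM2l (ltW C0) H1))))//.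
  by rewrite le_eqVlt; apply/orP; left; apply/eqP; field; rewrite gt_eqF.
pose d := omega - w; have d0 : 0 < d by rewrite subr_gt0.
have expd t : 0 < t -> expR (- (d * t)) <= (d * t)^-1.
  move=> tp; rewrite expRN lef_pV2 ?posrE ?expR_gt0 ?mulr_gt0//.
  by rewrite (le_trans _ (expR_ge1Dx _))// lerDr.
have expE t : expR (- (omega * t)) * expR (w * t) = expR (- (d * t)).
  by rewrite -expRD; congr expR; rewrite /d; ring.
(* [K1] bounds the contribution of omega T t for all t, [K2] that of the derivative up to [t0], and
   [K3] that of the derivative beyond [t0]. *)
pose K1 := `|omega| * M / d; pose K2 := expR (`|omega| * t0) * K.
pose K3 := M * K / t0 * expR (- (w * t0)) / d.
have K10 : 0 <= K1 by rewrite /K1 divr_ge0 ?mulr_ge0// ltW.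
have K20 : 0 <= K2 by rewrite /K2 mulr_ge0 ?expR_ge0.
have K30 : 0 <= K3 by rewrite /K3 !mulr_ge0 ?expR_ge0 ?invr_ge0 ?(ltW t00) ?(ltW d0).
exists (fun t x => expR (- (omega * t)) *: (omega *: T t x - D t x)), (K1 + (K2 + K3)); split.
- move=> t x tp; rewrite scalerBr (le_trans (ler_normB _ _))// !normrZ (ger0_norm (expR_ge0 _)).
  rewrite !mulrDl lerD//.
    have [_ /(_ x) hT] := hM t (ltW tp).
    apply: (@le_trans _ _ (expR (- (omega * t)) * (`|omega| * (M * expR (w * t) * `|x|)))).
      by rewrite ler_wpM2l ?expR_ge0// ler_wpM2l.
    have -> : expR (- (omega * t)) * (`|omega| * (M * expR (w * t) * `|x|)) =
        `|omega| * M * (expR (- (omega * t)) * expR (w * t)) * `|x| by ring.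
    rewrite expE ler_wpM2r//.
    have -> : K1 / t = `|omega| * M * (d * t)^-1 by rewrite /K1; field; rewrite !gt_eqF.
    by rewrite ler_wpM2l ?expd// mulr_ge0.
  have [tt0|t0t] := leP t t0.
    apply: (@le_trans _ _ (K2 / t * `|x|)).
      have htt : 0 < t <= t0 by rewrite tp.
      rewrite (le_trans (ler_wpM2l (expR_ge0 _) (DK t x htt)))// /K2.
      have -> : expR (`|omega| * t0) * K / t * `|x| = expR (`|omega| * t0) * (K / t * `|x|) by ring.
      rewrite ler_wpM2r ?mulr_ge0 ?invr_ge0 ?(ltW tp)// ler_expR.
      rewrite (le_trans (ler_norm _))// normrN normrM ler_wpM2l// gtr0_norm//.
    by rewrite lerDl mulr_ge0// mulr_ge0 ?invr_ge0 ?(ltW tp).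
  apply: (@le_trans _ _ (K3 / t * `|x|)); last by rewrite lerDr mulr_ge0// mulr_ge0 ?invr_ge0 ?(ltW tp).
  have tt : 0 <= t - t0 by rewrite subr_ge0 ltW.
  have -> : D t x = T (t - t0) (D t0 x) by rewrite Dadd// subrK.
  have [_ /(_ (D t0 x)) hT] := hM _ tt.
  have htt : 0 < t0 <= t0 by rewrite t00 lexx.
  rewrite (le_trans (ler_wpM2l (expR_ge0 _) hT))//.
  apply: (@le_trans _ _ (expR (- (omega * t)) * (M * expR (w * (t - t0)) * (K / t0 * `|x|)))).
    by rewrite ler_wpM2l ?expR_ge0// ler_wpM2l ?mulr_ge0 ?expR_ge0// DK.
  have -> : expR (w * (t - t0)) = expR (w * t) * expR (- (w * t0)).
    by rewrite -expRD; congr expR; ring.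
  have -> : expR (- (omega * t)) * (M * (expR (w * t) * expR (- (w * t0))) * (K / t0 * `|x|)) =
     M * K / t0 * expR (- (w * t0)) * (expR (- (omega * t)) * expR (w * t)) * `|x| by ring.
  rewrite expE ler_wpM2r//.
  have -> : K3 / t = M * K / t0 * expR (- (w * t0)) * (d * t)^-1.
    by rewrite /K3; field; rewrite !gt_eqF.
  by rewrite ler_wpM2l ?expd// !mulr_ge0 ?expR_ge0 ?invr_ge0 ?(ltW t00).
- move=> s t x s0 tp; have lT := hM s s0.
  rewrite /S (bounded_linearZ _ _ lT) (bounded_linearB _ _ lT) (bounded_linearZ _ _ lT).
  rewrite scalerA -expRD Dadd// -Tadd ?(ltW tp)//.
  by congr (expR _ *: _); ring.
- move=> t x C phi tp hphi.
  (* With a dummy second variable, [is_derive_total] converts the quantitative expansion into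
     [is_derive]. *)
  have tot : is_total_derivative (fun a _ => phi (T a x) : R) t 0 (phi (D t x)) 0.
    move=> e e0; have C1 : 0 < `|C| + 1 by rewrite ltr_wpDl.
    have [del del0 hd] := DP t x _ tp (divr_gt0 e0 C1).
    exists del => // h k /hd hh _; rewrite mul0r addr0.
    have -> : phi (T (t + h) x) - phi (T t x) - phi (D t x) * h = phi (T (t + h) x - T t x - h *: D t x).
      by rewrite !(bounded_linearB _ _ hphi) (bounded_linearZ _ _ hphi) /GRing.scale/= mulrC.
    rewrite (le_trans ((bounded_linear_ge0 hphi).2 _))//.
    rewrite (le_trans (ler_wpM2l (normr_ge0 _) hh))//.
    apply: (@le_trans _ _ (e * `|h|)); last by rewrite ler_wpM2l ?lerDl// ltW.
    rewrite mulrA ler_wpM2r// mulrCA -[leRHS]mulr1 ler_wpM2l ?(ltW e0)//.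
    by rewrite ler_pdivrMr// mul1r lerDl.
  have d1 := is_derive_total (a := id) (b := fun=> 0) (t := t) tot (is_derive_id _ _) (is_derive_cst _ _ _).
  have d2 : is_derive t (1 : R) (fun r => expR (- (omega * r))) (- omega * expR (- (omega * t))).
    by apply: is_derive_eq; rewrite /GRing.scale/=; ring.
  rewrite (_ : (fun r => phi (S r x)) = (fun r => expR (- (omega * r)) * phi (T r x))); last first.
    by apply/funext => r; rewrite (bounded_linearZ _ _ hphi).
  have := is_deriveM d2 d1; rewrite /GRing.scale/= => d3.
  apply: is_derive_eq.
  rewrite (bounded_linearZ _ _ hphi) (bounded_linearB _ _ hphi) (bounded_linearZ _ _ hphi) /GRing.scale/=.
  by ring.
Qed.

Lemma gamma_fun_gt0 b : 0 < b <= 1 -> 0 < gamma_fun b.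
Proof.
move=> /andP[b0 b1]; have hb : 0 < b <= 1 by rewrite b0.
have := gamma_integral_lty hb ltr01; under eq_integral do rewrite mul1r.
move=> fin; apply: fine_gt0; rewrite fin andbT.
have m0y : measurable (`]0, +oo[%classic : set (measurableTypeR R)) by exact: measurable_itv.
have mf : measurable_fun (`]0, +oo[%classic : set (measurableTypeR R)) (fun t : measurableTypeR R => (t `^ (b - 1) * expR (- t))%:E).
  apply/measurable_EFinP; apply: measurable_funTS; apply: measurable_funM.
    exact: measurable_powR.
  by apply: continuous_measurable_fun => t; apply: continuous_comp; [exact: opp_continuous|exact: continuous_expR].
apply: (@lt_le_trans _ _ (expR (-1))%:E); first by rewrite lte_fin expR_gt0.
have m01 : measurable (`]0, 1]%classic : set (measurableTypeR R)) by exact: measurable_itv.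
apply: (@le_trans _ _ (\int[mu]_(t in `]0%R, 1%R]) (t `^ (b - 1) * expR (- t))%:E)%E); last first.
  apply: ge0_subset_integral => //; last by move=> t /=; rewrite !in_itv/= => /andP[->].
  by move=> t _; rewrite lee_fin mulr_ge0 ?powR_ge0 ?expR_ge0.
have E : mu (`]0%R, 1%R]%classic : set R) = 1%E by rewrite lebesgue_measure_itv/= lte_fin ltr01 sube0.
rewrite -[leLHS]mule1 -E -integral_cst//; apply: ge0_le_integral => //.
- by move=> t _; rewrite lee_fin expR_ge0.
- by apply: measurable_funS mf => //; move=> t /=; rewrite !in_itv/= => /andP[->].
- move=> t /=; rewrite in_itv/= => /andP[t0 t1]; rewrite lee_fin -[leLHS]mul1r ler_pM ?expR_ge0//.
    by rewrite -[leLHS](powRr0 t); apply: ger_powR; [rewrite t0|rewrite subr_le0].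
  by rewrite ler_expR lerN2.
Qed.

Notation C := (fracpow_neg T omega).

Let CE a x : C a x = (gamma_fun a)^-1 *: pint S a x.
Proof.
rewrite /fracpow_neg /pint; congr (_ *: bochner _ _).
by apply/funext => t; rewrite /S scalerA.
Qed.

Let gamma_neq0 b : 0 < b <= 1 -> gamma_fun b != 0.
Proof. by move=> /gamma_fun_gt0 /lt0r_neq0. Qed.

Lemma fracpow_neg_linear a : 0 < a <= 1 -> exists2 K, 0 <= K & bounded_linear K (C a).
Proof.
move=> ha; have [M [d [M0 d0 hl [h1 h2 h3]]]] := rescaled_semigroupP.
have hP := bounded_linear_ge0 (pint_linear M0 d0 hl h1 h2 h3 ha).
have := bounded_linear_comp (normr_ge0 _) (bounded_linear_scale X (gamma_fun a)^-1) hP.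
move=> h; eexists; last first.
  rewrite (_ : C a = (fun x => (gamma_fun a)^-1 *: x) \o pint S a); first exact: h.
  by apply/funext => x; rewrite CE.
by rewrite mulr_ge0.
Qed.

Lemma fracpow_neg_comm a t x : 0 < a <= 1 -> 0 <= t -> T t (C a x) = C a (T t x).
Proof.
move=> ha t0; have [M [d [M0 d0 hl [h1 h2 h3]]]] := rescaled_semigroupP.
have [w [N [_ _ hN]]] := semigroup_growth.
rewrite !CE (bounded_linearZ _ _ (hN t t0)); congr (_ *: _).
have := pint_comm M0 d0 hl h1 h2 h3 x ha t0.
rewrite /S (bounded_linearZ _ _ (pint_linear M0 d0 hl h1 h2 h3 ha)).
by move/(scalerI (lt0r_neq0 (expR_gt0 _))).
Qed.

Lemma fracpow_neg_inj a x : 0 < a <= 1 -> C a x = 0 -> x = 0.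
Proof.
move=> ha /eqP; rewrite CE scaler_eq0 invr_eq0 (negbTE (gamma_neq0 ha))/= => /eqP.
have [M [d [M0 d0 hl [h1 h2 h3]]]] := rescaled_semigroupP.
exact: pint_inj M0 d0 hl h1 h2 h3 a x ha.
Qed.

(** The factor is Gamma(a + b) B(a, b) / (Gamma(a) Gamma(b)). Its being nonzero is what allows it to
    be divided out in the kernel of the control term. *)
Lemma fracpow_neg_law a b : 0 < a -> 0 < b -> a + b <= 1 ->
  exists2 c, c != 0 & forall x, C a (C b x) = c *: C (a + b) x.
Proof.
move=> a0 b0 ab1.
have ha : 0 < a <= 1 by rewrite a0 (le_trans _ ab1)// lerDl ltW.
have hb : 0 < b <= 1 by rewrite b0 (le_trans _ ab1)// lerDr ltW.
have hab : 0 < a + b <= 1 by rewrite addr_gt0.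
have [M [d [M0 d0 hl [h1 h2 h3]]]] := rescaled_semigroupP.
exists ((gamma_fun a)^-1 * (gamma_fun b)^-1 * fine (beta_integral a b : \bar R) * gamma_fun (a + b)).
  rewrite !mulf_neq0 ?invr_eq0 ?gamma_neq0// fine_eq0 ?gt_eqF ?beta_integral_gt0//.
  by rewrite ge0_fin_numE ?beta_integral_lty// ltW// beta_integral_gt0.
move=> x; rewrite !CE (bounded_linearZ _ _ (pint_linear M0 d0 hl h1 h2 h3 ha)).
rewrite (pint_law M0 d0 hl h1 h2 h3 x a0 b0 ab1) !scalerA; congr (_ *: _).
by rewrite mulfK// gamma_neq0.
Qed.

Lemma Xpow_fracpow_neg a y : Xpow T omega a (C a y).
Proof. exact: (ex_intro2 _ _ y I erefl). Qed.

Lemma fracpowK a x : Xpow T omega a x -> C a (fracpow T omega a x) = x.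
Proof. by move=> [y _ hy]; exact: (xgetPex 0 (ex_intro (fun z => C a z = x) y hy)). Qed.

Lemma fracpow_negK a y : 0 < a <= 1 -> fracpow T omega a (C a y) = y.
Proof.
move=> ha; have E := fracpowK (Xpow_fracpow_neg a y).
have [K _ hK] := fracpow_neg_linear ha.
apply/eqP; rewrite -subr_eq0; apply/eqP/(fracpow_neg_inj ha).
by rewrite (bounded_linearB _ _ hK) E subrr.
Qed.

Lemma Xpow_semigroup a t x : 0 < a < 1 -> 0 < t -> Xpow T omega a (T t x).
Proof.
move=> /andP[a0 a1] t0; have ha : 0 < a <= 1 by rewrite a0 ltW.
have [M [d [M0 d0 hl [h1 h2 h3]]]] := rescaled_semigroupP.
have [Q [K [Q1 Q2 Q3]]] := rescaled_semigroup_derivative.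
have ha' : 0 < a < 1 by rewrite a0.
have [y hy _] := pint_range M0 d0 hl h1 h2 h3 Q1 Q2 Q3 x ha' t0.
(* The factor undoes the exponential rescaling of T and the division by Gamma(a) in
   [fracpow_neg]. *)
exists ((expR (omega * t) * gamma_fun a) *: y) => //.
rewrite CE (bounded_linearZ _ _ (pint_linear M0 d0 hl h1 h2 h3 ha)) hy /S !scalerA.
have -> : (gamma_fun a)^-1 * (expR (omega * t) * gamma_fun a) * expR (- (omega * t)) = 1.
  by rewrite expRN; field; rewrite gamma_neq0// gt_eqF ?expR_gt0.
by rewrite scale1r.
Qed.

Lemma fracpow_semigroup_le a : 0 < a < 1 -> exists2 K, 0 <= K & forall t x, 0 < t ->
  `|fracpow T omega a (T t x)| <= K * expR (omega * t) * t `^ (- a) * `|x|.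
Proof.
move=> /andP[a0 a1]; have ha : 0 < a <= 1 by rewrite a0 ltW.
have [M [d [M0 d0 hl [h1 h2 h3]]]] := rescaled_semigroupP.
have [Q [K [Q1 Q2 Q3]]] := rescaled_semigroup_derivative.
set B := (fine (beta_integral a (1 - a) : \bar R))^-1 * (K * (1 / (1 - a) + 1 / a)).
have ha' : 0 < a < 1 by rewrite a0.
exists (`|gamma_fun a| * `|B|); first by rewrite mulr_ge0.
move=> t x t0; have [y hy yle] := pint_range M0 d0 hl h1 h2 h3 Q1 Q2 Q3 x ha' t0.
have -> : T t x = C a ((expR (omega * t) * gamma_fun a) *: y).
  rewrite CE (bounded_linearZ _ _ (pint_linear M0 d0 hl h1 h2 h3 ha)) hy /S !scalerA.
  have -> : (gamma_fun a)^-1 * (expR (omega * t) * gamma_fun a) * expR (- (omega * t)) = 1.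
    by rewrite expRN; field; rewrite gamma_neq0// gt_eqF ?expR_gt0.
  by rewrite scale1r.
rewrite fracpow_negK// normrZ normrM (ger0_norm (expR_ge0 _)).
have -> : `|gamma_fun a| * `|B| * expR (omega * t) * t `^ (- a) * `|x| =
    expR (omega * t) * `|gamma_fun a| * (`|B| * t `^ (- a) * `|x|) by ring.
rewrite ler_wpM2l ?mulr_ge0 ?expR_ge0// (le_trans yle)// !ler_wpM2r ?powR_ge0 ?ler_norm//.
Qed.

End SectorialSemigroup.

(** * Volterra integrals with a weakly singular kernel *)

Section VolterraKernel.
Variables (R : realType) (X : completeNormedModType R) (W : normedModType R).
Notation mu := (@lebesgue_measure R).
Variables (T : R -> X -> X) (K : R -> W -> X) (c : R).
Hypothesis T_bound : forall tau, exists2 M, 0 <= M & forall t, 0 <= t <= tau -> bounded_linear M (T t).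
Hypothesis T_id : forall x, T 0 x = x.
Hypothesis T_add : forall t s x, 0 <= t -> 0 <= s -> T (t + s) x = T t (T s x).
Hypothesis T_seq : forall (r : nat -> R) (y : nat -> X) (t : R) (x : X), (forall n, 0 <= r n) -> 0 <= t ->
  r n @[n --> \oo] --> t -> y n @[n --> \oo] --> x -> T (r n) (y n) @[n --> \oo] --> T t x.
Hypothesis T_cont : forall x, continuous (fun t : R => T `|t| x).
Hypothesis c01 : 0 < c < 1.
Hypothesis K_bound : forall tau, exists2 k, 0 <= k &
  forall s, 0 < s <= tau -> bounded_linear (k * s `^ (- c)) (K s).
Hypothesis K_add : forall h s w, 0 <= h -> 0 < s -> T h (K s w) = K (s + h) w.
Implicit Types (a b e h s t tau : R) (y : R -> X) (g : R -> W).

Let mcc a b : measurable (`[a, b]%classic : set (measurableTypeR R)).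
Proof. exact: measurable_itv. Qed.
Let moc a b : measurable (`]a, b]%classic : set (measurableTypeR R)).
Proof. exact: measurable_itv. Qed.

Lemma ae_neq a : {ae mu, forall s, s != a}.
Proof.
exists [set a]; split => //; first exact: lebesgue_measure_set1.
by move=> s /= /negP; rewrite negbK => /eqP.
Qed.

(** Continuity of K at s > 0 is inherited from T: near s, K r equals T (r - s / 2) composed with the
    fixed bounded operator K (s / 2). *)
Lemma kernel_cvg (r : nat -> R) (w : nat -> W) s v : 0 < s ->
  r n @[n --> \oo] --> s -> w n @[n --> \oo] --> v -> K (r n) (w n) @[n --> \oo] --> K s v.
Proof.
move=> s0 rs wv; have s2 : 0 < s / 2 by rewrite divr_gt0.
have [k k0 hk] := K_bound s.
have hk2 : 0 < s / 2 <= s by rewrite s2 ler_pdivrMr// ler_pMr// ler1n.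
have L : T `|r n - s / 2| (K (s / 2) (w n)) @[n --> \oo] --> T (s / 2) (K (s / 2) v).
  apply: T_seq; [by []|exact: ltW| |].
    have -> : nbhs (s / 2) = nbhs `|s - s / 2| by rewrite [X in X - _](splitr s) addrK gtr0_norm.
    by apply: cvg_norm; apply: cvgB; [exact: rs|exact: cvg_cst].
  apply: (@cvg_comp _ _ _ w (K (s / 2)) _ (nbhs v)) => //.
  exact: (bounded_linear_continuous (hk _ hk2)).
rewrite (K_add _ (ltW s2) s2) -splitr in L.
apply: cvg_trans L; apply: near_eq_cvg; near=> n.
have h : 0 <= r n - s / 2.
  rewrite subr_ge0; near: n; move/cvgrPdist_lt/(_ _ s2) : rs; apply: filterS => n.
  by rewrite ltr_norml => /andP[_ h]; rewrite /= in h *; lra.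
by rewrite ger0_norm// K_add// subrKC.
Unshelve. all: by end_near. Qed.

Lemma kernel_measurable a b g : 0 <= a -> strongly_measurable `[a, b] g ->
  strongly_measurable `[a, b] (fun s => K (b - s) (g s)).
Proof.
move=> a0 mg; apply: (strongly_measurable_joint (k := fun s => K (b - s)) _ mg).
  by move=> t /=; rewrite in_itv/= => /andP[/(le_trans a0)].
apply: aeS (ae_neq b) => t tb /=; rewrite in_itv/= => /andP[_ t1] r y _ rt yt.
apply: kernel_cvg => //; first by rewrite subr_gt0 lt_neqAle tb.
by apply: cvgB => //; exact: cvg_cst.
Qed.

Lemma reflected_power_integral a b : a <= b ->
  (\int[mu]_(s in `[a, b]) ((b - s) `^ (- c))%:E <= ((b - a) `^ (1 - c) / (1 - c))%:E)%E.
Proof.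
have /andP[c0 c1] := c01.
rewrite le_eqVlt => /predU1P[<-|ab].
  rewrite subrr powR0 ?mul0r; last by rewrite subr_eq0 gt_eqF.
  by rewrite set_itv1 integral_set1.
have ba : 0 < b - a by rewrite subr_gt0.
apply: le_trans (power_integral0 ba c1).
pose h (r : measurableTypeR R) : \bar R := (\1_(`]0, b - a]%classic : set R) r * r `^ (- c))%:E.
have mh : measurable_fun setT h.
  apply/measurable_EFinP; apply: measurable_funM; last exact: measurable_powR.
  by apply: measurable_indic; exact: moc.
have h0 r : (0 <= h r)%E by rewrite lee_fin mulr_ge0 ?powR_ge0.
have := @ge0_integral_affine R (-1) b h _ mh h0; rewrite normrN1 invr1 mul1e => H.
rewrite integral_mkcond [leRHS]integral_mkcond.
have -> : (\int[mu]_r ((fun r => (r `^ (- c))%:E) \_ `]0%R, (b - a)%R]) r = \int[mu]_r h r)%E.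
  apply: eq_integral => r _; rewrite patchE /h indicE; case: ifP => _; first by rewrite mul1r.
  by rewrite mul0r.
rewrite -H; last by rewrite oppr_eq0 oner_neq0.
rewrite le_eqVlt; apply/orP; left; apply/eqP; apply: eq_integral => r _.
rewrite patchE /h indicE (_ : -1 * r + b = b - r); last by rewrite mulN1r addrC.
rewrite !mem_setE !in_itv/= subr_gt0 lerD2l lerN2.
(* At r = b the indicator vanishes, and so does the power of 0, by the convention for nonzero
   exponents. *)
have [->|rb] := eqVneq r b.
  rewrite ltxx /= subrr [0 `^ _]powR0; last by rewrite oppr_eq0 gt_eqF.
  by rewrite if_same mul0r.
by rewrite lt_neqAle rb/= andbC; case: ifP => _; rewrite ?mul1r ?mul0r.
Qed.

Lemma kernel_integral_le a b k N g : 0 <= a -> a <= b -> 0 <= k -> 0 <= N ->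
  (forall s, 0 < s <= b -> bounded_linear (k * s `^ (- c)) (K s)) ->
  {ae mu, forall s, a <= s <= b -> `|g s| <= N} ->
  (\int[mu]_(s in `[a, b]) (`|K (b - s) (g s)|)%:E <=
    (k * N * ((b - a) `^ (1 - c) / (1 - c)))%:E)%E.
Proof.
move=> a0 ab k0 N0 hk hg.
apply: (@le_trans _ _ (\int[mu]_(s in `[a, b]) ((k * N)%:E * ((b - s) `^ (- c))%:E))%E).
  apply: ae_le_integral => //; first by move=> s _; rewrite mule_ge0// lee_fin ?mulr_ge0 ?powR_ge0.
  apply: aeS2 (ae_neq b) hg => s sb gs /=; rewrite in_itv/= => /andP[s1 s2].
  rewrite -EFinM lee_fin.
  have bs : 0 < b - s <= b by rewrite subr_gt0 lt_neqAle sb s2 lerBlDr lerDl (le_trans a0).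
  rewrite (le_trans ((hk _ bs).2 _))// mulrAC ler_wpM2r ?powR_ge0//.
  by rewrite ler_wpM2l// gs// s1.
rewrite ge0_integralZl_EFin//; last 3 first.
- by move=> s _; rewrite lee_fin powR_ge0.
- apply/measurable_EFinP; apply: measurable_funTS; apply: (measurableT_comp (measurable_powR (- c))).
  by apply: measurable_funB.
- by rewrite mulr_ge0.
by rewrite [leRHS]EFinM lee_wpmul2l ?reflected_power_integral// lee_fin mulr_ge0.
Qed.

(** The forcing g is a given function here, independent of y, so that restarting, gluing and
    continuity are linear matters; the nonlinear equation is the case g s = F (y s) (u s). *)
Definition volterra g (y0 : X) tau y := forall t, 0 <= t <= tau ->
  is_bochner `[0, t] (fun s => K (t - s) (g s)) (y t - T t y0).

(* y is almost an orbit of T, hence inherits its continuity. *)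
Lemma quasi_orbit_continuous tau y :
  (forall e, 0 < e -> exists2 d, 0 < d & forall t h, 0 <= t -> 0 <= h -> t + h <= tau -> h < d ->
     `|y (t + h) - T h (y t)| <= e) ->
  forall t, 0 <= t <= tau -> forall e, 0 < e -> exists2 d, 0 < d &
    forall s, 0 <= s <= tau -> `|s - t| < d -> `|y s - y t| <= e.
Proof.
move=> hy t /andP[t0 tt] e e0.
have e3 : 0 < e / 3 by rewrite divr_gt0.
have [d d0 hd] := hy _ e3.
(* A base point at or to the left of t and less than d away: on both sides of t, y is compared with
   the single orbit of T started from y a, which also gives left continuity. *)
pose a := Num.max 0 (t - d / 2).
have d2 : 0 < d / 2 by rewrite divr_gt0.
have a0 : 0 <= a by rewrite le_max lexx.
have at_ : a <= t by rewrite ge_max t0/= lerBlDr lerDl ltW.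
have ta : t - a < d.
  have : t - d / 2 <= a by rewrite le_max lexx orbT.
  by lra.
have /cvgrPdist_le/(_ _ e3)[del /= del0 hdel] := @T_cont (y a) (t - a).
have ta0 : 0 <= t - a by rewrite subr_ge0.
exists (Num.min del (Num.min (d / 2) (d - (t - a)))).
  by rewrite !lt_min del0 d2 subr_gt0.
move=> s /andP[s0 st]; rewrite !lt_min => /and3P[s1 s2 s3].
have as_ : a <= s.
  rewrite ge_max s0/= lerBlDr -lerBlDl ltW// (le_lt_trans _ s2)//.
  by rewrite distrC ler_norm.
have sa : s - a < d.
  by have := ler_norm (s - t); lra.
have sa0 : 0 <= s - a by rewrite subr_ge0.
have H r : a <= r -> r <= tau -> r - a < d -> `|y r - T (r - a) (y a)| <= e / 3.
  by move=> ar rt ra; have := hd a (r - a) a0; rewrite subr_ge0 subrKC; apply.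
have -> : y s - y t = (y s - T (s - a) (y a)) + ((T (s - a) (y a) - T (t - a) (y a)) + (T (t - a) (y a) - y t)).
  by rewrite !subrKA.
have -> : e = e / 3 + (e / 3 + e / 3) by field.
rewrite (le_trans (ler_normD _ _))// lerD ?H// (le_trans (ler_normD _ _))// lerD//; last by rewrite distrC H.
have := hdel (s - a); rewrite (ger0_norm sa0) (ger0_norm ta0) distrC; apply.
by rewrite /= opprB addrA subrK distrC.
Qed.

(** By [K_add], T (b - a) applied to the equation at a is the part over [0, a] of the equation at b.
    What remains is the integral over ]a, b], and the point a is negligible. *)
Lemma volterra_restart_itv g (y0 : X) tau y a b : volterra g y0 tau y -> 0 <= a -> a <= b -> b <= tau ->
  is_bochner `[a, b] (fun s => K (b - s) (g s)) (y b - T (b - a) (y a)).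
Proof.
move=> hy a0 ab bt; have b0 := le_trans a0 ab.
have hb := hy b; rewrite b0 bt in hb; have {}hb := hb isT.
have ha := hy a; rewrite a0 (le_trans ab bt) in ha; have {}ha := ha isT.
have ba : 0 <= b - a by rewrite subr_ge0.
have [M M0 hM] := T_bound (b - a).
have lT : bounded_linear M (T (b - a)) by apply: hM; rewrite ba lexx.
have {}ha : is_bochner `[0, a] (fun s => K (b - s) (g s)) (T (b - a) (y a) - T b y0).
  have -> : T (b - a) (y a) - T b y0 = T (b - a) (y a - T a y0).
    by rewrite (bounded_linearB _ _ lT) -T_add// subrK.
  apply: is_bochner_ae (is_bochner_linear (mcc _ _) ha lT).
  apply: aeS (ae_neq a) => s sa /=; rewrite in_itv/= => /andP[s0 s1].
  by rewrite K_add// ?subr_gt0 ?lt_neqAle ?sa// addrC addrA subrK.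
have [v hv] : exists v, is_bochner `]a, b] (fun s => K (b - s) (g s)) v.
  apply: bochner_exists => //; apply: (bochner_integrableS (mcc 0 b)) => //; last first.
    exact: is_bochner_integrable hb.
  by move=> s /=; rewrite !in_itv/= => /andP[s1 ->]; rewrite (le_trans a0 (ltW s1)).
have hab : is_bochner `[a, b] (fun s => K (b - s) (g s)) v.
  apply: (is_bochner_ae_set (moc a b)) hv => //.
  apply: aeS (ae_neq a) => s sa /=; rewrite !in_itv/= lt_neqAle eq_sym sa//=.
suff -> : y b - T (b - a) (y a) = v by [].
have U : is_bochner `[0, b] (fun s => K (b - s) (g s)) (T (b - a) (y a) - T b y0 + v).
  rewrite (_ : `[0, b]%classic = `[0, a]%classic `|` `]a, b]%classic); last first.
    by rewrite -itv_bndbnd_setU ?bnd_simp//=.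
  apply: is_bochner_setU => //.
  apply/disj_set2P/seteqP; split => // s /=; rewrite !in_itv/= => -[/andP[_ s1] /andP[]].
  by rewrite ltNge s1.
suff -> : y b = T (b - a) (y a) + v by rewrite addrAC subrr add0r.
by apply: (addIr (- T b y0)); rewrite (is_bochner_unique (mcc 0 b) hb U) addrAC.
Qed.

Lemma volterra_restart g (y0 : X) tau y a : volterra g y0 tau y -> 0 <= a -> a <= tau ->
  volterra (fun s => g (s + a)) (y a) (tau - a) (fun s => y (s + a)).
Proof.
move=> hy a0 at_ t /andP[t0 tt].
have ta : a <= t + a by rewrite lerDr.
have tat : t + a <= tau by rewrite -lerBrDr.
have := volterra_restart_itv hy a0 ta tat; rewrite addrK.
move=> /(is_bochner_translate a (mcc _ _)).
rewrite (_ : _ @^-1` _ = `[0, t]%classic); last first.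
  by apply/seteqP; split => s /=; rewrite !in_itv/= lerD2r lerDr.
apply: is_bochner_ae; apply: aeW => s _.
by congr (K _ _); ring.
Qed.

Lemma volterra_concat g (y0 : X) a tau y (z : R -> X) : 0 <= a -> 0 <= tau -> volterra g y0 a y ->
  volterra (fun s => g (s + a)) (y a) tau z ->
  volterra g y0 (a + tau) (fun s => if s <= a then y s else z (s - a)).
Proof.
move=> a0 tau0 hy hz t /andP[t0 tt]; have [ta|at_] := leP t a.
  by apply: hy; rewrite t0.
have ta0 : 0 <= t - a by rewrite subr_ge0 ltW.
have ha := hy a; rewrite a0 lexx in ha; have {}ha := ha isT.
have hta := hz (t - a); rewrite ta0 lerBlDl tt in hta; have {}hta := hta isT.
have [M M0 hM] := T_bound (t - a).
have lT : bounded_linear M (T (t - a)) by apply: hM; rewrite ta0 lexx.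
have {}ha : is_bochner `[0, a] (fun s => K (t - s) (g s)) (T (t - a) (y a) - T t y0).
  have -> : T (t - a) (y a) - T t y0 = T (t - a) (y a - T a y0).
    by rewrite (bounded_linearB _ _ lT) -T_add// subrK.
  apply: is_bochner_ae (is_bochner_linear (mcc _ _) ha lT).
  apply: aeS (ae_neq a) => s sa /=; rewrite in_itv/= => /andP[s0 s1].
  by rewrite K_add// ?subr_gt0 ?lt_neqAle ?sa// addrC addrA subrK.
have {}hta : is_bochner `]a, t] (fun s => K (t - s) (g s)) (z (t - a) - T (t - a) (y a)).
  move: hta => /(is_bochner_translate (- a) (mcc _ _)).
  rewrite (_ : _ @^-1` _ = `[a, t]%classic); last first.
    by apply/seteqP; split => s /=; rewrite !in_itv/= lerD2r subr_ge0.
  move=> H; apply: (is_bochner_ae_set (mcc a t) (moc a t)).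
    apply: aeS (ae_neq a) => s sa /=; rewrite !in_itv/= lt_neqAle eq_sym sa//=.
  apply: is_bochner_ae H; apply: aeW => s _; rewrite subrK.
  by congr (K _ _); ring.
have -> : z (t - a) - T t y0 = T (t - a) (y a) - T t y0 + (z (t - a) - T (t - a) (y a)).
  by rewrite [RHS]addrC subrKA.
rewrite (_ : `[0, t]%classic = `[0, a]%classic `|` `]a, t]%classic); last first.
  by rewrite -itv_bndbnd_setU ?bnd_simp//= ltW.
apply: is_bochner_setU => //.
apply/disj_set2P/seteqP; split => // s /=; rewrite !in_itv/= => -[/andP[_ s1] /andP[]].
by rewrite ltNge s1.
Qed.

(** The deviation of y from the orbit of T over [a, b] is the integral over [a, b]. Its smallness on
    short intervals is isolated as a hypothesis because it is met in two ways, by bounded forcing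
    and by forcing in L^p. *)
Lemma volterra_continuous g (y0 : X) tau y : volterra g y0 tau y ->
  (forall e, 0 < e -> exists2 d, 0 < d & forall a b, 0 <= a -> a <= b -> b <= tau -> b - a < d ->
     (\int[mu]_(s in `[a, b]) (`|K (b - s) (g s)|)%:E <= e%:E)%E) ->
  forall t, 0 <= t <= tau -> forall e, 0 < e -> exists2 d, 0 < d &
    forall s, 0 <= s <= tau -> `|s - t| < d -> `|y s - y t| <= e.
Proof.
move=> hy hg; apply: quasi_orbit_continuous => e e0; have [d d0 hd] := hg e e0.
exists d => // t h t0 h0 th hd'; have tth : t <= t + h by rewrite lerDl.
have := volterra_restart_itv hy t0 tth th; rewrite addrAC subrr add0r => H.
rewrite -lee_fin (le_trans (is_bochner_norm (mcc _ _) H))// hd//.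
by rewrite addrAC subrr add0r.
Qed.

Lemma bounded_forcing_small tau N g : 0 <= N ->
  {ae mu, forall s, 0 <= s <= tau -> `|g s| <= N} ->
  forall e, 0 < e -> exists2 d, 0 < d & forall a b, 0 <= a -> a <= b -> b <= tau -> b - a < d ->
     (\int[mu]_(s in `[a, b]) (`|K (b - s) (g s)|)%:E <= e%:E)%E.
Proof.
move=> N0 hg e e0; have [k k0 hk] := K_bound tau; have /andP[c0 c1] := c01.
have c10 : 0 < 1 - c by rewrite subr_gt0.
have kN : 0 < k * N + 1 by rewrite ltr_wpDl// mulr_ge0.
(* The length d satisfies d^(1 - c) = q, which makes the integral at most e; the summand 1 avoids a
   division by zero. *)
pose q := e * (1 - c) / (k * N + 1); have q0 : 0 < q by rewrite divr_gt0// mulr_gt0.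
exists (q `^ (1 - c)^-1); first by rewrite powR_gt0.
move=> a b a0 ab bt bad.
apply: le_trans (@kernel_integral_le a b k N g a0 ab k0 N0 _ _) _.
- by move=> s /andP[s0 sb]; apply: hk; rewrite s0 (le_trans sb).
- by apply: aeS hg => s h /andP[s1 s2]; apply: h; rewrite (le_trans a0 s1) (le_trans s2 bt).
have H : (b - a) `^ (1 - c) <= q.
  rewrite -[leRHS]powRr1 ?(ltW q0)// -[X in q `^ X](mulVf (lt0r_neq0 c10)) powRrM.
  by rewrite ge0_ler_powR ?nnegrE ?(ltW c10) ?subr_ge0 ?powR_ge0// ltW.
rewrite lee_fin mulrA ler_pdivrMr//.
apply: (@le_trans _ _ ((k * N + 1) * q)); last by rewrite /q mulrCA divff ?mulr1 ?gt_eqF.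
by rewrite ler_pM ?mulr_ge0 ?powR_ge0// lerDl.
Qed.

End VolterraKernel.

Lemma geometric_cauchy (R : realType) (V : completeNormedModType R) (v : nat -> V) :
  (forall n, `|v n.+1 - v n| <= (2 ^+ n)^-1) ->
  exists l, forall n, `|l - v n| <= 2 / 2 ^+ n.
Proof.
move=> hv.
have p0 n : 0 < (2 : R) ^+ n by rewrite exprn_gt0.
have hvm n m : `|v (n + m)%N - v n| <= 2 / 2 ^+ n.
  suff : `|v (n + m)%N - v n| <= 2 / 2 ^+ n - 2 / 2 ^+ (n + m).
    by move/le_trans; apply; rewrite lerBlDr lerDl divr_ge0 ?(ltW (p0 _)).
  elim: m => [|m ih]; first by rewrite addn0 !subrr normr0.
  rewrite addnS -[v _.+1](subrK (v (n + m)%N)) -addrA (le_trans (ler_normD _ _))//.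
  rewrite (le_trans (lerD (hv _) ih))// addrC -addrA lerD2l addrC exprS.
  by rewrite le_eqVlt; apply/orP; left; apply/eqP; field; rewrite expf_neq0.
have small (e : R) : 0 < e -> exists N, 2 / 2 ^+ N < e.
  move=> e0; have z1 : `|2^-1 : R| < 1 by rewrite ger0_norm ?invr_ge0// invf_lt1// ltr1n.
  have /cvgr0_norm_lt/(_ _ e0)[N _ /(_ N (leqnn N))] := @cvg_geometric R 2 _ z1.
  rewrite /geometric /= exprVn ger0_norm; last by rewrite divr_ge0 ?(ltW (p0 _)).
  by exists N.
have cv : cvgn v.
  apply/cauchy_cvgP/cauchy_exP => e e0; have [N hN] := small e e0.
  exists (v N); exists N => // n /= Nn; rewrite -ball_normE /= distrC.
  by rewrite -(subnKC Nn) (le_lt_trans (hvm _ _)).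
exists (limn v) => n; apply/ler_addgt0Pr => e e0.
move/cvgrPdist_le/(_ _ e0) : cv => [N _ hN].
have := hN (n + N)%N (leq_addl _ _) => {}hN.
rewrite -(subrK (v (n + N)%N) (limn v)) -addrA (le_trans (ler_normD _ _))// [leRHS]addrC lerD//.
Qed.

Lemma strongly_measurable_translate (R : realType) (X : normedModType R)
  (D : set (measurableTypeR R)) (g : R -> X) (a : R) :
  strongly_measurable D g -> strongly_measurable ((fun t => t + a) @^-1` D) (fun t => g (t + a)).
Proof.
move=> [s [hs sg]]; exists (fun n t => s n (t + a)); split => [n|].
  have mt : measurable_fun setT ((fun x => x + a) : measurableTypeR R -> measurableTypeR R).
    exact: measurable_funD.
  exact: (simple_measurable_comp mt).
by have := ae_affine (a := 1) a (oner_neq0 _) sg; apply: aeS => t; rewrite mul1r.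
Qed.

(** * The nonlinear Volterra equation and its flow *)

Section NonlinearVolterra.
Variables (R : realType) (X : completeNormedModType R) (W U : normedModType R).
Notation mu := (@lebesgue_measure R).
Variables (T : R -> X -> X) (K : R -> W -> X) (c : R) (F : X -> U -> W).
Hypothesis T_bound : forall tau, exists2 M, 0 <= M & forall t, 0 <= t <= tau -> bounded_linear M (T t).
Hypothesis T_id : forall x, T 0 x = x.
Hypothesis T_add : forall t s x, 0 <= t -> 0 <= s -> T (t + s) x = T t (T s x).
Hypothesis T_seq : forall (r : nat -> R) (y : nat -> X) (t : R) (x : X), (forall n, 0 <= r n) -> 0 <= t ->
  r n @[n --> \oo] --> t -> y n @[n --> \oo] --> x -> T (r n) (y n) @[n --> \oo] --> T t x.
Hypothesis T_cont : forall x, continuous (fun t : R => T `|t| x).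
Hypothesis c01 : 0 < c < 1.
Hypothesis K_bound : forall tau, exists2 k, 0 <= k &
  forall s, 0 < s <= tau -> bounded_linear (k * s `^ (- c)) (K s).
Hypothesis K_add : forall h s w, 0 <= h -> 0 < s -> T h (K s w) = K (s + h) w.
Hypothesis F_cont : forall x v e, 0 < e -> exists2 d, 0 < d &
  forall x' v', `|x' - x| < d -> `|v' - v| < d -> `|F x' v' - F x v| < e.
Hypothesis F_lip : forall r, 0 < r -> exists2 L, 0 < L & forall x x' v,
  `|x| < r -> `|x'| < r -> `|v| < r -> `|F x v - F x' v| <= L * `|x - x'|.
Hypothesis F_zero : forall r, exists2 N, 0 <= N & forall v, `|v| < r -> `|F 0 v| <= N.
Implicit Types (a b e h r s t tau : R) (y z : R -> X) (u v : R -> U).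

Let mcc a b : measurable (`[a, b]%classic : set (measurableTypeR R)).
Proof. exact: measurable_itv. Qed.

Definition path_continuous tau y := forall t, 0 <= t <= tau -> forall e, 0 < e ->
  exists2 d, 0 < d & forall s, 0 <= s <= tau -> `|s - t| < d -> `|y s - y t| <= e.

Lemma path_continuousP tau y : path_continuous tau y <-> {within `[0, tau], continuous y}.
Proof.
split=> [hy|/subspace_continuousP hy t tt e e0].
  apply/subspace_continuousP => t /=; rewrite in_itv/= => tt.
  apply/cvgrPdist_le => e e0; have [d d0 hd] := hy t tt e e0.
  rewrite near_withinE; exists d => //= s; rewrite /= distrC => sd; rewrite in_itv/= => ss.
  by rewrite distrC; exact: hd.
have := hy t; rewrite /= in_itv/= => /(_ tt)/cvgrPdist_le/(_ e e0)[d /= d0 hd].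
exists d => // s ss sd; rewrite distrC; by apply: hd => //=; rewrite distrC.
Qed.

Lemma path_bounded tau y : path_continuous tau y -> exists2 N, 0 < N &
  forall t, 0 <= t <= tau -> `|y t| < N.
Proof.
move=> /path_continuousP cy; have [t0|t0] := leP 0 tau; last first.
  by exists 1 => // t /andP[t1 t2]; have := le_lt_trans (le_trans t1 t2) t0; rewrite ltxx.
have cn : {within `[0, tau], continuous (fun t => `|y t|)}.
  by move=> t; apply: cvg_norm; exact: cy.
have [m _ hm] := EVT_max t0 cn.
exists (`|y m| + 1); first by rewrite ltr_wpDl.
by move=> t tt; rewrite (le_lt_trans (hm t _))// ?in_itv//= ltrDl.
Qed.

Lemma path_continuousW tau tau' y : tau' <= tau -> path_continuous tau y -> path_continuous tau' y.
Proof.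
move=> tt hy t /andP[t0 t1] e e0; have tt' : 0 <= t <= tau by rewrite t0 (le_trans t1).
have [d d0 hd] := hy t tt' e e0; exists d => // s /andP[s0 s1]; apply: hd.
by rewrite s0 (le_trans s1).
Qed.

Definition measurable_input r u := strongly_measurable `[0, +oo[ u /\
  {ae mu, forall s, 0 <= s -> `|u s| < r}.

Lemma forcing_measurable tau y u r : path_continuous tau y -> measurable_input r u ->
  strongly_measurable `[0, tau] (fun s => F (y s) (u s)).
Proof.
move=> cy [mu_ _].
have mu' : strongly_measurable `[0, tau] u.
  by apply: strongly_measurableS mu_ => s /=; rewrite !in_itv/= => /andP[->].
apply: (strongly_measurable_joint (k := fun s => F (y s)) _ mu').
  by move=> s /=; rewrite in_itv/= => /andP[].
apply: aeW => t /=; rewrite in_itv/= => tt q w hq qt wu.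
apply/cvgrPdist_lt => e e0; have [d d0 hd] := F_cont (y t) (u t) e0.
have d2 : 0 < d / 2 by rewrite divr_gt0.
have [d' d'0 hd'] := cy t tt _ d2.
near=> n; rewrite distrC; apply: hd.
  apply: (@le_lt_trans _ _ (d / 2)); last by rewrite ltr_pdivrMr// ltr_pMr// ltr1n.
  apply: hd'; first by case/andP: (hq n) => -> /le_trans; apply; case/andP: tt.
  by near: n; move/cvgrPdist_lt/(_ _ d'0) : qt; apply: filterS => n; rewrite distrC.
by near: n; move/cvgrPdist_lt/(_ _ d0) : wu; apply: filterS => n; rewrite distrC.
Unshelve. all: by end_near. Qed.

Lemma small_window C e : 0 <= C -> 0 < e -> exists2 h, 0 < h <= 1 &
  forall t, 0 <= t <= h -> C * (t `^ (1 - c) / (1 - c)) <= e.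
Proof.
move=> C0 e0; have /andP[c0 c1] := c01; have c10 : 0 < 1 - c by rewrite subr_gt0.
have C1 : 0 < C + 1 by rewrite ltr_wpDl.
pose q := e * (1 - c) / (C + 1); have q0 : 0 < q by rewrite divr_gt0// mulr_gt0.
exists (Num.min 1 (q `^ (1 - c)^-1)); first by rewrite lt_min ltr01 powR_gt0//= ge_min lexx.
move=> t /andP[t0]; rewrite le_min => /andP[_ tq].
have H : t `^ (1 - c) <= q.
  rewrite -[leRHS]powRr1 ?(ltW q0)// -[X in q `^ X](mulVf (lt0r_neq0 c10)) powRrM.
  by rewrite ge0_ler_powR ?nnegrE ?(ltW c10) ?powR_ge0.
rewrite mulrA ler_pdivrMr//.
apply: (@le_trans _ _ ((C + 1) * q)); last by rewrite /q mulrCA divff ?mulr1 ?gt_eqF.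
by rewrite ler_pM ?powR_ge0// lerDl.
Qed.

Lemma volterra_sub_le (g g' : R -> W) (y0 : X) tau y z k N t : volterra T K g y0 tau y ->
  volterra T K g' y0 tau z -> 0 <= t <= tau -> 0 <= k -> 0 <= N ->
  (forall s, 0 < s <= t -> bounded_linear (k * s `^ (- c)) (K s)) ->
  {ae mu, forall s, 0 <= s <= t -> `|g s - g' s| <= N} ->
  `|y t - z t| <= k * N * (t `^ (1 - c) / (1 - c)).
Proof.
move=> hy hz tt k0 N0 hk hg; have /andP[t0 _] := tt.
have H := is_bochnerB (mcc 0 t) (hy t tt) (hz t tt).
rewrite opprB addrA subrK in H.
have {}H : is_bochner `[0, t] (fun s => K (t - s) (g s - g' s)) (y t - z t).
  apply: is_bochner_ae H; apply: aeS (ae_neq t) => s st /=; rewrite in_itv/= => /andP[s0 s1].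
  have ts : 0 < t - s <= t by rewrite subr_gt0 lt_neqAle st s1 lerBlDr lerDl.
  by rewrite (bounded_linearB _ _ (hk _ ts)).
rewrite -lee_fin (le_trans (is_bochner_norm (mcc _ _) H))//.
have := @kernel_integral_le R X W K c c01 0 t k N (fun s => g s - g' s) (lexx _) t0 k0 N0 hk hg.
by rewrite subr0.
Qed.

Definition volterra_solution (y0 : X) u tau y :=
  path_continuous tau y /\ volterra T K (fun s => F (y s) (u s)) y0 tau y.
Notation sol := volterra_solution.

Lemma solution_restrict (y0 : X) u tau tau' y : tau' <= tau -> sol y0 u tau y -> sol y0 u tau' y.
Proof.
move=> tt [cy hy]; split; first exact: path_continuousW cy.
by move=> t /andP[t0 t1]; apply: hy; rewrite t0 (le_trans t1).
Qed.

Lemma solution_ext (y0 : X) u v tau y z : {ae mu, forall s, 0 <= s <= tau -> u s = v s} ->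
  (forall t, 0 <= t <= tau -> y t = z t) -> sol y0 u tau y -> sol y0 v tau z.
Proof.
move=> uv yz [cy hy]; split.
  move=> t tt e e0; have [d d0 hd] := cy t tt e e0; exists d => // s ss sd.
  by rewrite -!yz//; exact: hd.
move=> t tt; rewrite -yz//; apply: is_bochner_ae (hy t tt).
apply: aeS uv => s us /=; rewrite in_itv/= => /andP[s0 s1].
have ss : 0 <= s <= tau by rewrite s0 (le_trans s1); case/andP: tt.
by rewrite yz// us.
Qed.

Lemma solution_initial (y0 : X) u tau y : 0 <= tau -> sol y0 u tau y -> y 0 = y0.
Proof.
move=> t0 [_ hy]; have := hy 0; rewrite lexx t0 T_id => /(_ isT) H.
apply/eqP; rewrite -subr_eq0; apply/eqP; apply: (is_bochner_unique (mcc 0 0) H).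
by apply: is_bochner0 => //; rewrite set_itv1 lebesgue_measure_set1.
Qed.

Lemma solution_shift (y0 : X) u tau y a : 0 <= a -> a <= tau -> sol y0 u tau y ->
  sol (y a) (fun s => u (s + a)) (tau - a) (fun s => y (s + a)).
Proof.
move=> a0 at_ [cy hy]; split; last exact: (volterra_restart T_bound T_add K_add hy).
move=> t /andP[t0 t1] e e0; have tt : 0 <= t + a <= tau by rewrite addr_ge0//= -lerBrDr.
have [d d0 hd] := cy _ tt e e0; exists d => // s /andP[s0 s1] sd; apply: hd.
  by rewrite addr_ge0//= -lerBrDr.
by rewrite opprD addrACA subrr addr0.
Qed.

Lemma input_shift r u a : 0 <= a -> measurable_input r u -> measurable_input r (fun s => u (s + a)).
Proof.
move=> a0 [mu_ bu]; split.
  apply: strongly_measurableS (strongly_measurable_translate a mu_) => t /=.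
  by rewrite !in_itv/= !andbT => t0; rewrite addr_ge0.
have := ae_affine (a := 1) a (oner_neq0 _) bu; apply: aeS => t; rewrite mul1r.
by move=> h t0; apply: h; rewrite addr_ge0.
Qed.

Lemma forcing_le r (x : X) (v : U) L N : `|x| < r -> `|v| < r ->
  (forall (x x' : X) (v : U), `|x| < r -> `|x'| < r -> `|v| < r -> `|F x v - F x' v| <= L * `|x - x'|) ->
  0 <= L -> (forall v : U, `|v| < r -> `|F 0 v| <= N) -> `|F x v| <= L * r + N.
Proof.
move=> xr vr hL L0 hN; have r0 := le_lt_trans (normr_ge0 x) xr.
rewrite -(subrK (F 0 v) (F x v)) (le_trans (ler_normD _ _))// lerD ?hN//.
rewrite (le_trans (hL _ _ _ xr _ vr)) ?normr0// subr0 ler_wpM2l//; exact: ltW.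
Qed.

(** Local Lipschitz constants apply once both solutions are enclosed in a ball of radius q. On a
    window of length h the equation halves their distance, hence they agree there, and both are
    restarted at h. *)
Lemma solution_unique (y0 : X) r u tau y z : measurable_input r u ->
  sol y0 u tau y -> sol y0 u tau z -> forall t, 0 <= t <= tau -> y t = z t.
Proof.
move=> hu hy hz.
have [N1 N10 yN] := path_bounded hy.1; have [N2 N20 zN] := path_bounded hz.1.
pose q := Num.max r (Num.max N1 N2).
have rq : r <= q by rewrite le_max lexx.
have q0 : 0 < q by rewrite !lt_max N10 orbT.
have {}yN t : 0 <= t <= tau -> `|y t| < q by move/yN/lt_le_trans; apply; rewrite !le_max lexx orbT.
have {}zN t : 0 <= t <= tau -> `|z t| < q by move/zN/lt_le_trans; apply; rewrite !le_max lexx !orbT.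
have [L L0 hL] := F_lip q0; have [k k0 hk] := K_bound tau.
have kL : 0 <= k * L by rewrite mulr_ge0// ltW.
have e2 : 0 < 1 / 2 :> R by rewrite divr_gt0.
have [h /andP[h0 _] hh] := small_window kL e2.
(* Initial state, input and end time are generalised for the restart, whereas q and r stay fixed, so
   that the same window length h serves at every stage. *)
suff main n : forall (y0 : X) u tau' y z, tau' <= n%:R * h -> tau' <= tau -> measurable_input r u ->
    (forall t, 0 <= t <= tau' -> `|y t| < q) -> (forall t, 0 <= t <= tau' -> `|z t| < q) ->
    sol y0 u tau' y -> sol y0 u tau' z -> forall t, 0 <= t <= tau' -> y t = z t.
  apply: (main (Num.truncn (tau / h)).+1 y0 u tau) => //.
  by rewrite -ler_pdivrMr// ltW// truncnS_gt.
elim: n => [|n ih] {}y0 {}u tau' {}y {}z tn ttau {}hu {}yN {}zN {}hy {}hz t /andP[t0 tt].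
  have tau0 : tau' = 0 by apply/le_anti; rewrite (le_trans t0 tt) andbT; rewrite mul0r in tn.
  have -> : t = 0 by apply/le_anti; rewrite t0 -tau0 tt.
  by rewrite (solution_initial _ hy) ?(solution_initial _ hz)// tau0.
have local s : 0 <= s -> s <= tau' -> s <= h -> y s = z s.
  have est m : forall s, 0 <= s -> s <= tau' -> s <= h -> `|y s - z s| <= 2 * q / 2 ^+ m.
    elim: m => [|m ihm] {}s s0 st sh.
      have ss : 0 <= s <= tau' by rewrite s0.
      by rewrite expr0 divr1 mulr_natl mulr2n (le_trans (ler_normB _ _))// lerD// ltW ?yN ?zN.
    pose N := L * (2 * q / 2 ^+ m).
    have qm : 0 <= 2 * q / 2 ^+ m by rewrite divr_ge0 ?mulr_ge0 ?exprn_ge0// ltW.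
    have N0 : 0 <= N by rewrite mulr_ge0// ltW.
    have ss : 0 <= s <= tau' by rewrite s0.
    have := @volterra_sub_le _ _ y0 tau' y z k N s hy.2 hz.2 ss k0 N0.
    move=> /(_ _ _)/le_trans; apply.
    - by move=> p /andP[p0 p1]; apply: hk; rewrite p0 (le_trans p1)// (le_trans st).
    - apply: aeS hu.2 => p up /andP[p0 p1].
      have pp : 0 <= p <= tau' by rewrite p0 (le_trans p1).
      rewrite (le_trans (hL _ _ _ (yN _ pp) (zN _ pp) (lt_le_trans (up p0) rq)))//.
      by rewrite ler_wpM2l ?(ltW L0)// ihm// (le_trans p1).
    - have ssh : 0 <= s <= h by rewrite s0.
      have := hh s ssh; rewrite /N.
      have -> : k * (L * (2 * q / 2 ^+ m)) * (s `^ (1 - c) / (1 - c)) =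
         (k * L * (s `^ (1 - c) / (1 - c))) * (2 * q / 2 ^+ m) by ring.
      have -> : 2 * q / 2 ^+ m.+1 = 1 / 2 * (2 * q / 2 ^+ m).
        by rewrite exprS; field; rewrite expf_neq0.
      by move=> H; rewrite ler_wpM2r.
  move=> s0 st sh; apply/eqP; rewrite -subr_eq0 -normr_eq0; apply/eqP/le_anti.
  rewrite normr_ge0 andbT; apply/ler_addgt0Pl => e e0; rewrite addr0.
  have : 2 * q / 2 ^+ m @[m --> \oo] --> (0 : R).
    have z1 : `|2^-1 : R| < 1 by rewrite ger0_norm ?invr_ge0// invf_lt1// ltr1n.
    rewrite (_ : (fun m => _) = geometric (2 * q) 2^-1); first exact: cvg_geometric.
    by apply/funext => m; rewrite /geometric/= exprVn.
  move=> /cvgr0_norm_le/(_ _ e0)[m _ /(_ m (leqnn m))] /= hm.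
  by rewrite (le_trans (est m s s0 st sh))// (le_trans (ler_norm _)).
have [th|ht] := leP t h; first exact: local.
have ht' : h <= tau' by rewrite (le_trans (ltW ht)).
have hy' := solution_shift (ltW h0) ht' hy.
have hz' := solution_shift (ltW h0) ht' hz.
rewrite -(local h (ltW h0) ht' (lexx _)) in hz'.
have := ih _ _ (tau' - h) _ _ _ _ (input_shift (ltW h0) hu) _ _ hy' hz' (t - h).
rewrite subrK; apply.
- by rewrite lerBlDr (le_trans tn)// -natr1 mulrDl mul1r.
- by rewrite lerBlDr (le_trans ttau)// lerDl ltW.
- by move=> s /andP[s0 s1]; apply: yN; rewrite addr_ge0 ?(ltW h0)//= -lerBrDr.
- by move=> s /andP[s0 s1]; apply: zN; rewrite addr_ge0 ?(ltW h0)//= -lerBrDr.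
- by rewrite subr_ge0 (ltW ht)/= lerB.
Qed.

(** The time h depends on r alone, not on the particular state and input. This uniformity is what
    later excludes a finite life span without blow-up. *)
Lemma local_existence r : 0 < r -> exists2 h, 0 < h &
  forall (y0 : X) u, `|y0| <= r -> measurable_input r u -> exists y, sol y0 u h y.
Proof.
move=> r0; have [M M0 hM] := T_bound 1.
(* M r bounds the orbit of T on [0, 1] and the integral adds at most 1. The remaining room r + 1
   puts the inputs below q and leaves a strict inequality for the limit of the iterates. *)
pose q := M * r + r + 2.
have Mr : 0 <= M * r by rewrite mulr_ge0// ltW.
have q0 : 0 < q by rewrite /q; lra.
have [L L0 hL] := F_lip q0; have [N0 N00 hN0] := F_zero q; have [k k0 hk] := K_bound 1.
pose N := L * q + N0.
have N0' : 0 <= N by rewrite addr_ge0// mulr_ge0 // ltW.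
have e2 : 0 < 1 / 2 :> R by rewrite divr_gt0.
(* [h1] keeps the integral term below 1, so that iteration preserves the ball; [h2] makes it a
   contraction of factor 1 / 2. *)
have [h1 /andP[h10 h11] hh1] := small_window (mulr_ge0 k0 N0') (@ltr01 R).
have [h2 /andP[h20 h21] hh2] := small_window (mulr_ge0 k0 (ltW L0)) e2.
pose h := Num.min h1 h2.
have h0 : 0 < h by rewrite lt_min h10.
have hle1 t : t <= h -> t <= 1 by rewrite le_min => /andP[th1 _]; exact: le_trans th1 h11.
have hk' t s : t <= h -> 0 < s <= t -> bounded_linear (k * s `^ (- c)) (K s).
  by move=> th /andP[s0 st]; apply: hk; rewrite s0 (le_trans st)// hle1.
exists h => // y0 u y0r hu.
have uq s : `|u s| < r -> `|u s| < q by move/lt_trans; apply; rewrite /q; lra.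
pose I (y : R -> X) t := bochner `[0, t] (fun s => K (t - s) (F (y s) (u s))).
(* Picard iterates starting from the orbit of T; the absolute value makes the first one continuous
   on the whole line. *)
pose Y := fix Y n : R -> X := if n is m.+1 then fun t => T t y0 + I (Y m) t else fun t => T `|t| y0.
pose good y := path_continuous h y /\ forall t, 0 <= t <= h -> `|y t| < q.
have Ty t : 0 <= t <= h -> `|T t y0| <= M * r.
  move=> /andP[t0 th]; have tt : 0 <= t <= 1 by rewrite t0 hle1.
  by rewrite (le_trans ((hM _ tt).2 _))// ler_wpM2l.
have Fy y s : good y -> 0 <= s <= h -> `|u s| < r -> `|F (y s) (u s)| <= N.
  by move=> [_ yq] ss us; apply: (forcing_le (yq s ss) (uq s us) hL (ltW L0) hN0).
have Iy y : good y -> volterra T K (fun s => F (y s) (u s)) y0 h (fun t => T t y0 + I y t) /\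
    forall t, 0 <= t <= h -> `|I y t| <= 1.
  move=> gy.
  have bint t : 0 <= t <= h -> is_bochner `[0, t] (fun s => K (t - s) (F (y s) (u s))) (I y t) /\ `|I y t| <= 1.
    move=> /andP[t0 th].
    have le1 : (\int[mu]_(s in `[0%R, t]) (`|K (t - s) (F (y s) (u s))|)%:E <= 1%:E)%E.
      have := @kernel_integral_le R X W K c c01 0 t k N (fun s => F (y s) (u s)) (lexx _) t0 k0 N0'.
      move=> /(_ (fun s => @hk' t s th)) H; apply: le_trans (H _) _.
        apply: aeS hu.2 => s us /andP[s0 st]; apply: Fy => //; last exact: us.
        by rewrite s0 (le_trans st).
      by rewrite lee_fin subr0 hh1// t0 (le_trans th)// ge_min lexx.
    have H : is_bochner `[0, t] (fun s => K (t - s) (F (y s) (u s))) (I y t).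
      apply: bochnerE => //; split; last exact: (le_lt_trans le1 (ltry _)).
      apply: (kernel_measurable T_seq K_bound K_add (lexx _)).
      exact: (forcing_measurable (path_continuousW th gy.1) hu).
    by split => //; rewrite -lee_fin (le_trans (is_bochner_norm (mcc _ _) H)).
  split=> [t tt|t tt]; last by have [] := bint t tt.
  by rewrite addrAC subrr add0r; have [] := bint t tt.
have goodY n : good (Y n).
  elim: n => [|n gn].
    split=> [t tt e e0|t tt]; last first.
      have /andP[t0 _] := tt.
      rewrite /= ger0_norm// (le_lt_trans (Ty t tt))// /q; lra.
    have /cvgrPdist_le/(_ e e0)[d /= d0 hd] := @T_cont y0 t.
    by exists d => // s ss sd; rewrite distrC; apply: hd => /=; rewrite distrC.
  have [Vn In] := Iy _ gn; split.
    apply: (volterra_continuous T_bound T_add T_cont K_add Vn).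
    apply: (bounded_forcing_small c01 K_bound (N := N)) => //.
    by apply: aeS hu.2 => s us ss; apply: Fy => //; apply: us; case/andP: ss.
  move=> t tt; rewrite /= (le_lt_trans (ler_normD _ _))//.
  by rewrite (le_lt_trans (lerD (Ty t tt) (In t tt)))// /q; lra.
have VY n := (Iy _ (goodY n)).1.
have sub (y z : R -> X) (y' z' : R -> X) D t : good y -> good z -> 0 <= D -> 0 <= t <= h ->
    (forall s, 0 <= s <= t -> `|y s - z s| <= D) ->
    volterra T K (fun s => F (y s) (u s)) y0 h y' ->
    volterra T K (fun s => F (z s) (u s)) y0 h z' -> `|y' t - z' t| <= D / 2.
  move=> gy gz D0 tt yz hy' hz'; have /andP[t0 th] := tt.
  have LD : 0 <= L * D by rewrite mulr_ge0// ltW.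
  apply: le_trans (@volterra_sub_le _ _ y0 h y' z' k (L * D) t hy' hz' tt k0 LD (fun s => @hk' t s th) _) _.
    apply: aeS hu.2 => s us /andP[s0 st]; have ss : 0 <= s <= h by rewrite s0 (le_trans st).
    rewrite (le_trans (hL _ _ _ (gy.2 s ss) (gz.2 s ss) (uq s (us s0))))//.
    by rewrite ler_wpM2l ?(ltW L0)// yz// s0.
  have -> : k * (L * D) * (t `^ (1 - c) / (1 - c)) = k * L * (t `^ (1 - c) / (1 - c)) * D by ring.
  have -> : D / 2 = 1 / 2 * D by ring.
  by rewrite ler_wpM2r// hh2// t0 (le_trans th)// ge_min lexx orbT.
have dY n : forall t, 0 <= t <= h -> `|Y n.+1 t - Y n t| <= (2 ^+ n)^-1.
  elim: n => [|n ih] t tt.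
    have /andP[t0 _] := tt.
    rewrite expr0 invr1 /= ger0_norm// addrAC subrr add0r.
    by have [_] := Iy _ (goodY 0); apply.
  have -> : (2 ^+ n.+1 : R)^-1 = (2 ^+ n)^-1 / 2 by rewrite exprS invfM mulrC.
  have p0 : 0 <= (2 ^+ n)^-1 :> R by rewrite invr_ge0 exprn_ge0.
  apply: (sub _ _ _ _ _ _ (goodY n.+1) (goodY n) p0 tt _ (VY n.+1) (VY n)).
  move=> s /andP[s0 st]; apply: ih; rewrite s0 (le_trans st)//; by case/andP: tt.
have lim t : exists l, 0 <= t <= h -> forall n, `|l - Y n t| <= 2 / 2 ^+ n.
  have [tt|nt] := boolP (0 <= t <= h); last by exists 0.
  have [l hl] := geometric_cauchy (fun n => dY n t tt).
  by exists l.
have [y hy] := choice lim.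
have small e : 0 < e -> exists n, 2 / 2 ^+ n <= e.
  move=> e0; have z1 : `|2^-1 : R| < 1 by rewrite ger0_norm ?invr_ge0// invf_lt1// ltr1n.
  have /cvgr0_norm_le/(_ _ e0)[n _ /(_ n (leqnn n))] := @cvg_geometric R 2 _ z1.
  by rewrite /geometric /= exprVn => /(le_trans (ler_norm _)) H; exists n.
have yY e : 0 < e -> exists n, forall t, 0 <= t <= h -> `|y t - Y n t| <= e.
  by move=> /small[n hn]; exists n => t tt; rewrite (le_trans (hy t tt n)).
have gy : good y.
  split.
    move=> t tt e e0; have e3 : 0 < e / 3 by rewrite divr_gt0.
    have [n hn] := yY _ e3; have [d d0 hd] := (goodY n).1 t tt _ e3.
    exists d => // s ss sd.
    have -> : y s - y t = (y s - Y n s) + ((Y n s - Y n t) + (Y n t - y t)) by rewrite !subrKA.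
    have -> : e = e / 3 + (e / 3 + e / 3) by field.
    rewrite (le_trans (ler_normD _ _))// lerD ?hn// (le_trans (ler_normD _ _))// lerD ?hd//.
    by rewrite distrC hn.
  move=> t tt; have q2 : 0 < (r + 1) / 2 by lra.
  have [[|n] hn] := yY _ q2.
    rewrite -(subrK (Y 0 t) (y t)) (le_lt_trans (ler_normD _ _))//.
    have /andP[t0 _] := tt.
    have := Ty t tt; have := hn t tt; rewrite /= ger0_norm// => h1' h2'.
    by rewrite (le_lt_trans (lerD h1' h2'))// /q; lra.
  rewrite -(subrK (Y n.+1 t) (y t)) (le_lt_trans (ler_normD _ _))//.
  have [_ In] := Iy _ (goodY n).
  have : `|Y n.+1 t| <= M * r + 1 by rewrite /= (le_trans (ler_normD _ _))// lerD ?Ty ?In.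
  by move=> H; rewrite (le_lt_trans (lerD (hn t tt) H))// /q; lra.
have [Vy _] := Iy _ gy.
(* The limit is a fixed point: the integral map brings y and [Y n] closer by a factor 2, so its
   value at y and y itself are both close to [Y n.+1]. *)
have zy t : 0 <= t <= h -> T t y0 + I y t = y t.
  move=> tt; apply/eqP; rewrite -subr_eq0 -normr_eq0; apply/eqP/le_anti; rewrite normr_ge0 andbT.
  apply/ler_addgt0Pl => e e0; rewrite addr0.
  have [n hn] := small _ (divr_gt0 e0 (ltr0n R 2)).
  have qn : 0 <= 2 / 2 ^+ n :> R by rewrite divr_ge0 ?exprn_ge0.
  rewrite -(subrK (Y n.+1 t) (T t y0 + I y t)) -addrA (le_trans (ler_normD _ _))// (splitr e) lerD//.
    have := sub y (Y n) _ _ _ t gy (goodY n) qn tt _ Vy (VY n) => /(_ _)/le_trans; apply.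
      by move=> s /andP[s0 st]; apply: hy; rewrite s0 (le_trans st)//; case/andP: tt.
    by rewrite (le_trans _ hn)// ler_pdivrMr// ler_peMr// ler1n.
  rewrite distrC (le_trans (hy t tt n.+1))// (le_trans _ hn)//.
  by rewrite ler_wpM2l// lef_pV2 ?posrE ?exprn_gt0// ler_weXn2l// ler1n.
exists y; split; first exact: gy.1.
by move=> t tt; rewrite -{1}zy//; exact: Vy.
Qed.

(** Meant for glued functions: continuity across the junction follows from boundedness and the
    equation, since the forcing is then bounded. *)
Lemma volterra_regular (y0 : X) r u tau y N : measurable_input r u ->
  (forall t, 0 <= t <= tau -> `|y t| < N) ->
  volterra T K (fun s => F (y s) (u s)) y0 tau y -> sol y0 u tau y.
Proof.
move=> hu yN hy; split => //.
have [t0|t0] := leP 0 tau; last first.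
  by move=> t /andP[t1 t2]; have := le_lt_trans (le_trans t1 t2) t0; rewrite ltxx.
have N0 : 0 < N by apply: le_lt_trans (yN 0 _); rewrite ?lexx.
pose q := Num.max r N.
have q0 : 0 < q by rewrite lt_max N0 orbT.
have [L L0 hL] := F_lip q0; have [N' N0' hN'] := F_zero q.
apply: (volterra_continuous T_bound T_add T_cont K_add hy).
apply: (bounded_forcing_small c01 K_bound (N := L * q + N')).
  by rewrite addr_ge0// mulr_ge0// ltW.
apply: aeS hu.2 => s us ss; apply: (forcing_le _ _ hL (ltW L0) hN').
  by rewrite (lt_le_trans (yN s ss))// le_max lexx orbT.
by rewrite (lt_le_trans (us _))// ?le_max ?lexx//; case/andP: ss.
Qed.

Lemma solution_concat (y0 : X) r u a h y z : measurable_input r u -> 0 <= a -> 0 <= h ->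
  sol y0 u a y -> sol (y a) (fun s => u (s + a)) h z ->
  sol y0 u (a + h) (fun s => if s <= a then y s else z (s - a)).
Proof.
move=> hu a0 h0 hy hz.
have [N1 N10 yN] := path_bounded hy.1; have [N2 N20 zN] := path_bounded hz.1.
apply: (volterra_regular (N := Num.max N1 N2) hu).
  move=> t /andP[t0 th]; rewrite lt_max; have [ta|at_] := leP t a.
    by rewrite yN ?t0.
  by rewrite (zN (t - a)) ?orbT// subr_ge0 (ltW at_) lerBlDl.
apply: (volterra_concat T_bound T_add K_add a0 h0).
  move=> t tt; apply: is_bochner_ae (hy.2 t tt); apply: aeW => s /=; rewrite in_itv/= => /andP[_ st].
  by rewrite (le_trans st)//; case/andP: tt.
(* At s = 0 the glued function takes the value y a, not z 0; this single time is discarded. *)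
move=> t tt; apply: is_bochner_ae (hz.2 t tt); apply: aeS (ae_neq 0) => s s0 /=.
rewrite in_itv/= => /andP[s1 st].
by rewrite leNgt ltrDr lt_neqAle eq_sym s0 s1/= addrK.
Qed.

Definition admissible u := exists2 r, 0 < r & measurable_input r u.

Lemma admissible_shift u a : 0 <= a -> admissible u -> admissible (fun s => u (s + a)).
Proof. by move=> a0 [r r0 hu]; exists r => //; exact: input_shift. Qed.

Lemma measurable_inputW r r' u : r <= r' -> measurable_input r u -> measurable_input r' u.
Proof. by move=> rr [h1 h2]; split => //; apply: aeS h2 => s h /h/lt_le_trans; apply. Qed.

Definition solvable (y0 : X) u tau := 0 < tau /\ exists y, sol y0 u tau y.

Definition existence_time (y0 : X) u : \bar R := ereal_sup [set t%:E | t in solvable y0 u].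
Notation tmax := existence_time.

(** By uniqueness every solution reaching t gives the same value ([flowE]); the default 0 occurs
    only where no solution reaches t. *)
Definition flow (y0 : X) u t : X :=
  xget 0 [set x | exists tau y, [/\ 0 <= t <= tau, sol y0 u tau y & x = y t]].

Lemma flowE (y0 : X) u tau y t : admissible u -> sol y0 u tau y -> 0 <= t <= tau ->
  flow y0 u t = y t.
Proof.
move=> [r r0 hu] hy tt; rewrite /flow; case: xgetP => [_ -> [tau' [z [tt' hz ->]]]|]; last first.
  by move=> /(_ (y t)) []; exists tau, y.
have /andP[t0 t1] := tt; have /andP[_ t2] := tt'.
apply: (solution_unique (tau := t) hu); last by rewrite t0 lexx.
  exact: solution_restrict hz.
exact: solution_restrict hy.
Qed.

Lemma solvable_local (y0 : X) u : admissible u -> exists tau, solvable y0 u tau.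
Proof.
move=> [r r0 hu]; have q0 : 0 < Num.max r `|y0| by rewrite lt_max r0.
have [h h0 hh] := local_existence q0.
exists h; split => //; apply: hh; first by rewrite le_max lexx orbT.
by apply: measurable_inputW hu; rewrite le_max lexx.
Qed.

Lemma solvable_le_time (y0 : X) u tau : solvable y0 u tau -> (tau%:E <= tmax y0 u)%E.
Proof. by move=> h; apply: ereal_sup_ubound; exists tau. Qed.

Lemma existence_time_gt0 (y0 : X) u : admissible u -> (0 < tmax y0 u)%E.
Proof.
move=> hu; have [tau ht] := solvable_local y0 hu.
by apply: lt_le_trans (solvable_le_time ht); rewrite lte_fin; case: ht.
Qed.

Lemma solvable_extend (y0 : X) u tau y : admissible u -> 0 <= tau -> sol y0 u tau y ->
  exists2 h, 0 < h & solvable y0 u (tau + h).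
Proof.
move=> hu t0 hy; have [h [h0 [z hz]]] := solvable_local (y tau) (admissible_shift t0 hu).
exists h => //; split; first by rewrite ltr_wpDl.
have [r _ hu'] := hu; eexists; exact: (solution_concat hu' t0 (ltW h0) hy hz).
Qed.

(** Every solution can be continued a little, so the supremum is not attained and the existence
    interval is open on the right. *)
Lemma solvable_lt_time (y0 : X) u tau : admissible u -> solvable y0 u tau -> (tau%:E < tmax y0 u)%E.
Proof.
move=> hu [t0 [y hy]]; have [h h0 hs] := solvable_extend hu (ltW t0) hy.
by apply: lt_le_trans (solvable_le_time hs); rewrite lte_fin ltrDl.
Qed.

Lemma flow_solution (y0 : X) u tau : admissible u -> (tau%:E < tmax y0 u)%E ->
  sol y0 u tau (flow y0 u).
Proof.
move=> hu /ereal_sup_gt[_ [tau' [t0' [y hy]] <-]]; rewrite lte_fin => tt.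
have {}hy := solution_restrict (ltW tt) hy.
apply: (solution_ext _ _ hy); first exact: aeW.
by move=> t tt'; rewrite (flowE hu hy).
Qed.

Lemma flow_initial (y0 : X) u : admissible u -> flow y0 u 0 = y0.
Proof.
move=> hu; have hs := flow_solution hu (existence_time_gt0 y0 hu).
exact: solution_initial (lexx _) hs.
Qed.

Lemma flow_cocycle (y0 : X) u t h : admissible u -> 0 <= t -> 0 <= h ->
  ((t + h)%:E < tmax y0 u)%E ->
  (h%:E < tmax (flow y0 u t) (fun s => u (s + t)%R))%E /\
  flow (flow y0 u t) (fun s => u (s + t)) h = flow y0 u (t + h).
Proof.
move=> hu t0 h0 /ereal_sup_gt[_ [tau [tau0 [y hy]] <-]]; rewrite lte_fin => tt.
have ttau : t <= tau by rewrite (le_trans _ (ltW tt))// lerDl.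
have ft : flow y0 u t = y t by apply: (flowE hu hy); rewrite t0.
have hs := solution_shift t0 ttau hy.
have th : h < tau - t by rewrite ltrBrDl.
rewrite ft; split.
  apply: (@lt_le_trans _ _ (tau - t)%:E); first by rewrite lte_fin.
  by apply: solvable_le_time; split; [rewrite (le_lt_trans h0)|exists (fun s => y (s + t))].
rewrite (flowE (admissible_shift t0 hu) hs); last by rewrite h0 ltW.
by rewrite addrC (flowE hu hy)// addr_ge0//= ltW.
Qed.

(** A solution for u up to t is also one for v, and it can then be continued under v; hence the
    strict inequality for t. *)
Lemma flow_causal (y0 : X) u v t : admissible u -> admissible v -> 0 <= t ->
  {ae mu, forall s, 0 <= s <= t -> u s = v s} -> (t%:E < tmax y0 u)%E ->
  (t%:E < tmax y0 v)%E /\ flow y0 u t = flow y0 v t.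
Proof.
move=> hu hv t0 uv tu.
have hs : sol y0 v t (flow y0 u) by apply: solution_ext (flow_solution hu tu).
split; last by rewrite (flowE hv hs)// t0 lexx.
have [h h0 hs'] := solvable_extend hv t0 hs.
by apply: lt_le_trans (solvable_le_time hs'); rewrite lte_fin ltrDl.
Qed.

(** A state of norm at most N at a time closer to [tm] than the uniform existence time h could be
    continued past [tm]. As h serves all such times, the norm exceeds N throughout the last
    interval, which gives a limit and not merely an unbounded norm. *)
Lemma flow_blow_up (y0 : X) u tm N : admissible u -> tmax y0 u = tm%:E ->
  exists2 d, 0 < d & forall t, 0 <= t -> tm - d < t -> t < tm -> N < `|flow y0 u t|.
Proof.
move=> hu tmE; have [r r0 hu'] := hu.
have q0 : 0 < Num.max r N by rewrite lt_max r0.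
have [h h0 hh] := local_existence q0.
exists h => // t t0 th ttm; rewrite ltNge; apply/negP => Nt.
have ttm' : (t%:E < tmax y0 u)%E by rewrite tmE lte_fin.
have fr : `|flow y0 u t| <= Num.max r N by rewrite le_max Nt orbT.
have rq : r <= Num.max r N by rewrite le_max lexx.
have [z hz] := hh _ _ fr (measurable_inputW rq (input_shift t0 hu')).
have hc := solution_concat hu' t0 (ltW h0) (flow_solution hu ttm') hz.
have ths : solvable y0 u (t + h) by split; [rewrite ltr_wpDl|eexists; exact: hc].
have := solvable_le_time ths; rewrite tmE lee_fin leNgt => /negP; apply.
by rewrite -ltrBlDr.
Qed.

End NonlinearVolterra.

(** * The operators (omega I - A)^a T(t) as kernels *)

Section SmoothingKernel.
Variables (R : realType) (X : completeNormedModType R).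
Notation mu := (@lebesgue_measure R).
Variables (T : R -> X -> X) (omega : R).
Hypotheses (T_C0 : C0_semigroup T) (T_analytic : analytic T).
Hypothesis T_growth : (growth_bound T < omega%:E)%E.
Implicit Types (a b e h s t tau : R) (x y : X).

Lemma semigroup_bounded tau : exists2 M, 0 <= M &
  forall t, 0 <= t <= tau -> bounded_linear M (T t).
Proof.
have [w [M [_ M0 hM]]] := semigroup_growth T_C0 T_growth.
exists (M * expR (`|w| * `|tau|)); first by rewrite mulr_ge0 ?expR_ge0.
move=> t /andP[t0 tt]; have [h1 h2] := hM t t0; split => // x.
rewrite (le_trans (h2 x))// ler_wpM2r// ler_wpM2l// ler_expR.
by rewrite (le_trans (ler_norm _))// normrM ler_wpM2l// ger0_norm// (le_trans tt)// ler_norm.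
Qed.

Let T_rescaled t x : T t x = expR (omega * t) *: rescaled_semigroup T omega t x.
Proof. by rewrite /rescaled_semigroup scalerA -expRD subrr expR0 scale1r. Qed.

Lemma semigroup_sequential (r : nat -> R) (y : nat -> X) t x : (forall n, 0 <= r n) -> 0 <= t ->
  r n @[n --> \oo] --> t -> y n @[n --> \oo] --> x -> T (r n) (y n) @[n --> \oo] --> T t x.
Proof.
move=> r0 t0 rt yx; have [M [d [M0 d0 hl [h1 h2 h3]]]] := rescaled_semigroupP T_C0 T_growth.
rewrite T_rescaled; under eq_fun do rewrite T_rescaled.
apply: cvgZ; last exact: (semigroup_cvg M0 d0 hl h1 h2 h3).
apply: (@cvg_comp _ _ _ (fun n => omega * r n) (@expR R) _ (nbhs (omega * t))); first exact: cvgMr.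
exact: continuous_expR.
Qed.

Lemma semigroup_continuous x : continuous (fun t : R => T `|t| x).
Proof.
have [M [d [M0 d0 hl [h1 h2 h3]]]] := rescaled_semigroupP T_C0 T_growth.
move=> t; under eq_fun do rewrite T_rescaled.
apply: cvgZ; last exact: (semigroup_norm_continuous M0 d0 hl h1 h2 h3).
apply: (@cvg_comp _ _ _ (fun s : R => omega * `|s|) (@expR R) _ (nbhs (omega * `|t|))).
  by apply: cvgMr; exact: norm_continuous.
exact: continuous_expR.
Qed.

Notation C := (fracpow_neg T omega).

Definition smoothing a t x := fracpow T omega a (T t x).
Notation G := smoothing.

Lemma fracpow_neg_smoothing a t x : 0 < a < 1 -> 0 < t -> C a (G a t x) = T t x.
Proof. by move=> ha t0; apply: fracpowK; exact: Xpow_semigroup. Qed.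

Let half a : 0 < a < 1 -> 0 < a <= 1.
Proof. by move=> /andP[-> /ltW]. Qed.

(** Identities for [smoothing] are checked after applying this operator, which turns [smoothing]
    back into T. *)
Lemma fracpow_neg_injective a x y : 0 < a <= 1 -> C a x = C a y -> x = y.
Proof.
move=> ha E; have [k _ hk] := fracpow_neg_linear T_C0 T_growth ha.
apply/eqP; rewrite -subr_eq0; apply/eqP/(fracpow_neg_inj T_C0 T_growth ha).
by rewrite (bounded_linearB _ _ hk) E subrr.
Qed.

Lemma smoothing_bounded a tau : 0 < a < 1 -> exists2 k, 0 <= k &
  forall s, 0 < s <= tau -> bounded_linear (k * s `^ (- a)) (G a s).
Proof.
move=> ha; have [k k0 hk] := fracpow_semigroup_le T_C0 T_analytic T_growth ha.
have [c _ hc] := fracpow_neg_linear T_C0 T_growth (half ha).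
exists (k * expR (`|omega| * `|tau|)); first by rewrite mulr_ge0 ?expR_ge0.
move=> s /andP[s0 st]; split=> [b x y|x].
  apply: (fracpow_neg_injective (half ha)).
  rewrite (bounded_linearD _ _ hc) (bounded_linearZ _ _ hc) !fracpow_neg_smoothing//.
  have [M _ hM] := semigroup_bounded s.
  have lT : bounded_linear M (T s) by apply: hM; rewrite lexx ltW.
  by rewrite (bounded_linearD _ _ lT) (bounded_linearZ _ _ lT).
rewrite (le_trans (hk s x s0))// ler_wpM2r// ler_wpM2r ?powR_ge0// ler_wpM2l// ler_expR.
by rewrite (le_trans (ler_norm _))// normrM ler_wpM2l// gtr0_norm// (le_trans st)// ler_norm.
Qed.

Lemma smoothing_add a h s x : 0 < a < 1 -> 0 <= h -> 0 < s -> T h (G a s x) = G a (s + h) x.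
Proof.
move=> ha h0 s0; apply: (fracpow_neg_injective (half ha)).
rewrite -(fracpow_neg_comm T_C0 T_growth _ (half ha) h0) !fracpow_neg_smoothing ?ltr_wpDr//.
by have [_ _ Tadd _] := T_C0; rewrite addrC Tadd// ltW.
Qed.

(** Powers of order -a and a + b combine to order b, up to the factor of [fracpow_neg_law]. The
    comparison is made after one more power of order -b, which yields T t x on both sides. *)
Lemma fracpow_neg_smoothing_add a b : 0 < a -> 0 < b -> a + b < 1 ->
  exists2 c, c != 0 & forall t x, 0 < t -> C a (G (a + b) t x) = c *: G b t x.
Proof.
move=> a0 b0 ab1.
have ha : 0 < a <= 1 by rewrite a0 (le_trans _ (ltW ab1))// lerDl ltW.
have hb : 0 < b < 1 by rewrite b0 (le_lt_trans _ ab1)// lerDr ltW.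
have hab : 0 < a + b < 1 by rewrite addr_gt0.
have ba1 : b + a <= 1 by rewrite addrC ltW.
have [c c0 hc] := fracpow_neg_law T_C0 T_growth b0 a0 ba1.
have [k _ hk] := fracpow_neg_linear T_C0 T_growth (half hb).
exists c => // t x t0; apply: (fracpow_neg_injective (half hb)).
by rewrite hc [b + a]addrC (bounded_linearZ _ _ hk) !fracpow_neg_smoothing.
Qed.

End SmoothingKernel.

(** * Extension to completions, and forcing in L^p *)

Lemma isometric_extension (R : realType) (X Z Y : completeNormedModType R) (j : {linear X -> Y})
  (S : X -> Z) C : bounded_linear C S -> (forall x, `|j x| = `|S x|) -> dense (range j) ->
  exists2 J, bounded_linear 1 J & forall x, J (j x) = S x.
Proof.
move=> lS jS dj.
have approx v (e : R) : 0 < e -> exists x, `|j x - v| <= e.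
  move=> e0; have [|z [+ [x _ xz]]] := dj (ball v e) _ (ball_open v e).
    by exists v; exact: ballxx.
  by rewrite -xz -ball_normE /= distrC => /ltW; exists x.
(* The value at v is characterised by an inequality for all x rather than as the limit of one
   sequence; agreement with S, linearity and the norm bound are all read off from it. *)
have ex v : exists l, forall x, `|S x - l| <= `|j x - v|.
  have seq (n : nat) : exists x, `|j x - v| <= (2 ^+ n)^-1 / 2.
    by apply: approx; rewrite divr_gt0// invr_gt0 exprn_gt0.
  have [q hq] := choice seq.
  have p0 n : 0 <= (2 ^+ n)^-1 :> R by rewrite invr_ge0 exprn_ge0.
  have Sj x y : `|S x - S y| = `|j x - j y| by rewrite -(bounded_linearB _ _ lS) -jS linearB.
  have hS n : `|S (q n.+1) - S (q n)| <= (2 ^+ n)^-1.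
    rewrite Sj -(subrKA v) (le_trans (ler_normD _ _))// (splitr (2 ^+ n)^-1) lerD//; last by rewrite distrC.
    rewrite (le_trans (hq n.+1))// ler_wpM2r// lef_pV2 ?posrE ?exprn_gt0//.
    by rewrite ler_weXn2l// ler1n.
  have [l hl] := geometric_cauchy hS; exists l => x.
  apply/ler_addgt0Pr => e e0; have z1 : `|2^-1 : R| < 1 by rewrite ger0_norm ?invr_ge0// invf_lt1// ltr1n.
  have e3 : 0 < e / 3 by rewrite divr_gt0.
  have /cvgr0_norm_le/(_ _ e3)[n _ /(_ n (leqnn n))] := @cvg_geometric R 1 _ z1.
  rewrite /geometric /= mul1r exprVn ger0_norm// => he.
  have -> : S x - l = (S x - S (q n)) + (S (q n) - l) by rewrite subrKA.
  rewrite (le_trans (ler_normD _ _))// Sj distrC -(subrKA v).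
  have H1 := hq n; have H2 := hl n; rewrite distrC in H2.
  have H3 := ler_normD (j (q n) - v) (v - j x).
  rewrite [`|v - j x|]distrC in H3.
  have := p0 n; lra.
have [J hJ] := choice ex.
exists J; last first.
  move=> x; apply/eqP; rewrite eq_sym -subr_eq0 -normr_le0.
  by rewrite (le_trans (hJ _ x))// subrr normr0.
split=> [a v w|v].
  apply/eqP; rewrite -subr_eq0 -normr_eq0; apply/eqP/le_anti; rewrite normr_ge0 andbT.
  apply/ler_addgt0Pl => e e0; rewrite addr0.
  pose n := 2 * (`|a| + 1); have n0 : 0 < n by rewrite mulr_gt0// ltr_wpDl.
  have en : 0 < e / n by rewrite divr_gt0.
  have [x hx] := approx v _ en; have [y hy] := approx w _ en.
  have -> : J (a *: v + w) - (a *: J v + J w) =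
     (J (a *: v + w) - S (a *: x + y)) + (a *: (S x - J v) + (S y - J w)).
    by rewrite [X in _ = _ + (X + _)]scalerBr [X in _ = _ + X]addrACA -opprD -lS.1 subrKA.
  have H : `|j (a *: x + y) - (a *: v + w)| <= `|a| * (e / n) + e / n.
    rewrite linearD linearZ/= opprD addrACA -scalerBr (le_trans (ler_normD _ _))// lerD// normrZ.
    by rewrite ler_wpM2l.
  have H1 := le_trans (hJ _ (a *: x + y)) H; rewrite distrC in H1.
  have H2 : `|a *: (S x - J v) + (S y - J w)| <= `|a| * (e / n) + e / n.
    rewrite (le_trans (ler_normD _ _))// lerD ?(le_trans (hJ _ _))// normrZ ler_wpM2l//.
    by rewrite (le_trans (hJ _ _)).
  rewrite (le_trans (ler_normD _ _))// (le_trans (lerD H1 H2))//.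
  by rewrite le_eqVlt; apply/orP; left; apply/eqP; rewrite /n; field; rewrite gt_eqF// ltr_wpDl.
rewrite mul1r; apply/ler_addgt0Pr => e e0; have e2 : 0 < e / 2 by rewrite divr_gt0.
have [x hx] := approx v _ e2.
have H1 := le_trans (hJ v x) hx; rewrite distrC in H1.
rewrite -(subrK (S x) (J v)) (le_trans (ler_normD _ _))// -jS.
have := ler_normD (j x - v) v; rewrite subrK => H2.
by rewrite (splitr e); lra.
Qed.

Lemma dense_bounded_linear_eq (R : realType) (X : Type) (Y Z : normedModType R) (j : X -> Y)
  C C' (A B : Y -> Z) : dense (range j) -> bounded_linear C A -> bounded_linear C' B ->
  (forall x, A (j x) = B (j x)) -> A =1 B.
Proof.
move=> dj /bounded_linear_ge0 hA /bounded_linear_ge0 hB AB v.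
apply/eqP; rewrite -subr_eq0 -normr_eq0; apply/eqP/le_anti; rewrite normr_ge0 andbT.
apply/ler_addgt0Pl => e e0; rewrite addr0.
pose n := `|C| + `|C'| + 1; have n0 : 0 < n by rewrite ltr_wpDl// addr_ge0.
have en : 0 < e / n by rewrite divr_gt0.
have [|z [+ [x _ xz]]] := dj (ball v (e / n)) _ (ball_open v (e / n)).
  by exists v; exact: ballxx.
rewrite -xz -ball_normE /= => /ltW hx.
have -> : A v - B v = A (v - j x) - B (v - j x).
  by rewrite (bounded_linearB _ _ hA) (bounded_linearB _ _ hB) AB opprB addrA subrK.
rewrite (le_trans (ler_normB _ _))// (le_trans (lerD (hA.2 _) (hB.2 _)))// -mulrDl.
apply: (@le_trans _ _ (n * (e / n))); last by rewrite mulrC divfK// gt_eqF.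
by rewrite ler_pM ?addr_ge0// lerDl.
Qed.

Lemma fracpow_completion_bounded (R : realType) (X : completeNormedModType R) (Y : completeNormedModType R)
  (S : X -> X) C (j : {linear X -> Y}) : bounded_linear C S -> (forall x, `|j x| = `|S x|) ->
  bounded_linear C j.
Proof. by move=> [_ h] jS; split=> [a x y|x]; rewrite ?linearP ?jS. Qed.

(* Young's inequality balances the kernel against |g|^p; the weight l makes the second term small before b - a is chosen. *)
Lemma lp_forcing_le (R : realType) (X W : normedModType R) (K : R -> W -> X) (c k p q l a b tau : R)
  (g : R -> W) : 0 < c < 1 -> 1 < p -> p^-1 + q^-1 = 1 -> c * q < 1 -> 0 < q -> 0 <= k -> 0 < l ->
  0 <= a -> a <= b -> b <= tau ->
  (forall s, 0 < s <= tau -> bounded_linear (k * s `^ (- c)) (K s)) ->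
  strongly_measurable `[0, tau] g ->
  (\int[@lebesgue_measure R]_(s in `[a, b]) (`|K (b - s) (g s)|)%:E <=
    (k * (l `^ q / q) * ((b - a) `^ (1 - c * q) / (1 - c * q)))%:E +
    (k * (l `^ (- p) / p))%:E * \int[@lebesgue_measure R]_(s in `[0%R, tau]) (`|g s| `^ p)%:E)%E.
Proof.
move=> /andP[c0 c1] p1 pq cq q0 k0 l0 a0 ab bt hk mg.
have p0 : 0 < p by rewrite (lt_trans _ p1).
have cq01 : 0 < c * q < 1 by rewrite mulr_gt0.
have m0t : measurable (`[0, tau]%classic : set (measurableTypeR R)) by exact: measurable_itv.
have mab : measurable (`[a, b]%classic : set (measurableTypeR R)) by exact: measurable_itv.
have [h nh [gh _]] := nice_representative m0t mg.
set A := l `^ q / q; set B := l `^ (- p) / p.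
have A0 : 0 <= k * A by rewrite mulr_ge0 ?divr_ge0 ?powR_ge0// ltW.
have B0 : 0 <= k * B by rewrite mulr_ge0 ?divr_ge0 ?powR_ge0// ltW.
have mh : measurable_fun setT ((fun s => `|h s| `^ p) : measurableTypeR R -> R).
  exact: (measurableT_comp (measurable_powR p) (nice_norm nh)).
have mr : measurable_fun setT ((fun s => (b - s) `^ (- (c * q))) : measurableTypeR R -> R).
  by apply: (measurableT_comp (measurable_powR _)); exact: measurable_funB.
apply: (@le_trans _ _ (\int[@lebesgue_measure R]_(s in `[a, b])
   ((k * A)%:E * ((b - s) `^ (- (c * q)))%:E + (k * B)%:E * (`|h s| `^ p)%:E))%E).
  apply: ae_le_integral => //.
    by move=> s _; rewrite adde_ge0// mule_ge0// lee_fin powR_ge0.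
  apply: aeS2 (ae_neq b) gh => s sb gs /=; rewrite in_itv/= => /andP[s1 s2].
  have s0t : 0 <= s <= tau by rewrite (le_trans a0 s1) (le_trans s2 bt).
  have bs0 : 0 < b - s by rewrite subr_gt0 lt_neqAle sb s2.
  have bs : 0 < b - s <= tau by rewrite bs0 (le_trans _ bt)// lerBlDr lerDl (le_trans a0).
  rewrite -!EFinM -EFinD lee_fin -gs; last by rewrite /= in_itv.
  rewrite (le_trans ((hk _ bs).2 _))// -!mulrA -mulrDr ler_wpM2l//.
  have := conjugate_powR (a := l^-1 * `|g s|) (b := l * (b - s) `^ (- c)) _ _ p0 q0 pq.
  rewrite !mulr_ge0 ?invr_ge0 ?powR_ge0 ?(ltW l0)// => /(_ isT isT).
  have -> : l^-1 * `|g s| * (l * (b - s) `^ (- c)) = (b - s) `^ (- c) * `|g s|.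
    by field; rewrite gt_eqF.
  move/le_trans; apply; rewrite addrC !powRM ?invr_ge0 ?powR_ge0 ?(ltW l0)//.
  rewrite -powRrM -powR_inv1 ?(ltW l0)// -powRrM mulN1r mulNr.
  by rewrite /A /B (mulrC q^-1) (mulrC p^-1) !mulrA.
rewrite ge0_integralD//; last 4 first.
- by move=> s _; rewrite mule_ge0// lee_fin powR_ge0.
- by apply: measurable_funTS; apply/measurable_EFinP; apply: measurable_funM.
- by move=> s _; rewrite mule_ge0// lee_fin powR_ge0.
- by apply: measurable_funTS; apply/measurable_EFinP; apply: measurable_funM.
have mhE : measurable_fun (`[a, b]%classic : set (measurableTypeR R)) (fun s => (`|h s| `^ p)%:E).
  by apply/measurable_EFinP; exact: measurable_funTS.
have mrE : measurable_fun (`[a, b]%classic : set (measurableTypeR R)) (fun s => ((b - s) `^ (- (c * q)))%:E).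
  by apply/measurable_EFinP; exact: measurable_funTS.
rewrite (ge0_integralZl_EFin _ mab _ mrE A0); last by move=> s _; rewrite lee_fin powR_ge0.
rewrite (ge0_integralZl_EFin _ mab _ mhE B0); last by move=> s _; rewrite lee_fin powR_ge0.
apply: leeD.
  by rewrite [leRHS]EFinM lee_wpmul2l ?lee_fin// reflected_power_integral.
apply: lee_wpmul2l; first by rewrite lee_fin.
rewrite (@ae_eq_ge0_integral R `[0, tau] (fun s => (`|g s| `^ p)%:E) (fun s => (`|h s| `^ p)%:E)); last 3 first.
- by move=> s _; rewrite lee_fin powR_ge0.
- by move=> s _; rewrite lee_fin powR_ge0.
- by apply: aeS gh => s gs st; rewrite gs.
apply: ge0_subset_integral => //.
  by apply/measurable_EFinP; exact: measurable_funTS.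
by move=> s /=; rewrite !in_itv/= => /andP[s1 s2]; rewrite (le_trans a0 s1) (le_trans s2 bt).
Qed.

(** * Essentially bounded inputs *)

Section EssentiallyBounded.
Variables (R : realType) (U : normedModType R).
Notation mu := (@lebesgue_measure R).
Implicit Types (u v w : R -> U) (r : R).

Let muT : (0 < mu [set: measurableTypeR R])%E.
Proof.
have E : mu (`]-oo, +oo[%classic : set R) = +oo%E by rewrite lebesgue_measure_itv.
by rewrite set_itvNyy in E; rewrite [X in (_ < X)%E]E.
Qed.

Let ind_le (t a r : R) : (0 <= t -> a <= r) -> 0 <= r -> \1_(`[0, +oo[%classic : set R) t * a <= r.
Proof.
move=> ar r0; rewrite indicE mem_setE in_itv/= andbT; have [t0|_] := boolP (0 <= t).
  by rewrite mul1r ar.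
by rewrite mul0r.
Qed.

Lemma Linf_ess_ge0 u : (0 <= Linf_ess u)%E.
Proof.
apply: ess_sup_gee; first exact: muT.
by apply: aeW => t; rewrite lee_fin mulr_ge0// indicE.
Qed.

Lemma Linf_norm_ge0 u : 0 <= Linf_norm u.
Proof. by rewrite fine_ge0// Linf_ess_ge0. Qed.

Lemma Linf_norm_ae u : Linf u -> {ae mu, forall t, 0 <= t -> `|u t| <= Linf_norm u}.
Proof.
move=> [_ fin]; have := @ess_sup_ge _ _ _ mu (fun t => (\1_(`[0, +oo[%classic : set R) t * `|u t|)%:E).
apply: aeS => t + t0; rewrite -/(Linf_ess u) -lee_fin fineK; last by rewrite ge0_fin_numE// Linf_ess_ge0.
by rewrite indicE mem_setE in_itv/= t0 mul1r.
Qed.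

(** Membership and norm bound come together because both follow from one almost everywhere bound;
    closure under linear combinations, shifts and concatenation is then a matter of exhibiting that
    bound. *)
Lemma Linf_norm_le u r : 0 <= r -> strongly_measurable `[0, +oo[ u ->
  {ae mu, forall t, 0 <= t -> `|u t| <= r} -> Linf u /\ Linf_norm u <= r.
Proof.
move=> r0 mu_ ur; have H : (Linf_ess u <= r%:E)%E.
  by apply/ess_supP; apply: aeS ur => t h; rewrite lee_fin ind_le.
have fin : (Linf_ess u < +oo)%E := le_lt_trans H (ltry _).
by split=> //; rewrite -lee_fin fineK// ge0_fin_numE// Linf_ess_ge0.
Qed.

Lemma Linf_input u : Linf u -> exists2 r, 0 < r & measurable_input r u.
Proof.
move=> Lu; exists (Linf_norm u + 1); first by rewrite ltr_wpDl// Linf_norm_ge0.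
split; first exact: Lu.1.
by apply: aeS (Linf_norm_ae Lu) => t h /h/le_lt_trans; apply; rewrite ltrDl.
Qed.

Lemma Linf_norm_eq0 u v : Linf (u - v) -> Linf_norm (u - v) = 0 ->
  {ae mu, forall t, 0 <= t -> u t = v t}.
Proof.
move=> Luv E; apply: aeS (Linf_norm_ae Luv) => t h /h; rewrite E normr_le0.
by rewrite subr_eq0 => /eqP.
Qed.

Let mI := measurable_itv `[0, +oo[ : measurable (`[0, +oo[%classic : set (measurableTypeR R)).

Lemma Linf_lin (a : R) u v : Linf u -> Linf v ->
  Linf (a *: u + v) /\ Linf_norm (a *: u + v) <= `|a| * Linf_norm u + Linf_norm v.
Proof.
move=> Lu Lv; apply: Linf_norm_le.
- by rewrite addr_ge0 ?mulr_ge0 ?Linf_norm_ge0.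
- have [[s [hs su]] _] := Lu; have [[s' [hs' sv]] _] := Lv.
  exists (fun n t => a *: s n t + s' n t); split => [n|].
    exact: (simple_comp2 (fun x y => a *: x + y) (hs n) (hs' n)).
  apply: aeS2 su sv => t h1 h2 t0; apply: cvgD; last exact: h2.
  by apply: cvgZr; exact: h1.
- apply: aeS2 (Linf_norm_ae Lu) (Linf_norm_ae Lv) => t h1 h2 t0.
  by rewrite (le_trans (ler_normD _ _))// lerD ?h2// normrZ ler_wpM2l// h1.
Qed.

Lemma Linf_seminormed : seminormed_space (@Linf R U) (@Linf_norm R U).
Proof.
have L0 : Linf (0 : R -> U) /\ Linf_norm (0 : R -> U) <= 0.
  apply: Linf_norm_le => //; last by apply: aeW => t _; rewrite normr0.
  by exists (fun _ _ => 0); split => [n|]; [exact: simple_cst|apply: aeW => t _; exact: cvg_cst].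
have Zle a u : Linf u -> Linf (a *: u) /\ Linf_norm (a *: u) <= `|a| * Linf_norm u.
  move=> Lu; have [h1 h2] := Linf_lin a Lu L0.1; rewrite addr0 in h1 h2.
  by split => //; rewrite (le_trans h2)// gerDl L0.2.
split.
- exact: L0.1.
- by move=> a x y Lx Ly; have [] := Linf_lin a Lx Ly.
- by move=> x _; exact: Linf_norm_ge0.
- move=> a x Lx; apply/le_anti; rewrite (Zle a x Lx).2 /=.
  have [->|a0] := eqVneq a 0; first by rewrite normr0 mul0r Linf_norm_ge0.
  (* The reverse inequality is the first one for the scalar a^-1 and the function [a *: x]. *)
  have := (Zle a^-1 _ (Zle a x Lx).1).2.
  by rewrite scalerA mulVf// scale1r normfV mulrC ler_pdivlMr ?normr_gt0// mulrC.
- move=> x y Lx Ly; have := (Linf_lin 1 Lx Ly).2.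
  by rewrite scale1r normr1 mul1r.
Qed.

Lemma Linf_shift u (tau : R) : Linf u -> 0 <= tau ->
  Linf (shift_input tau u) /\ Linf_norm (shift_input tau u) <= Linf_norm u.
Proof.
move=> Lu tau0; apply: Linf_norm_le; first exact: Linf_norm_ge0.
  apply: strongly_measurableS (strongly_measurable_translate tau Lu.1) => t /=.
  by rewrite !in_itv/= !andbT => t0; rewrite addr_ge0.
have := ae_affine (a := 1) tau (oner_neq0 _) (Linf_norm_ae Lu); apply: aeS => t; rewrite mul1r.
by move=> h t0; apply: h; rewrite addr_ge0.
Qed.

Lemma Linf_concat u v (t : R) : Linf u -> Linf v -> 0 < t -> Linf (concat_input t u v).
Proof.
move=> Lu Lv t0; have [[s [hs su]] _] := Lu; have [s' [hs' sv]] := strongly_measurable_translate (- t) Lv.1.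
have mA : measurable (`]-oo, t]%classic : set (measurableTypeR R)) by exact: measurable_itv.
have r0 : 0 <= Linf_norm u + Linf_norm v by rewrite addr_ge0// Linf_norm_ge0.
suff [] : Linf (concat_input t u v) /\ Linf_norm (concat_input t u v) <= Linf_norm u + Linf_norm v by [].
apply: Linf_norm_le => //.
  (* The case distinction is made on the value of a simple indicator, so that the glued
     approximations are simple by [simple_comp2]. *)
  exists (fun n r => if (\1_(`]-oo, t]%classic : set R) r : R) == 1 then s n r else s' n r); split => [n|].
    exact: (simple_comp2 (fun (i : R^o) p => if i == 1 then p.1 else p.2) (simple_indic mA) (simple_pair (hs n) (hs' n))).
  apply: aeS2 su sv => r h1 h2 /=; rewrite in_itv/= andbT => r0'.
  rewrite /concat_input indicE mem_setE in_itv/=; have [rt|tr] := leP r t.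
    by rewrite eqxx; apply: h1; rewrite /= in_itv/= r0'.
  by rewrite eq_sym oner_eq0; apply: h2; rewrite /= in_itv/= subr_ge0 ltW.
have := ae_affine (a := 1) (- t) (oner_neq0 _) (Linf_norm_ae Lv).
apply: aeS2 (Linf_norm_ae Lu) => r h1 + r0'; rewrite mul1r => h2.
rewrite /concat_input; have [rt|tr] := leP r t.
  by rewrite (le_trans (h1 r0'))// lerDl Linf_norm_ge0.
by rewrite (le_trans (h2 _))// ?subr_ge0 ?(ltW tr)// lerDr Linf_norm_ge0.
Qed.

End EssentiallyBounded.

Lemma kernel_bochner_exists (R : realType) (X : completeNormedModType R) (W : normedModType R)
  (T : R -> X -> X) (K : R -> W -> X) (c k N t : R) (g : R -> W) :
  (forall (r : nat -> R) (y : nat -> X) (t : R) (x : X), (forall n, 0 <= r n) -> 0 <= t ->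
    r n @[n --> \oo] --> t -> y n @[n --> \oo] --> x -> T (r n) (y n) @[n --> \oo] --> T t x) ->
  0 < c < 1 ->
  (forall tau, exists2 k, 0 <= k & forall s, 0 < s <= tau -> bounded_linear (k * s `^ (- c)) (K s)) ->
  (forall h s w, 0 <= h -> 0 < s -> T h (K s w) = K (s + h) w) ->
  0 <= t -> 0 <= N -> strongly_measurable `[0, t] g ->
  {ae (@lebesgue_measure R), forall s, 0 <= s <= t -> `|g s| <= N} ->
  exists v, is_bochner `[0, t] (fun s => K (t - s) (g s)) v.
Proof.
move=> T_seq c01 K_bound K_add t0 N0 mg gN; have [k' k0 hk] := K_bound t.
have m0t : measurable (`[0, t]%classic : set (measurableTypeR R)) by exact: measurable_itv.
apply: bochner_exists => //; split; first exact: (kernel_measurable T_seq K_bound K_add (lexx _)).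
by apply: le_lt_trans (kernel_integral_le c01 (lexx _) t0 k0 N0 hk gN) (ltry _).
Qed.

(** The condition p > 1 / (1 - c) says that c q < 1 for the conjugate exponent q, so the kernel is
    in L^q locally. The weight l is chosen first, to make the L^p term at most e / 2, and then the
    length of the interval. *)
Lemma lp_forcing_small (R : realType) (X : completeNormedModType R) (W : normedModType R)
  (K : R -> W -> X) (c p tau : R) (g : R -> W) : 0 < c < 1 -> (1 - c)^-1 < p ->
  (forall tau, exists2 k, 0 <= k & forall s, 0 < s <= tau -> bounded_linear (k * s `^ (- c)) (K s)) ->
  strongly_measurable `[0, tau] g ->
  (\int[@lebesgue_measure R]_(s in `[0%R, tau]) (`|g s| `^ p)%:E < +oo)%E ->
  (forall a b, 0 <= a -> a <= b -> b <= tau ->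
    (\int[@lebesgue_measure R]_(s in `[a, b]) (`|K (b - s) (g s)|)%:E < +oo)%E) /\
  forall e, 0 < e -> exists2 d, 0 < d & forall a b, 0 <= a -> a <= b -> b <= tau -> b - a < d ->
    (\int[@lebesgue_measure R]_(s in `[a, b]) (`|K (b - s) (g s)|)%:E <= e%:E)%E.
Proof.
move=> c01 cp K_bound mg; set I := (\int[_]_(s in _) _)%E => Ifin.
have /andP[c0 c1] := c01; have c10 : 0 < 1 - c by rewrite subr_gt0.
have p1 : 1 < p by rewrite (lt_trans _ cp)// invf_gt1// ltrBlDr ltrDl.
have p0 : 0 < p by rewrite (lt_trans _ p1).
have ip : p^-1 < 1 - c by rewrite invf_plt// posrE.
pose q := (1 - p^-1)^-1.
have iq0 : 0 < 1 - p^-1 by rewrite subr_gt0 invf_lt1.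
have q0 : 0 < q by rewrite invr_gt0.
have pq : p^-1 + q^-1 = 1 by rewrite /q invrK subrKC.
have cq : c * q < 1 by rewrite /q ltr_pdivrMr// mul1r ltrBrDl -ltrBrDr.
have [k k0 hk] := K_bound tau.
have I0 : (0 <= I)%E by apply: integral_ge0 => s _; rewrite lee_fin powR_ge0.
have If : I = (fine I)%:E by rewrite fineK// ge0_fin_numE.
have If0 : 0 <= fine I by rewrite fine_ge0.
split=> [a b a0 ab bt|e e0].
  apply: le_lt_trans (lp_forcing_le c01 p1 pq cq q0 k0 ltr01 a0 ab bt hk mg) _.
  by rewrite -/I If -EFinM -EFinD ltry.
pose D := k * (fine I / p) + 1.
have D0 : 0 < D by rewrite ltr_wpDl// mulr_ge0// divr_ge0// ltW.
pose z := e / 2 / D; have z0 : 0 < z by rewrite !divr_gt0.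
(* This choice gives l^(-p) = z = e / (2 D), while D exceeds the coefficient of l^(-p) in the L^p
   term. *)
pose l := z `^ (- p^-1); have l0 : 0 < l by rewrite powR_gt0.
have lz : l `^ (- p) = z by rewrite /l -powRrM mulrNN mulVf ?gt_eqF// powRr1// ltW.
have cq01 : 0 < c * q < 1 by rewrite mulr_gt0.
have A0 : 0 <= k * (l `^ q / q) by rewrite mulr_ge0// divr_ge0 ?powR_ge0// ltW.
have e2 : 0 < e / 2 by rewrite divr_gt0.
have [d /andP[d0 _] hd] := small_window cq01 A0 e2.
exists d => // a b a0 ab bt abd.
apply: le_trans (lp_forcing_le c01 p1 pq cq q0 k0 l0 a0 ab bt hk mg) _.
rewrite -/I If -EFinM -EFinD lee_fin (splitr e) lerD//.
  by apply: hd; rewrite subr_ge0 ab ltW.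
rewrite lz; apply: (@le_trans _ _ (D * z)); last by rewrite /z mulrC divfK// gt_eqF.
have -> : k * (z / p) * fine I = k * (fine I / p) * z by ring.
by rewrite ler_wpM2r ?(ltW z0)// lerDl.
Qed.

(** * Mild solutions as solutions of a Volterra equation in X *)

Section MildSolutionBridge.
Variables (R : realType) (X U : completeNormedModType R) (Xm1 : normedModType R).
Notation mu := (@lebesgue_measure R).
Variables (T : R -> X -> X) (Tm1 : R -> Xm1 -> Xm1) (jm1 : X -> Xm1) (Bm : U -> Xm1).
Variables (K1 K2 : R -> X -> X) (a1 a2 : R) (Ca frac : X -> X) (Xa : set X).
Variables (f : X -> U -> X) (b : U -> X) (Cj Cc Cb : R).
Hypothesis T_bound : forall tau, exists2 M, 0 <= M & forall t, 0 <= t <= tau -> bounded_linear M (T t).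
Hypothesis T_id : forall x, T 0 x = x.
Hypothesis T_add : forall t s x, 0 <= t -> 0 <= s -> T (t + s) x = T t (T s x).
Hypothesis T_seq : forall (r : nat -> R) (y : nat -> X) (t : R) (x : X), (forall n, 0 <= r n) -> 0 <= t ->
  r n @[n --> \oo] --> t -> y n @[n --> \oo] --> x -> T (r n) (y n) @[n --> \oo] --> T t x.
Hypothesis T_cont : forall x, continuous (fun t : R => T `|t| x).
Hypotheses (a101 : 0 < a1 < 1) (a201 : 0 < a2 < 1).
Hypothesis K1_bound : forall tau, exists2 k, 0 <= k &
  forall s, 0 < s <= tau -> bounded_linear (k * s `^ (- a1)) (K1 s).
Hypothesis K2_bound : forall tau, exists2 k, 0 <= k &
  forall s, 0 < s <= tau -> bounded_linear (k * s `^ (- a2)) (K2 s).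
Hypothesis K1_add : forall h s w, 0 <= h -> 0 < s -> T h (K1 s w) = K1 (s + h) w.
Hypothesis K2_add : forall h s w, 0 <= h -> 0 < s -> T h (K2 s w) = K2 (s + h) w.
Hypotheses (Ca_lin : bounded_linear Cc Ca) (Ca_inj : injective Ca).
Hypothesis Ca_T : forall t x, 0 <= t -> T t (Ca x) = Ca (T t x).
Hypothesis fracK : forall x, Xa x -> Ca (frac x) = x.
Hypothesis Xa_Ca : forall x, Xa (Ca x).
Hypothesis Ca_K1 : forall t x, 0 < t -> Ca (K1 t x) = T t x.
Hypotheses (j_lin : bounded_linear Cj jm1) (j_inj : injective jm1).
Hypothesis b_lin : bounded_linear Cb b.
Hypothesis j_K2 : forall t v, 0 < t -> jm1 (Ca (K2 t (b v))) = Tm1 t (Bm v).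
Hypothesis f_cont : forall x v e, 0 < e -> exists2 d, 0 < d &
  forall x' v', `|x' - x| < d -> `|v' - v| < d -> `|f (Ca x') v' - f (Ca x) v| < e.
Hypothesis f_lip : forall r, 0 < r -> exists2 L, 0 < L & forall x x' v,
  `|x| < r -> `|x'| < r -> `|v| < r -> `|f (Ca x) v - f (Ca x') v| <= L * `|x - x'|.
Hypothesis f_zero : forall r, exists2 N, 0 <= N & forall v, `|v| < r -> `|f (Ca 0) v| <= N.
Hypothesis f_Lp : forall (u : R -> U) (x : R -> X), Linf u -> {within `[0, +oo[, continuous x} ->
  (forall s, 0 < s -> Xa (x s)) -> exists2 p, (1 - a1)^-1 < p & Lp_loc p (fun s => f (x s) (u s)).
Implicit Types (e h r s t tau : R) (x y : R -> X) (u : R -> U).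

Let mcc s t : measurable (`[s, t]%classic : set (measurableTypeR R)).
Proof. exact: measurable_itv. Qed.

(** The nonlinearity and the control pass through kernels with different singularities. On pairs
    they form one kernel with the worse exponent, to which the theory of a single Volterra equation
    applies. *)
Definition mild_kernel s (p : X * X) : X := K1 s p.1 + K2 s p.2.
Definition mild_forcing (y : X) (v : U) : X * X := (f (Ca y) v, b v).
Definition mild_exponent : R := Num.max a1 a2.
Notation K := mild_kernel.
Notation F := mild_forcing.
Notation c := mild_exponent.

Lemma mild_exponent01 : 0 < c < 1.
Proof.
by case/andP: a101 => h1 h2; case/andP: a201 => h3 h4; rewrite /c lt_max h1 gt_max h2.
Qed.

Let power_le a tau s : a <= c -> 0 < s <= tau -> s `^ (- a) <= tau `^ (c - a) * s `^ (- c).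
Proof.
move=> ac /andP[s0 st]; rewrite [X in s `^ X <= _](_ : - a = (c - a) + - c); last by ring.
rewrite powRD; last by rewrite (gt_eqF s0) implybT.
rewrite ler_wpM2r ?powR_ge0// ge0_ler_powR ?nnegrE ?subr_ge0 ?(ltW s0)//.
exact: le_trans (ltW s0) st.
Qed.

Lemma mild_kernel_bound tau : exists2 k, 0 <= k &
  forall s, 0 < s <= tau -> bounded_linear (k * s `^ (- c)) (K s).
Proof.
have [k1 k10 h1] := K1_bound tau; have [k2 k20 h2] := K2_bound tau.
exists (k1 * tau `^ (c - a1) + k2 * tau `^ (c - a2)).
  by rewrite addr_ge0// mulr_ge0// powR_ge0.
move=> s hs; split=> [a p q|p].
  rewrite /K /= (h1 s hs).1 (h2 s hs).1 scalerDr.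
  by rewrite addrACA.
have n1 : `|p.1| <= `|p| by rewrite prod_normE le_max lexx.
have n2 : `|p.2| <= `|p| by rewrite prod_normE le_max lexx orbT.
rewrite (le_trans (ler_normD _ _))// mulrDl mulrDl lerD//.
  rewrite (le_trans ((h1 s hs).2 _))// -!mulrA ler_wpM2l// mulrA.
  by rewrite ler_pM ?powR_ge0// power_le// le_max lexx.
rewrite (le_trans ((h2 s hs).2 _))// -!mulrA ler_wpM2l// mulrA.
by rewrite ler_pM ?powR_ge0// power_le// le_max lexx orbT.
Qed.

Lemma mild_kernel_add h s w : 0 <= h -> 0 < s -> T h (K s w) = K (s + h) w.
Proof.
move=> h0 s0; have [M _ hM] := T_bound h; have lT : bounded_linear M (T h) by apply: hM; rewrite h0 lexx.
by rewrite /K (bounded_linearD _ _ lT) K1_add// K2_add.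
Qed.

Lemma mild_forcing_continuous (x : X) (v : U) e : 0 < e -> exists2 d, 0 < d &
  forall (x' : X) (v' : U), `|x' - x| < d -> `|v' - v| < d -> `|F x' v' - F x v| < e.
Proof.
move=> e0; have [d d0 hd] := f_cont x v e0.
have lb := bounded_linear_ge0 b_lin.
have C1 : 0 < `|Cb| + 1 by rewrite ltr_wpDl.
exists (Num.min d (e / (`|Cb| + 1))); first by rewrite lt_min d0 divr_gt0.
move=> x' v'; rewrite !lt_min => /andP[x1 _] /andP[v1 v2].
rewrite prod_normE /= gt_max hd//= -(bounded_linearB _ _ b_lin) (le_lt_trans (lb.2 _))//.
apply: (@le_lt_trans _ _ ((`|Cb| + 1) * `|v' - v|)); first by rewrite ler_wpM2r// lerDl.
by rewrite mulrC -ltr_pdivlMr.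
Qed.

Lemma mild_forcing_lipschitz r : 0 < r -> exists2 L, 0 < L & forall (x x' : X) v,
  `|x| < r -> `|x'| < r -> `|v| < r -> `|F x v - F x' v| <= L * `|x - x'|.
Proof.
move=> r0; have [L L0 hL] := f_lip r0; exists L => // x x' v xr xr' vr.
by rewrite prod_normE /= subrr normr0 ge_max hL//= mulr_ge0// ltW.
Qed.

Lemma mild_forcing_zero r : exists2 N, 0 <= N & forall v, `|v| < r -> `|F 0 v| <= N.
Proof.
have [N N0 hN] := f_zero r; have lb := bounded_linear_ge0 b_lin.
exists (N + `|Cb| * `|r|); first by rewrite addr_ge0// mulr_ge0.
move=> v vr; rewrite prod_normE /= ge_max; apply/andP; split.
  by rewrite (le_trans (hN v vr))// lerDl mulr_ge0.
rewrite (le_trans (lb.2 v))// (@le_trans _ _ (`|Cb| * `|r|))// ?lerDr// ler_wpM2l//.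
by rewrite (le_trans (ltW vr))// ler_norm.
Qed.

Notation sol := (volterra_solution T K F).
Notation mild := (mild_solution Xa T jm1 Tm1 f Bm).

(** The dictionary between the two equations: [Ca] sends the integral of [K1] to that of T, and
    [jm1] after [Ca] sends the integral of [K2] to that of [Tm1]. The end point s = t, where the
    kernels are singular, is negligible. *)
Let mild_parts t (g : R -> X) u (v1 v2 : X) : 0 <= t ->
  is_bochner `[0, t] (fun s => K1 (t - s) (g s)) v1 ->
  is_bochner `[0, t] (fun s => K2 (t - s) (b (u s))) v2 ->
  [/\ is_bochner `[0, t] (fun s => T (t - s) (g s)) (Ca v1),
      is_bochner `[0, t] (fun s => Tm1 (t - s) (Bm (u s))) (jm1 (Ca v2)) &
      is_bochner `[0, t] (fun s => K (t - s) (g s, b (u s))) (v1 + v2)].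
Proof.
move=> t0 h1 h2; split; last exact: (is_bochnerD (mcc _ _) h1 h2).
  apply: is_bochner_ae (is_bochner_linear (mcc _ _) h1 Ca_lin).
  apply: aeS (ae_neq t) => s st /=; rewrite in_itv/= => /andP[_ s1].
  by rewrite Ca_K1// subr_gt0 lt_neqAle st.
apply: is_bochner_ae (is_bochner_linear (mcc _ _) (is_bochner_linear (mcc _ _) h2 Ca_lin) j_lin).
apply: aeS (ae_neq t) => s st /=; rewrite in_itv/= => /andP[_ s1].
by rewrite j_K2// subr_gt0 lt_neqAle st.
Qed.

Let input_forcing_measurable u r tau : measurable_input r u ->
  strongly_measurable `[0, tau] (fun s => b (u s)).
Proof.
move=> [[s [hs su]] _]; exists (fun n t => b (s n t)); split => [n|].
  exact: (simple_comp b (hs n)).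
apply: aeS su => t h /=; rewrite in_itv/= => /andP[t0 _].
apply: (@cvg_comp _ _ _ _ b _ (nbhs (u t))); last exact: (bounded_linear_continuous b_lin).
by apply: h; rewrite /= in_itv/= t0.
Qed.

Let input_forcing_le u r tau : measurable_input r u ->
  {ae mu, forall s, 0 <= s <= tau -> `|b (u s)| <= `|Cb| * `|r|}.
Proof.
move=> [_ hu]; apply: aeS hu => s us /andP[s0 _].
rewrite (le_trans ((bounded_linear_ge0 b_lin).2 _))// ler_wpM2l//.
by rewrite (le_trans (ltW (us s0)))// ler_norm.
Qed.

Lemma volterra_solution_mild (y0 : X) r u tau y : measurable_input r u ->
  sol y0 u tau y -> mild (Ca y0) u tau (Ca \o y).
Proof.
move=> hu [cy hy]; split=> [|s _|t tt].
- have /path_continuousP cy' := cy.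
  move=> t; apply: (@cvg_comp _ _ _ _ Ca _ (nbhs (y t))); first exact: cy'.
  exact: (bounded_linear_continuous Ca_lin).
- exact: Xa_Ca.
have /andP[t0 t1] := tt.
have [N N0 yN] := path_bounded cy.
have q0 : 0 < Num.max r N by rewrite lt_max N0 orbT.
have [L L0 hL] := f_lip q0; have [N' N'0 hN'] := f_zero (Num.max r N).
have [v1 h1] : exists v, is_bochner `[0, t] (fun s => K1 (t - s) (f (Ca (y s)) (u s))) v.
  apply: (kernel_bochner_exists (N := L * Num.max r N + N') 0 T_seq a101 K1_bound K1_add t0).
  - by rewrite addr_ge0// mulr_ge0// ltW.
  - exact: (forcing_measurable (F := fun z => f (Ca z)) f_cont (path_continuousW t1 cy) hu).
  - apply: aeS hu.2 => s us /andP[s0 st].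
    apply: (forcing_le (F := fun z => f (Ca z)) _ _ hL (ltW L0) hN').
      by rewrite (lt_le_trans (yN s _)) ?s0 ?(le_trans st)// le_max lexx orbT.
    by rewrite (lt_le_trans (us s0))// le_max lexx.
have [v2 h2] : exists v, is_bochner `[0, t] (fun s => K2 (t - s) (b (u s))) v.
  apply: (kernel_bochner_exists (N := `|Cb| * `|r|) 0 T_seq a201 K2_bound K2_add t0).
  - by rewrite mulr_ge0.
  - exact: input_forcing_measurable hu.
  - exact: input_forcing_le.
have [p1 p2 p3] := mild_parts t0 h1 h2.
exists (Ca v1), (jm1 (Ca v2)); split => //=.
rewrite -(bounded_linearD _ _ j_lin) Ca_T// -!(bounded_linearD _ _ Ca_lin).
by rewrite -addrA -(is_bochner_unique (mcc _ _) (hy t tt) p3) subrKC.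
Qed.

(** The integrability hypothesis [f_Lp] concerns paths on all of R_+; a path on [0, tau] is
    therefore frozen after tau. *)
Let clip_continuous x tau : 0 <= tau -> path_continuous tau x ->
  {within `[0, +oo[, continuous (fun s => x (Num.min s tau))}.
Proof.
move=> tau0 cx; apply/subspace_continuousP => t /=; rewrite in_itv/= andbT => t0.
apply/cvgrPdist_le => e e0.
have mt s : 0 <= s -> 0 <= Num.min s tau <= tau by move=> s0; rewrite le_min s0 tau0 ge_min lexx orbT.
have [d d0 hd] := cx _ (mt t t0) e e0.
rewrite near_withinE; exists d => //= s ts; rewrite in_itv/= andbT => s0.
rewrite distrC; apply: hd; first exact: mt.
apply: le_lt_trans ts; rewrite distrC.
have [s1|s1] := leP s tau; have [t1|t1] := leP t tau => //.
- by have st := le_trans s1 (ltW t1); rewrite !ger0_norm ?subr_ge0// lerB// ltW.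
- have ts' := le_trans t1 (ltW s1); rewrite distrC [leRHS]distrC !ger0_norm ?subr_ge0//.
  by rewrite lerB// ltW.
- by rewrite subrr normr0.
Qed.

(** As x is continuous in X only, [f (x s) (u s)] might be unbounded near 0, and [f_Lp] supplies its
    integrability. The integrals then exist in X before [Ca] is applied, injectivity of [jm1] and
    [Ca] cancels these maps from the equation, and the L^p estimate gives the continuity of
    [frac \o x]. *)
Lemma mild_volterra_solution (y0 : X) r u tau x : Linf u -> measurable_input r u -> 0 < tau ->
  mild (Ca y0) u tau x ->
  sol y0 u tau (frac \o x) /\ forall t, 0 <= t <= tau -> Ca (frac (x t)) = x t.
Proof.
move=> Lu hu tau0 [cx hX hx].
(* At time 0 the definition of mild solutions does not put x in [Xa]; the equation on the null
   interval [0, 0] does. *)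
have x0 : x 0 = Ca y0.
  have tt : 0 <= (0 : R) <= tau by rewrite lexx ltW.
  have [v [w [hv hw E]]] := hx 0 tt.
  have m00 : mu (`[0, 0]%classic : set R) = 0%E by rewrite set_itv1 lebesgue_measure_set1.
  have v0 : v = 0 by apply: (is_bochner_unique (mcc 0 0) hv); exact: is_bochner0.
  have w0 : w = 0 by apply: (is_bochner_unique (mcc 0 0) hw); exact: is_bochner0.
  by apply: j_inj; rewrite E v0 w0 !addr0 T_id.
have xC t : 0 <= t <= tau -> Ca (frac (x t)) = x t.
  move=> /andP[]; rewrite le_eqVlt => /predU1P[<- _|t0 t1].
    by rewrite x0 fracK.
  by apply: fracK; apply: hX; rewrite t0.
split => //; have /path_continuousP {}cx := cx.
pose g s := f (x s) (u s).
have [|p cp hp] := f_Lp Lu (clip_continuous (ltW tau0) cx).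
  by move=> s s0; apply: hX; rewrite lt_min s0 tau0 ge_min lexx orbT.
have {hp}[mg ig] := hp tau (ltW tau0).
have ge : {ae mu, forall s, (`[0, tau]%classic : set R) s -> f (x (Num.min s tau)) (u s) = g s}.
  by apply: aeW => s /=; rewrite in_itv/= => /andP[_ st]; rewrite /g; congr (f (x _) _); apply/min_idPl.
have {}mg : strongly_measurable `[0, tau] g := strongly_measurable_ae ge mg.
have {}ig : (\int[mu]_(s in `[0%R, tau]) (`|g s| `^ p)%:E < +oo)%E.
  apply: le_lt_trans ig; apply: ae_le_integral.
  - by move=> s _; rewrite lee_fin powR_ge0.
  - by move=> s _; rewrite lee_fin powR_ge0.
  - by apply: aeS ge => s gs st; rewrite gs.
have [fin small] := lp_forcing_small a101 cp K1_bound mg ig.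
have ex1 t : 0 <= t <= tau -> exists v, is_bochner `[0, t] (fun s => K1 (t - s) (g s)) v.
  move=> /andP[t0 t1]; apply: bochner_exists => //; split; last exact: fin.
  apply: (kernel_measurable T_seq K1_bound K1_add (lexx _)).
  by apply: strongly_measurableS mg => s /=; rewrite !in_itv/= => /andP[-> /le_trans]; apply.
have ex2 t : 0 <= t <= tau -> exists v, is_bochner `[0, t] (fun s => K2 (t - s) (b (u s))) v.
  move=> /andP[t0 t1].
  apply: (kernel_bochner_exists (N := `|Cb| * `|r|) 0 T_seq a201 K2_bound K2_add t0).
  - by rewrite mulr_ge0.
  - exact: input_forcing_measurable hu.
  - exact: input_forcing_le.
have [v1 h1] : exists v1 : R -> X, forall t, 0 <= t <= tau -> is_bochner `[0, t] (fun s => K1 (t - s) (g s)) (v1 t).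
  exists (fun t => bochner `[0, t] (fun s => K1 (t - s) (g s))) => t tt.
  by have [v hv] := ex1 t tt; rewrite (bochner_eq (mcc _ _) hv).
have [v2 h2] : exists v2 : R -> X, forall t, 0 <= t <= tau -> is_bochner `[0, t] (fun s => K2 (t - s) (b (u s))) (v2 t).
  exists (fun t => bochner `[0, t] (fun s => K2 (t - s) (b (u s)))) => t tt.
  by have [v hv] := ex2 t tt; rewrite (bochner_eq (mcc _ _) hv).
have yE t : 0 <= t <= tau -> frac (x t) = T t y0 + v1 t + v2 t.
  move=> tt; have /andP[t0 _] := tt; apply: Ca_inj; rewrite xC//; apply: j_inj.
  have [p1 p2 _] := mild_parts t0 (h1 t tt) (h2 t tt).
  have [v [w [hv hw ->]]] := hx t tt.
  rewrite (is_bochner_unique (mcc _ _) hv p1) (is_bochner_unique (mcc _ _) hw p2).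
  by rewrite -(bounded_linearD _ _ j_lin) Ca_T// -!(bounded_linearD _ _ Ca_lin).
(* Continuity is shown for the two parts separately: the forcing of [K1] is in L^p, that of [K2] is
   bounded. *)
have V1 : volterra T K1 g y0 tau (fun t => T t y0 + v1 t).
  by move=> t tt; rewrite addrAC subrr add0r; exact: h1.
have V2 : volterra T K2 (fun s => b (u s)) 0 tau (fun t => T t 0 + v2 t).
  by move=> t tt; rewrite addrAC subrr add0r; exact: h2.
have C1 := volterra_continuous T_bound T_add T_cont K1_add V1 small.
have C2 := volterra_continuous T_bound T_add T_cont K2_add V2
  (bounded_forcing_small a201 K2_bound (mulr_ge0 (normr_ge0 Cb) (normr_ge0 r)) (input_forcing_le tau hu)).
have T0 t : 0 <= t -> T t 0 = 0.
  move=> t0; have [M _ hM] := T_bound t; have lT : bounded_linear M (T t) by apply: hM; rewrite t0 lexx.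
  exact: bounded_linear0 lT.
split.
  move=> t tt e e0; have e2 : 0 < e / 2 by rewrite divr_gt0.
  have [d1 d10 hd1] := C1 t tt _ e2; have [d2 d20 hd2] := C2 t tt _ e2.
  exists (Num.min d1 d2); first by rewrite lt_min d10.
  move=> s ss; rewrite lt_min => /andP[s1 s2] /=; rewrite !yE//.
  have := hd1 s ss s1; have := hd2 s ss s2.
  have /andP[s0 _] := ss; have /andP[t0 _] := tt.
  rewrite (T0 s s0) (T0 t t0) !add0r => H2 H1.
  have -> : T s y0 + v1 s + v2 s - (T t y0 + v1 t + v2 t) =
      (T s y0 + v1 s - (T t y0 + v1 t)) + (v2 s - v2 t) by rewrite opprD addrACA.
  by rewrite (le_trans (ler_normD _ _))// (splitr e) lerD.
move=> t tt; have /andP[t0 t1] := tt; rewrite /= yE// -(addrA (T t y0)) addrAC subrr add0r.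
have [_ _] := mild_parts t0 (h1 t tt) (h2 t tt).
apply: is_bochner_ae; apply: aeW => s /=; rewrite in_itv/= => /andP[s0 st].
by rewrite /F xC// s0 (le_trans st).
Qed.

Hypothesis frac_Ca : forall x : X, frac (Ca x) = x.

Let c01 : 0 < c < 1. Proof. exact: mild_exponent01. Qed.
Let K_bound := mild_kernel_bound.
Let K_add := mild_kernel_add.
Let F_cont := mild_forcing_continuous.
Let F_lip := mild_forcing_lipschitz.
Let F_zero := mild_forcing_zero.

Let tmax (x : X) u := existence_time T K F (frac x) u.
Let yflow (x : X) u t := flow T K F (frac x) u t.
Let phi t (x : X) u := Ca (yflow x u t).
Notation mild_on := (mild_solution_on Xa T jm1 Tm1 f Bm).
Notation maximal := (maximal_mild_solution Xa T jm1 Tm1 f Bm).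

Let adm u : Linf u -> admissible u. Proof. exact: Linf_input. Qed.

Let flow_mild (x : X) u tau : Xa x -> Linf u -> (tau%:E < tmax x u)%E ->
  mild x u tau (fun t => phi t x u).
Proof.
move=> hx Lu tt; have [r _ hu] := Linf_input Lu; rewrite -{1}(fracK hx).
exact: (volterra_solution_mild hu (flow_solution T_bound T_id T_add c01 K_bound K_add F_lip (adm Lu) tt)).
Qed.

Let mild_flow (x : X) u tau z : Xa x -> Linf u -> 0 < tau -> mild x u tau z ->
  (tau%:E < tmax x u)%E /\ forall t, 0 <= t <= tau -> z t = phi t x u.
Proof.
move=> hx Lu t0; have [r _ hu] := Linf_input Lu; rewrite -{1}(fracK hx) => hz.
have [hs hE] := mild_volterra_solution Lu hu t0 hz.
split=> [|t tt].
  apply: (solvable_lt_time T_bound T_add T_seq T_cont c01 K_bound K_add F_cont F_lip F_zero (adm Lu)).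
  by split => //; exists (frac \o z).
rewrite /phi /yflow (flowE T_bound T_id T_add c01 K_bound K_add F_lip (adm Lu) hs tt).
by rewrite /= hE.
Qed.

Let tmax_gt0 (x : X) u : Linf u -> (0 < tmax x u)%E.
Proof.
by move=> Lu; exact: (existence_time_gt0 T_bound T_add T_seq T_cont c01 K_bound K_add F_cont F_lip F_zero _ (adm Lu)).
Qed.

Let time_interval_ge0 J t : time_interval J -> J t -> 0 <= t.
Proof. by case=> [[tau _ ->]|[t1 _ ->]] /=; [rewrite in_itv/= => /andP[]|case]. Qed.

Let time_interval_pos J : time_interval J -> exists2 tau : R, 0 < tau & J tau.
Proof.
case=> [[tau t0 ->]|[[t1||] // t10 ->]].
- by exists tau => //=; rewrite in_itv/= lexx (ltW t0).
- rewrite lte_fin in t10; exists (t1 / 2); first by rewrite divr_gt0.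
  by split; [rewrite divr_ge0// ltW|rewrite lte_fin ltr_pdivrMr// ltr_pMr// ltr1n].
- by exists 1 => //; split => //; exact: ltry.
Qed.

(** Every mild solution on any interval is a restriction of the flow, so existence and uniqueness of
    the maximal one follow at once. Time 0 is reached through some positive time of J, since
    [mild_solution_on] speaks of positive times. *)
Let mild_on_sub (x : X) u J z : Xa x -> Linf u -> mild_on x u J z ->
  J `<=` Ico0 (tmax x u) /\ forall t, J t -> z t = phi t x u.
Proof.
move=> hx Lu [hJ hz].
have pos t : 0 < t -> J t -> (t%:E < tmax x u)%E /\ forall s, 0 <= s <= t -> z s = phi s x u.
  by move=> t0 Jt; apply: mild_flow => //; exact: hz.
split=> t Jt; have := time_interval_ge0 hJ Jt; rewrite le_eqVlt => /predU1P[t0|t0].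
- by rewrite -t0; split => //; exact: tmax_gt0.
- by split; [exact: ltW|exact: (pos t t0 Jt).1].
- have [tau tau0 Jtau] := time_interval_pos hJ.
  by rewrite -t0; apply: (pos tau tau0 Jtau).2; rewrite lexx ltW.
- by apply: (pos t t0 Jt).2; rewrite (ltW t0) lexx.
Qed.

Let flow_mild_on (x : X) u : Xa x -> Linf u -> mild_on x u (Ico0 (tmax x u)) (fun t => phi t x u).
Proof.
move=> hx Lu; split; first by right; exists (tmax x u) => //; exact: tmax_gt0.
by move=> tau t0 [_ tt]; exact: flow_mild.
Qed.

Let flow_maximal (x : X) u : Xa x -> Linf u -> maximal x u (Ico0 (tmax x u)) (fun t => phi t x u).
Proof.
move=> hx Lu; split; first exact: flow_mild_on.
move=> J z hz IJ _; apply/seteqP; split => //.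
by have [] := mild_on_sub hx Lu hz.
Qed.

Let maximal_flow (x : X) u J z : Xa x -> Linf u -> maximal x u J z ->
  J = Ico0 (tmax x u) /\ forall t, J t -> z t = phi t x u.
Proof.
move=> hx Lu [hz hmax]; have [JI hE] := mild_on_sub hx Lu hz; split => //.
by apply/esym; apply: hmax (flow_mild_on hx Lu) JI _ => t Jt; rewrite hE.
Qed.

Let Xa_normed : normed_space Xa (fun x : X => `|frac x|).
Proof.
have Ca0 : Ca 0 = 0 by exact: (bounded_linear0 Ca_lin).
have frac_lin a (x y : X) : Xa x -> Xa y -> a *: x + y = Ca (a *: frac x + frac y).
  move=> hx hy; rewrite (bounded_linearD _ _ Ca_lin) (bounded_linearZ _ _ Ca_lin).
  by rewrite !fracK.
split; last first.
  by move=> x hx /eqP; rewrite normr_eq0 => /eqP fx; rewrite -(fracK hx) fx Ca0.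
split=> [||x _|a x hx|x y hx hy].
- by rewrite -Ca0.
- by move=> a x y hx hy; rewrite frac_lin.
- exact: normr_ge0.
- by rewrite -[a *: x]addr0 -Ca0 frac_lin// !frac_Ca addr0 normrZ.
- by rewrite -[x]scale1r frac_lin// scale1r frac_Ca scale1r ler_normD.
Qed.

Let flow_continuous (x : X) u t e : Xa x -> Linf u -> Ico0 (tmax x u) t -> 0 < e ->
  exists2 d, 0 < d & forall s, Ico0 (tmax x u) s -> `|s - t| < d ->
    `|frac (phi s x u - phi t x u)| < e.
Proof.
move=> hx Lu [t0 /ereal_sup_gt[_ [tau [tau0 hy] <-]]]; rewrite lte_fin => tt e0.
have ttau : (tau%:E < tmax x u)%E.
  by apply: (solvable_lt_time T_bound T_add T_seq T_cont c01 K_bound K_add F_cont F_lip F_zero (adm Lu)).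
have [cy _] := flow_solution T_bound T_id T_add c01 K_bound K_add F_lip (adm Lu) ttau.
have e2 : 0 < e / 2 by rewrite divr_gt0.
have t0t : 0 <= t <= tau by rewrite t0 ltW.
have [d d0 hd] := cy t t0t _ e2.
(* The bound tau - t keeps s below tau, inside the interval on which the solution is known to be
   continuous. *)
exists (Num.min d (tau - t)); first by rewrite lt_min d0 subr_gt0.
move=> s [s0 _]; rewrite lt_min => /andP[sd st].
rewrite /phi -(bounded_linearB _ _ Ca_lin) frac_Ca.
apply: (@le_lt_trans _ _ (e / 2)); last by rewrite ltr_pdivrMr// ltr_pMr// ltr1n.
apply: hd sd; rewrite s0/=; have := ler_norm (s - t); lra.
Qed.

Let blow_up (x : X) u : Xa x -> Linf u -> (tmax x u < +oo)%E ->
  `|frac (phi t x u)| @[t --> (fine (tmax x u))^'-] --> +oo.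
Proof.
move=> hx Lu fin; have t0 := tmax_gt0 x Lu.
have tE : tmax x u = (fine (tmax x u))%:E by rewrite fineK// ge0_fin_numE// ltW.
apply/cvgryPge => N.
have [d d0 hd] := flow_blow_up T_bound T_id T_add T_seq T_cont c01 K_bound K_add F_cont F_lip F_zero N (adm Lu) tE.
have f0 : 0 < fine (tmax x u) by rewrite -lte_fin -tE.
near=> t; rewrite /phi frac_Ca ltW//; apply: hd.
- by near: t; exact: nbhs_left_ge.
- by near: t; apply: nbhs_left_gt; rewrite ltrBlDr ltrDl.
- by near: t; exact: nbhs_left_lt.
Unshelve. all: by end_near. Qed.

Lemma mild_control_system : exists (tm : X -> (R -> U) -> \bar R) (phi : R -> X -> (R -> U) -> X),
  [/\ forall (x : X) u, Xa x -> Linf u ->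
        [/\ (0 < tm x u)%E, maximal x u (Ico0 (tm x u)) (fun t => phi t x u) &
          forall J y, maximal x u J y -> J = Ico0 (tm x u) /\ forall t, J t -> y t = phi t x u],
      control_system Xa (fun x : X => `|frac x|) (@Linf R U) (@Linf_norm R U)
        [set q | [/\ Xa q.1.2, Linf q.2 & Ico0 (tm q.1.2 q.2) q.1.1]] phi &
      forall (x : X) u, Xa x -> Linf u -> (tm x u < +oo)%E ->
        `|frac (phi t x u)| @[t --> (fine (tm x u))^'-] --> +oo].
Proof.
exists tmax, phi; split; last exact: blow_up.
  move=> x u hx Lu; split; first exact: tmax_gt0.
    exact: flow_maximal.
  by move=> J y; exact: maximal_flow.
split; [split|split; split].
- exact: Xa_normed.
- exact: Linf_seminormed.
- by move=> u tau Lu tau0; exact: Linf_shift.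
- by move=> u v t Lu Lv t0; exact: Linf_concat.
- by move=> t x u [/= hx Lu [t0 _]].
- by move=> t x u [/= hx Lu _]; exact: Xa_Ca.
- move=> x u hx Lu; exists (tmax x u); first exact: tmax_gt0.
  by move=> t; split=> [[]|h] //; split.
- move=> x u hx Lu; rewrite /phi /yflow.
  rewrite (flow_initial T_bound T_id T_add T_seq T_cont c01 K_bound K_add F_cont F_lip F_zero _ (adm Lu)).
  exact: fracK.
- move=> t x u v [/= hx Lu [t0 tt]] Lv [w [Lw wv wu]].
  have [_ Llin _ _ _] := Linf_seminormed U.
  have Lwv : Linf (w - v) by rewrite addrC -scaleN1r; exact: Llin.
  (* w equals u at every time of [0, t] and v almost everywhere. *)
  have uv : {ae mu, forall s, 0 <= s <= t -> u s = v s}.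
    have weq := Linf_norm_eq0 Lwv wv.
    apply: (aeS _ weq) => s h ss; rewrite -wu// h//.
    by case/andP: ss.
  have caus s : 0 <= s <= t -> (s%:E < tmax x v)%E /\ yflow x u s = yflow x v s.
    move=> /andP[s0 st].
    apply: (flow_causal T_bound T_id T_add T_seq T_cont c01 K_bound K_add F_cont F_lip F_zero (adm Lu) (adm Lv) s0).
      by apply: aeS uv => r h /andP[r0 rs]; apply: h; rewrite r0 (le_trans rs).
    by apply: le_lt_trans tt; rewrite lee_fin.
  split=> [s ss|]; last by rewrite /phi (caus t _).2// t0 lexx.
  have /andP[s0 _] := ss; have [sv _] := caus s ss.
  exact: (And3 hx Lv (conj s0 sv)).
- move=> t x u [/= hx Lu It] e e0; have [d d0 hd] := flow_continuous hx Lu It e0.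
  by exists d => // s [/= _ _ Is]; exact: hd.
- move=> x u t h hx Lu t0 h0 H.
  have th : 0 <= t + h <= t + h by rewrite addr_ge0/=.
  have [/= _ _ [_ tth]] := H (t + h) th.
  have := flow_cocycle T_bound T_id T_add c01 K_bound K_add F_lip (adm Lu) t0 h0 tth.
  rewrite -/(yflow x u t) => -[h1 h2].
  have fphi : frac (phi t x u) = yflow x u t by exact: frac_Ca.
  split.
    split => /=; [exact: Xa_Ca|by have [] := Linf_shift Lu t0|].
    by split => //; rewrite /tmax fphi.
  by rewrite {1}/phi {1}/yflow fphi /shift_input h2.
Qed.

End MildSolutionBridge.

(** * The concrete kernels and the control system *)

Theorem theorem4p8 (R : realType) (X U : completeNormedModType R)
  (DA : set X) (A : X -> X) (T : R -> X -> X)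
  (hA : generates_analytic_semigroup DA A T)
  (omega : R) (homega : (growth_bound T < omega%:E)%E)
  (* the extrapolation space X_{-1} and the semigroup T_{-1} on it *)
  (Xm1 : completeNormedModType R) (jm1 : {linear X -> Xm1})
  (hm1 : is_completion (Xpow_neg_norm T omega 1) jm1)
  (Tm1 : R -> Xm1 -> Xm1) (hTm1 : C0_semigroup Tm1)
  (hTm1T : forall t x, 0 <= t -> Tm1 t (jm1 x) = jm1 (T t x))
  (* (A1) *)
  (alpha : R) (halpha : 0 < alpha < 1)
  (* (A2), with X_{-1+alpha+eps} and its canonical map into X_{-1} *)
  (eps : R) (heps : 0 < eps) (haeps : alpha + eps < 1)
  (Xb : completeNormedModType R) (jb : {linear X -> Xb})
  (hb : is_completion (Xpow_neg_norm T omega (1 - (alpha + eps))) jb)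
  (incl : Xb -> Xm1) (hincl : bounded_operator incl)
  (hinclj : forall x, incl (jb x) = jm1 x)
  (B : U -> Xb) (hB : bounded_operator B)
  (f : X -> U -> X)
  (* (A3) *)
  (hfC : forall x u, Xpow T omega alpha x -> forall e, 0 < e ->
     exists2 d, 0 < d & forall y v, Xpow T omega alpha y ->
       Xpow_norm T omega alpha (y - x) < d -> `|v - u| < d ->
       `|f y v - f x u| < e)
  (hfL : forall r, 0 < r -> exists2 L, 0 < L & forall x1 x2 u,
     Xpow T omega alpha x1 -> Xpow T omega alpha x2 ->
     Xpow_norm T omega alpha x1 < r -> Xpow_norm T omega alpha x2 < r ->
     `|u| < r ->
     `|f x1 u - f x2 u| <= L * Xpow_norm T omega alpha (x1 - x2))
  (* (A4) *)
  (hf4 : forall (u : R -> U) (x : R -> X), Linf u ->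
     {within `[0, +oo[, continuous x} ->
     (forall s, 0 < s -> Xpow T omega alpha (x s)) ->
     exists2 p, (1 - alpha)^-1 < p & Lp_loc p (fun s => f (x s) (u s)))
  (* (A5) *)
  (hf5 : exists (sigma : R -> R) (c : R), [/\ K_infty sigma, 0 < c &
     forall u, `|f 0 u| <= sigma `|u| + c]) :
  exists (tm : X -> (R -> U) -> \bar R) (phi : R -> X -> (R -> U) -> X),
  [/\ (* (i) *)
      forall x u, Xpow T omega alpha x -> Linf u ->
        let maximal := maximal_mild_solution (Xpow T omega alpha) T jm1 Tm1 f
                         (fun v => incl (B v)) x u in
        [/\ (0 < tm x u)%E,
            maximal (Ico0 (tm x u)) (fun t => phi t x u) &
            forall J y, maximal J y ->
              J = Ico0 (tm x u) /\ forall t, J t -> y t = phi t x u],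
      (* (ii) *)
      control_system (Xpow T omega alpha) (Xpow_norm T omega alpha)
        (@Linf R U) (@Linf_norm R U)
        [set q | [/\ Xpow T omega alpha q.1.2, Linf q.2 &
                     Ico0 (tm q.1.2 q.2) q.1.1]]
        phi &
      (* (iii) *)
      forall x u, Xpow T omega alpha x -> Linf u -> (tm x u < +oo)%E ->
        Xpow_norm T omega alpha (phi t x u) @[t --> (fine (tm x u))^'-]
          --> +oo].
Proof.
have [T_C0 _ T_an] := hA.
have [Tb T_id T_add T_cvg] := T_C0.
have /andP[a0 a1] := halpha.
(* The order of the negative norm in which B is bounded; alpha + beta = 1 - eps < 1 makes the kernel
   of the control term integrable. *)
set beta := 1 - (alpha + eps).
have b0 : 0 < beta by rewrite subr_gt0.
have ab1 : alpha + beta < 1 by rewrite /beta; lra.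
have hb01 : 0 < beta < 1 by rewrite b0 (le_lt_trans _ ab1)// lerDr ltW.
have hab01 : 0 < alpha + beta < 1 by rewrite ab1 addr_gt0.
have ha : 0 < alpha <= 1 by rewrite a0 ltW.
have hb' : 0 < beta <= 1 by case/andP: hb01 => -> /ltW.
have h1 : 0 < (1 : R) <= 1 by rewrite ltr01 lexx.
have [c c0 hc] := fracpow_neg_smoothing_add T_C0 T_an homega a0 b0 ab1.
pose G := smoothing T omega.
(* The factor c^-1 removes the constant of the composition law, so that the power of order -alpha
   maps K2 t exactly to G beta t. *)
pose K2 t x := c^-1 *: G (alpha + beta) t x.
have [Ca _ lC] := fracpow_neg_linear T_C0 homega ha.
have XnormE z : Xpow_norm T omega alpha (fracpow_neg T omega alpha z) = `|z|.
  by rewrite /Xpow_norm (fracpow_negK T_C0 homega).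
have [Cb _ lCb] := fracpow_neg_linear T_C0 homega hb'.
have [C1 _ lC1] := fracpow_neg_linear T_C0 homega h1.
(* J is the power of order -beta on the completion [Xb]; J \o B is thus a bounded operator into X
   that can replace B in the Volterra equation. *)
have [J lJ hJ] := isometric_extension lCb hb.1 hb.2.
have lj : bounded_linear C1 jm1 := fracpow_completion_bounded lC1 hm1.1.
have j_inj : injective jm1.
  move=> x y E; apply: (fracpow_neg_injective T_C0 homega h1); apply/eqP.
  by rewrite -subr_eq0 -(bounded_linearB _ _ lC1) -normr_eq0 -[`|_|]hm1.1 linearB E subrr normr0.
have T_bound := semigroup_bounded T_C0 homega.
have [CB CB0 lB] := bounded_operatorP hB.
have [Ci Ci0 li] := bounded_operatorP hincl.
have lb : bounded_linear (1 * CB) (J \o B) := bounded_linear_comp ler01 lJ lB.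
have CK2 t x : 0 < t -> fracpow_neg T omega alpha (K2 t x) = G beta t x.
  by move=> t0; rewrite /K2 (bounded_linearZ _ _ lC) hc// scalerA mulVf// scale1r.
have jK2 t v : 0 < t -> jm1 (fracpow_neg T omega alpha (K2 t ((J \o B) v))) = Tm1 t (incl (B v)).
  move=> t0; rewrite CK2//=.
  have [k k0 /(_ t)] := smoothing_bounded T_C0 T_an homega t hb01.
  rewrite t0 lexx => /(_ isT) lG.
  have [tb _ _ _] := hTm1; have [Ct _ lTm] := bounded_operatorP (tb t (ltW t0)).
  have Ct0 : 0 <= `|Ct| by [].
  have lA := bounded_linear_comp Ct0 (bounded_linear_ge0 lTm) li.
  (* Both sides are bounded and linear in B v, so it is enough to compare them on the dense image of
     X, where J is the power of order -beta and the claim reads (omega I - A)^beta T(t) (omega I -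
     A)^(-beta) x = T(t) x. *)
  have lD := bounded_linear_comp (normr_ge0 _) (bounded_linear_ge0 lj)
    (bounded_linear_comp (normr_ge0 _) (bounded_linear_ge0 lG) lJ).
  apply/esym; apply: (dense_bounded_linear_eq hb.2 lA lD) => x /=.
  rewrite hinclj hTm1T ?(ltW t0)//; congr (jm1 _).
  rewrite hJ; apply: (fracpow_neg_injective T_C0 homega hb').
  by rewrite fracpow_neg_smoothing// fracpow_neg_comm// ltW.
apply: (@mild_control_system R X U Xm1 T Tm1 jm1 (fun v => incl (B v)) (G alpha) K2 alpha (alpha + beta)
  (fracpow_neg T omega alpha) (fracpow T omega alpha) (Xpow T omega alpha) f (J \o B) C1 Ca (1 * CB)).
- exact: T_bound.
- exact: T_id.
- by move=> t s x t0 s0; exact: T_add.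
- exact: (semigroup_sequential T_C0 homega).
- exact: (semigroup_continuous T_C0 homega).
- exact: halpha.
- exact: hab01.
- by move=> tau; exact: smoothing_bounded.
- move=> tau; have [k k0 hk] := smoothing_bounded T_C0 T_an homega tau hab01.
  exists (`|c^-1| * k); first by rewrite mulr_ge0.
  move=> s hs; rewrite -mulrA.
  exact: (bounded_linear_comp (normr_ge0 _) (bounded_linear_scale X c^-1) (hk s hs)).
- by move=> h s x h0 s0; exact: smoothing_add.
- move=> h s x h0 s0; rewrite /K2; have [M _ hM] := T_bound h.
  have lT : bounded_linear M (T h) by apply: hM; rewrite h0 lexx.
  by rewrite (bounded_linearZ _ _ lT) smoothing_add.
- exact: lC.
- by move=> x y; exact: (fracpow_neg_injective T_C0 homega ha).
- by move=> t x t0; exact: (fracpow_neg_comm T_C0 homega).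
- by move=> x; exact: fracpowK.
- by move=> x; exact: Xpow_fracpow_neg.
- by move=> t x t0; exact: fracpow_neg_smoothing.
- exact: lj.
- exact: j_inj.
- exact: lb.
- exact: jK2.
- move=> x v e e0; have [d d0 hd] := hfC _ v (Xpow_fracpow_neg T omega alpha x) _ e0.
  exists d => // x' v' xd vd; apply: hd => //; first exact: Xpow_fracpow_neg.
  by rewrite -(bounded_linearB _ _ lC) XnormE.
- move=> r r0; have [L L0 hL] := hfL _ r0; exists L => // x x' v xr xr' vr.
  have Xx := Xpow_fracpow_neg T omega alpha.
  rewrite -(XnormE x) in xr; rewrite -(XnormE x') in xr'.
  have H := hL _ _ v (Xx x) (Xx x') xr xr' vr.
  by rewrite -(XnormE (x - x')) (bounded_linearB x x' lC).
- move=> r; have [sigma [k [[_ _ smon _] k0 hk]]] := hf5.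
  (* Monotonicity of sigma turns (A5) into a bound on each ball of inputs; the absolute value makes
     the witness nonnegative also for r < 0, where no v is concerned. *)
  exists (`|sigma r| + k); first by rewrite addr_ge0// ltW.
  move=> v vr; rewrite (bounded_linear0 lC) (le_trans (hk v))// lerD2r.
  by rewrite (le_trans (ltW (smon _ _ (normr_ge0 v) vr)))// ler_norm.
- exact: hf4.
- by move=> x; exact: (fracpow_negK T_C0 homega).
Qed.
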